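(* Let $\mu$ be a fixed positive integer and let $q$ be a fixed odd prime power. Then, as $g\to\infty$ through positive integers, \begin{align*} \sum_{D\in\mathcal H_{2g+1}} \frac{L^{(\mu)}(\tfrac{1}{2},\chi_{D})}{(\ln q)^{\mu}} &= \frac{(-2)^{\mu}|D|}{\zeta_{\mathbb{A}}(2)} \left(G(1)J_{\mu}([\tfrac{g}{2}]) + \frac{G^{(\mu)}(1)}{(-\ln q)^{\mu}}\right) - \frac{(-2)^{\mu}|D|}{\zeta_{\mathbb{A}}(2)}\sum_{n=1}^{\mu+1} j_{\mu}(n)\frac{G^{(n)}(1)}{(-\ln q)^{n}} \\ &\quad+ \frac{2^{\mu}|D|}{\zeta_{\mathbb{A}}(2)} \sum_{m=0}^{\mu} \binom{\mu}{m} (-g)^{\mu-m}\left(G(1)J_{m}([\tfrac{g-1}{2}]) + \frac{G^{(m)}(1)}{(-\ln q)^{m}}\right) \\ &\quad- \frac{2^{\mu}|D|}{\zeta_{\mathbb{A}}(2)} \sum_{m=0}^{\mu}\binom{\mu}{m} (-g)^{\mu-m} \sum_{n=1}^{m+1} j_{m}(n)\frac{G^{(n)}(1)}{(-\ln q)^{n}} + O\left(|D|^{\frac{7}{8}} (\log_{q}|D|)^{\mu}\right), \end{align*} where on the right-hand side $|D|$ denotes the number $q^{2g+1}$ (so $\log_q|D|=2g+1$), and the implied constant may depend on $q$ and $\mu$ but not on $g$.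
   Context: $\mathbb{F}_q$ is a finite field with $q$ elements, $q$ odd; $\mathbb{A}=\mathbb{F}_q[t]$; $\mathbb{A}^+$ is the set of monic polynomials in $\mathbb{A}$, and $\mathbb{A}^+_n$ the set of monic polynomials of degree $n$. $\mathcal H_n$ is the set of monic square-free polynomials of degree $n$. For $f\in\mathbb{A}$, $|f|=q^{\deg f}$ if $f\neq 0$ and $|0|=0$. $\zeta_{\mathbb{A}}(s)=\frac{1}{1-q^{1-s}}$, so $\zeta_{\mathbb{A}}(2)=\frac{1}{1-q^{-1}}$. For $D$ monic square-free, $\chi_D(f)=\left(\frac{D}{f}\right)$ for $f\in\mathbb{A}^+$ is the quadratic residue symbol: completely multiplicative in $f$, and for $P$ monic irreducible, $\chi_D(P)=0$ if $P\mid D$, $1$ if $P\nmid D$ and $D$ is a square modulo $P$, and $-1$ if $P\nmid D$ and $D$ is a non-square modulo $P$. The $L$-function is $L(s,\chi_D)=\sum_{f\in\mathbb{A}^+}\chi_D(f)|f|^{-s}$ for $\mathrm{Re}(s)>1$; for $D\in\mathcal H_{2g+1}$ it equals the polynomial in $q^{-s}$ given by $\sum_{n=0}^{2g}\left(\sum_{f\in\mathbb{A}^+_n}\chi_D(f)\right)q^{-ns}$, which defines it for all complex $s$. $L^{(\mu)}(s,\chi_D)$ is the $\mu$-th derivative with respect to $s$. For integers $k\ge 0$, $n\ge 0$, $J_k(n)=\sum_{\ell=1}^n \ell^k$, which is a polynomial in $n$ of degree $k+1$ with zero constant term; its coefficients $j_k(m)$ are defined by $J_k(n)=\sum_{m=1}^{k+1}j_k(m)n^m$.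 $[x]$ is the integer part of $x$. $G(s)=\sum_{L\in\mathbb{A}^+}\frac{\mu(L)}{|L|^s\prod_{P\mid L}(1+|P|)}$, where $\mu(L)$ (with a polynomial argument) is the Möbius function on monic polynomials and $P$ runs over the monic irreducible divisors of $L$; $G^{(m)}$ is its $m$-th derivative, so $\frac{G^{(m)}(s)}{(-\ln q)^m}=\sum_{L\in\mathbb{A}^+}\frac{\mu(L)\deg(L)^m}{|L|^s\prod_{P\mid L}(1+|P|)}$ (with $0^0=1$). *)

(* Defs.v *)
From HB Require Import structures.
From mathcomp Require Import all_boot all_order all_algebra.
From mathcomp Require Import complex.
From mathcomp Require Import all_classical all_reals all_analysis.

Set Implicit Arguments.
Unset Strict Implicit.
Unset Printing Implicit Defensive.

Import Order.TTheory GRing.Theory Num.Theory.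
Import numFieldNormedType.Exports.

Local Open Scope classical_set_scope.
Local Open Scope complex_scope.
Local Open Scope ring_scope.

Section ComplexPowers.
Variable R : realType.
Implicit Types (x : R) (s z : R[i]).

Definition cexp z : R[i] :=
  let: a +i* b := z in (expR a)%:C * (cos b +i* sin b).

(* meaningful for 0 < x only *)
Definition cpow x s : R[i] := cexp (s * (ln x)%:C).

End ComplexPowers.

Section Polynomials.
Variable F : finFieldType.
Implicit Types (f D P L : {poly F}) (n : nat).

Definition pnorm f : nat := if f == 0 then 0%N else (#|F| ^ (size f).-1)%N.

Definition monic_deg n : set {poly F} :=
  [set f | f \is monic /\ size f = n.+1].

Definition square_free f : Prop :=
  forall u : {poly F}, size u != 1%N -> ~~ (u ^+ 2 %| f).

Definition monic_squarefree n : set {poly F} :=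
  [set D | monic_deg n D /\ square_free D].

Definition prime_divisors f : set {poly F} :=
  [set P | [/\ P \is monic, irreducible_poly P & P %| f]].

Definition is_square_mod P D : Prop := exists h : {poly F}, P %| h ^+ 2 - D.

Definition legendre D P : int :=
  if P %| D then 0 else if `[< is_square_mod P D >] then 1 else -1.

(* multiplicity of P in f, for f nonzero and P nonconstant: then P ^+ k %| f
   forces k < size f *)
Definition pmult P f : nat := \max_(k < size f | P ^+ k %| f) k.

(* the completely multiplicative extension of legendre D to monic f *)
Definition chi D f : int :=
  \big[*%R/1]_(P \in prime_divisors f) legendre D P ^+ pmult P f.

Definition pmobius L : int :=
  if `[< square_free L >] then \big[*%R/1]_(P \in prime_divisors L) (-1 : int)
  else 0.

End Polynomials.

Arguments monic_deg : clear implicits.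
Arguments monic_squarefree : clear implicits.

Section LFunctions.
Variables (R : realType) (F : finFieldType).

Definition zetaA (s : R[i]) : R[i] := (1 - cpow #|F|%:R (1 - s))^-1.

(* For D of degree d this is the sum over 0 <= n < d, that is n <= 2g when
   d = 2g + 1.  The codomain is R[i]^o because derive1n expects a normed
   module over the scalar field R[i]. *)
Definition Lchi (D : {poly F}) (s : R[i]) : R[i]^o :=
  \sum_(n < (size D).-1)
    (\sum_(f \in monic_deg F n) chi D f)%:~R * cpow #|F|%:R (- (n%:R * s)).

Definition Gterm (s : R[i]) (L : {poly F}) : R[i] :=
  (pmobius L)%:~R / (cpow (pnorm L)%:R s *
    \big[*%R/1]_(P \in prime_divisors L) (1 + (pnorm P)%:R : R[i])).

(* The sum over all monic L is taken degree by degree; it converges absolutely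
   for 0 < 'Re s, so that the order of summation does not matter there. *)
Definition Gseries (s : R[i]) : R[i]^o :=
  limn (series (fun n => \sum_(L \in monic_deg F n) Gterm s L) : nat -> R[i]^o).

End LFunctions.

Definition powersum (k n : nat) : nat := \sum_(1 <= l < n.+1) l ^ k.

Section PowerSumCoefficients.

Let polyfun (d : nat) (f : nat -> rat) := exists c : nat -> rat,
  forall n, f n = \sum_(1 <= m < d.+2) c m * n%:R ^+ m.

Let polyfunD d f g : polyfun d f -> polyfun d g ->
  polyfun d (fun n => f n + g n).
Proof.
move=> [c cE] [e eE]; exists (fun m => c m + e m) => n.
by rewrite cE eE -big_split; apply: eq_bigr => m _; rewrite mulrDl.
Qed.

Let polyfunZ d a f : polyfun d f -> polyfun d (fun n => a * f n).
Proof.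
move=> [c cE]; exists (fun m => a * c m) => n.
by rewrite cE mulr_sumr; apply: eq_bigr => m _; rewrite mulrA.
Qed.

Let polyfun_leq d e f : (d <= e)%N -> polyfun d f -> polyfun e f.
Proof.
move=> le_de [c cE]; exists (fun m => if (m < d.+2)%N then c m else 0) => n.
rewrite cE [RHS](@big_cat_nat _ _ _ d.+2) //=.
rewrite [X in _ + X]big_nat [X in _ + X]big1 ?addr0; last first.
  by move=> m /andP[dm _]; rewrite ltnNge dm mul0r.
by apply: eq_big_nat => m /andP[_ ->].
Qed.

Let polyfun_sum d (f : nat -> nat -> rat) k :
  (forall i, (i < k)%N -> polyfun d (f i)) ->
  polyfun d (fun n => \sum_(i < k) f i n).
Proof.
elim: k => [_|k IHk fP].
  exists (fun=> 0) => n; rewrite big_ord0 big1 // => m _.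
  by rewrite mul0r.
have [c cE] := polyfunD (IHk (fun i ik => fP i (ltnW ik))) (fP k (ltnSn k)).
by exists c => n; rewrite big_ord_recr /= cE.
Qed.

Let powersum_rec k n : (k.+1)%:R * (powersum k n)%:R =
  (n.+1%:R ^+ k.+1 - 1) - \sum_(i < k) 'C(k.+1, i)%:R * (powersum i n)%:R :> rat.
Proof.
apply/eqP; rewrite eq_sym subr_eq.
have -> : k.+1%:R * (powersum k n)%:R
    + \sum_(i < k) 'C(k.+1, i)%:R * (powersum i n)%:R
  = \sum_(i < k.+1) 'C(k.+1, i)%:R * (powersum i n)%:R :> rat.
  by rewrite big_ord_recr /= binSn addrC.
apply/eqP; elim: n => [|n IHn].
  rewrite expr1n subrr big1 // => i _.
  by rewrite /powersum big_geq ?mulr0.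
have psS i : powersum i n.+1 = (powersum i n + n.+1 ^ i)%N.
  by rewrite /powersum big_nat_recr.
under eq_bigr do rewrite psS natrD mulrDr natrX.
rewrite big_split /= -IHn -[n.+2]add1n natrD exprDn big_ord_recr /=.
rewrite subnn expr0 mul1r binn mulr1n.
under eq_bigr do rewrite expr1n mul1r -mulr_natl.
by rewrite mulr1n -addrA addrC.
Qed.

Lemma powersum_coef_exists k : exists j : nat -> rat, forall n,
  (powersum k n)%:R = \sum_(1 <= m < k.+2) j m * n%:R ^+ m.
Proof.
elim/ltn_ind: k => k IH.
suff [c cE] : polyfun k (fun n => (k.+1%:R)^-1 *
    (((n.+1)%:R ^+ k.+1 - 1) +
     (-1) * \sum_(i < k) 'C(k.+1, i)%:R * (powersum i n)%:R)).
  by exists c => n; rewrite -cE mulN1r -powersum_rec mulKf ?pnatr_eq0.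
apply/polyfunZ/polyfunD; last first.
  apply/polyfunZ.
  apply: (polyfun_sum (f := fun i n => 'C(k.+1, i)%:R * (powersum i n)%:R)).
  move=> i ik.
  by apply/polyfunZ/(polyfun_leq (ltnW ik))/IH.
exists (fun m => 'C(k.+1, m)%:R) => n.
rewrite -addn1 natrD [_ + 1]addrC exprDn big_ord_recl /= expr0 mulr1 bin0 expr1n.
rewrite mulr1n addrC addKr big_add1 /= big_mkord; apply: eq_bigr => i _.
by rewrite expr1n mul1r mulr_natl.
Qed.

End PowerSumCoefficients.

(* determined for 1 <= m <= k + 1 by powersum_coefE *)
Definition powersum_coef (k : nat) : nat -> rat :=
  projT1 (cid (powersum_coef_exists k)).

Lemma powersum_coefE k n :
  (powersum k n)%:R =
    \sum_(1 <= m < k.+2) powersum_coef k m * n%:R ^+ m :> rat.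
Proof. exact: (projT2 (cid (powersum_coef_exists k))). Qed.

(* Main.v *)
From HB Require Import structures.
Require Import Defs.
From mathcomp Require Import all_boot all_order all_algebra all_fingroup all_solvable all_field all_character.
From mathcomp Require Import complex.
From mathcomp Require Import all_classical all_reals all_analysis.
From mathcomp Require Import ring lra zify.
Set Implicit Arguments.
Unset Strict Implicit.
Unset Printing Implicit Defensive.
Import Order.TTheory GRing.Theory Num.Theory.
Import numFieldNormedType.Exports.
Local Open Scope classical_set_scope.
Local Open Scope complex_scope.
Local Open Scope ring_scope.

(* Over F_q[t] everything reduces to finite sums.  Write N = 2g + 1.  The symbol
   (D/f) is a power of the resultant of D and f, which gives bimultiplicativity,
   periodicity and reciprocity.  For square-free f, completing the sum of (D/f)
   over monic D of degree b by the Gauss sum attached to the additive character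
   psi (coefficient of t^(deg f - 1) of x mod f) gives the Polya-Vinogradov bound
   q^(deg f / 2); removing square factors one prime at a time extends it to all
   nonsquare f.  The same completion, applied to the modulus D, yields the
   functional equation A_(2g-n) = q^(g-n) A_n for A_n = sum of (D/f) over monic f
   of degree n; its sign is read off from the exact average of A_2g over all D.

   Folding the L-polynomial at n = g leaves only deg f <= g.  Nonsquare f, after a
   Moebius sieve for square-free D, contribute O(q^(7g/4)): a sieve term of degree
   a is at most q^a min(q^(N-2a), q^(deg f / 2)).  A square f = l^2 counts the
   square-free D prime to l, with density (1 - 1/q) / prod_(P | l) (1 + 1/|P|);
   expanding it and summing by parts against powers of deg l produces J_mu, its
   coefficients, and the series G and its derivatives at 1.

   Derivatives in s are computed termwise through the quadratic remainder
   |exp(w) - 1 - w| <= 4 |w|^2 exp |w| under geometric domination. *)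

(** * Monic polynomials and Möbius sums *)

(** The exponent 7/8 comes from the nonsquare f. There are at most q^n of degree n; the two bounds
    for a sieve term balance at a = g - n/4 and give q^(g + n/4) for each f, and the weight q^(-n/2)
    brings the total to q^(g + 3n/4). Folding caps n at g, hence q^(7g/4); with n running up to 2g
    the same bound would exceed the main term. The errors from square f are smaller: 4^g times a
    power of g from counting, and a tail of G. The Gauss sum is known only in absolute value, which
    leaves the functional equation with an unknown sign. The average of A_2g over D is as large as
    A_2g <= q^g allows, and this forces equality for each square-free D. *)

Section Enumeration.
Variable F : finFieldType.
Implicit Types (f g h p A B D E P : {poly F}).

(** Finite sets of polynomials are duplicate-free lists, so that a change of variables is a
    [perm_eq]. *)
Definition polys n : seq {poly F} := [seq polyn u | u <- enum {poly_n F}].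

Lemma mem_polys n p : (p \in polys n) = (size p <= n)%N.
Proof.
apply/mapP/idP => [[u _ ->]|sp]; first exact: size_npoly.
by exists (npolyp n p); rewrite ?mem_enum //= npolypK.
Qed.

Lemma polys_uniq n : uniq (polys n).
Proof. by rewrite map_inj_uniq ?enum_uniq //; apply: val_inj. Qed.

Lemma size_polys n : size (polys n) = (#|F| ^ n)%N.
Proof. by rewrite size_map -cardE card_npoly. Qed.

Definition monics n : seq {poly F} := [seq 'X^n + p | p <- polys n].

Lemma mem_monics n f : (f \in monics n) = (f \is monic) && (size f == n.+1).
Proof.
apply/mapP/andP => [[p]|[fm /eqP sf]].
  rewrite mem_polys => sp ->.
  have lt : (size p < size ('X^n : {poly F}))%N by rewrite size_polyXn.
  by rewrite size_polyDl // size_polyXn qualifE /= lead_coefDl // lead_coefXn.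
exists (f - 'X^n); last by rewrite addrC subrK.
rewrite mem_polys; apply/leq_sizeP => j; rewrite leq_eqVlt => /predU1P[<-|nj].
  by rewrite coefB coefXn eqxx; move/monicP: fm; rewrite lead_coefE sf /= => ->; rewrite subrr.
by rewrite coefB coefXn gtn_eqF // subr0 nth_default // sf.
Qed.

Lemma monics_uniq n : uniq (monics n).
Proof. by rewrite map_inj_uniq ?polys_uniq //; apply: addrI. Qed.

Lemma size_monics n : size (monics n) = (#|F| ^ n)%N.
Proof. by rewrite size_map size_polys. Qed.

Lemma monics0 : monics 0 = [:: 1].
Proof.
have : size (monics 0) = 1%N by rewrite size_monics.
have : 1 \in monics 0 by rewrite mem_monics monic1 size_poly1.
by case: (monics 0) => [|x [|y s]] //=; rewrite inE => /eqP <-.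
Qed.

Lemma monicsP n f : reflect (f \is monic /\ size f = n.+1) (f \in monics n).
Proof. by rewrite mem_monics; apply: (iffP andP) => -[-> /eqP]. Qed.

Lemma fsbig_monics (R : Type) (idx : R) (op : Monoid.com_law idx) n (G : {poly F} -> R) :
  \big[op/idx]_(f \in monic_deg F n) G f = \big[op/idx]_(f <- monics n) G f.
Proof.
rewrite [RHS]fsbig_seq ?monics_uniq //.
congr (\big[op/idx]_(f \in _) _); apply/seteqP; split=> f /=.
  by move=> -[fm sf]; apply/monicsP.
by move/monicsP => [].
Qed.

Definition sqfree f := `[< square_free f >].

Lemma fsbig_monic_squarefree (R : Type) (idx : R) (op : Monoid.com_law idx) n (G : {poly F} -> R) :
  \big[op/idx]_(f \in monic_squarefree F n) G f = \big[op/idx]_(f <- monics n | sqfree f) G f.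
Proof.
rewrite -[RHS]big_filter [RHS]fsbig_seq ?filter_uniq ?monics_uniq //.
congr (\big[op/idx]_(f \in _) _); apply/seteqP; split=> f /=.
  by move=> -[[fm sf] sq]; rewrite mem_filter; apply/andP; split; [exact/asboolP|exact/monicsP].
by rewrite mem_filter => /andP[/asboolP ? /monicsP[]].
Qed.

Definition mirr P := (P \is monic) && `[< irreducible_poly P >].

Lemma mirrP P : reflect (P \is monic /\ irreducible_poly P) (mirr P).
Proof. by apply: (iffP andP) => -[Pm /asboolP]. Qed.

Lemma mirr_monic P : mirr P -> P \is monic. Proof. by case/andP. Qed.

Lemma mirr_size P : mirr P -> (1 < size P)%N.
Proof. by move/mirrP => [_ []]. Qed.

Lemma mirr_neq0 P : mirr P -> P != 0.
Proof. by move/mirr_monic/monic_neq0. Qed.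

Lemma mirr_coprime P f : mirr P -> coprimep P f = ~~ (P %| f).
Proof. by move/mirrP => [_ Pi]; rewrite irreducible_poly_coprime. Qed.

Lemma mirr_dvdM P f g : mirr P -> (P %| f * g) = (P %| f) || (P %| g).
Proof.
move=> Pi; case: (boolP (P %| f)) => [Pf|nPf]; first by rewrite dvdp_mulr.
by rewrite Gauss_dvdpr // mirr_coprime.
Qed.

Lemma mirr_dvd1 P : mirr P -> (P %| 1) = false.
Proof. by move=> Pi; rewrite dvdp1 gtn_eqF ?mirr_size. Qed.

Lemma mirr_eq P Q : mirr P -> mirr Q -> (P %| Q) = (P == Q).
Proof.
move=> Pi Qi; apply/idP/eqP => [PQ|->]; last exact: dvdpp.
have /mirrP[_ [_ Qirr]] := Qi.
have := Qirr P; rewrite gtn_eqF ?mirr_size // => /(_ isT PQ).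
by rewrite eqp_monic ?mirr_monic // => /eqP.
Qed.

Lemma monic_size_gt0 f : f \is monic -> (0 < size f)%N.
Proof. by move=> fm; rewrite lt0n size_poly_eq0 monic_neq0. Qed.

Lemma monic_size1 f : f \is monic -> size f = 1%N -> f = 1.
Proof. by move=> fm sf; have := mem_monics 0 f; rewrite fm sf eqxx monics0 inE => /eqP. Qed.

Lemma exists_mirr f : f \is monic -> f != 1 -> exists2 P, mirr P & P %| f.
Proof.
have [n] := ubnP (size f); elim: n f => // n IH f; rewrite ltnS => sf fm f1.
have sf1 : (1 < size f)%N.
  rewrite ltn_neqAle monic_size_gt0 // andbT eq_sym.
  by apply: contra f1 => /eqP s1; rewrite (monic_size1 fm s1).
case: (boolP (mirr f)) => [fi|]; first by exists f.
rewrite /mirr fm /= => /asboolP nf.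
have [u [u1 uf uNf]] : exists u : {poly F}, [/\ size u != 1%N, u %| f & ~~ (u %= f)].
  apply/not_existsP => H; apply: nf; split=> // u u1 uf.
  by apply: contrapT => /negP uNf; apply: (H u).
have u0 : u != 0.
  by apply: contraNneq (monic_neq0 fm) => u0; move: uf; rewrite u0 dvd0p.
have lu : lead_coef u != 0 by rewrite lead_coef_eq0.
pose v := (lead_coef u)^-1 *: u.
have sv : size v = size u by rewrite size_scale // invr_eq0.
have vf : v %| f by rewrite dvdpZl // invr_eq0.
have vm : v \is monic by rewrite qualifE /= lead_coefZ mulVf.
have [||P Pi Pv] := IH v _ vm.
- rewrite sv (leq_trans _ sf) // ltn_neqAle dvdp_leq ?monic_neq0 // andbT.
  by apply: contra uNf => /eqP e; rewrite -dvdp_size_eqp // e.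
- by apply: contra u1 => /eqP v1; rewrite -sv v1 size_poly1.
by exists P => //; apply: dvdp_trans vf.
Qed.

(** Peels off one prime factor at a time; multiplicative identities below are proved this way rather
    than from a full factorization. *)
Lemma monic_ind (T : {poly F} -> Prop) :
  T 1 -> (forall P f, mirr P -> f \is monic -> T f -> T (P * f)) ->
  forall f, f \is monic -> T f.
Proof.
move=> T1 TM f; have [n] := ubnP (size f); elim: n f => // n IH f; rewrite ltnS => sf fm.
have [->//|f1] := eqVneq f 1.
have [P Pi /dvdpP[g fE]] := exists_mirr fm f1.
have gm : g \is monic by move: fm; rewrite fE (monicMr _ (mirr_monic Pi)).
rewrite fE mulrC; apply: TM => //; apply: IH => //.
apply: leq_trans sf; rewrite fE size_Mmonic ?monic_neq0 // ?mirr_monic //.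
by have := mirr_size Pi; have := monic_size_gt0 gm; lia.
Qed.

Lemma size_monicM f g : f \is monic -> g \is monic -> size (f * g) = (size f + size g).-1.
Proof. by move=> fm gm; rewrite size_Mmonic ?monic_neq0. Qed.

Lemma monics_dvd e k E : E \in monics e ->
  perm_eq [seq f <- monics k | E %| f]
          (if (e <= k)%N then [seq E * l | l <- monics (k - e)] else [::]).
Proof.
move=> /monicsP[Em sE].
have E0 := monic_neq0 Em.
case: leqP => [ek|ke]; last first.
  rewrite (@eq_in_filter _ _ pred0) ?filter_pred0 // => f /monicsP[fm sf] /=.
  by apply/negP => /dvdp_leq; rewrite monic_neq0 // sE sf ltnS leqNgt ke => /(_ isT).
apply: uniq_perm; rewrite ?filter_uniq ?monics_uniq //.
  by rewrite map_inj_uniq ?monics_uniq //; apply: mulfI.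
move=> f; rewrite mem_filter; apply/andP/mapP => [[/dvdpP[l ->]]|[l /monicsP[lm sl] ->]].
  move/monicsP => [lE]; have lm : l \is monic by rewrite monicMr in lE.
  rewrite size_monicM // => sl; exists l; rewrite 1?mulrC //.
  by apply/monicsP; split=> //; rewrite sE in sl; have := monic_size_gt0 lm; lia.
split; first exact: dvdp_mulr.
apply/monicsP; split; first by rewrite monicMl.
by rewrite size_monicM // sE sl; lia.
Qed.

Lemma sum_monics_dvd (V : nmodType) e k E (G : {poly F} -> V) : E \in monics e ->
  \sum_(f <- monics k | E %| f) G f =
  if (e <= k)%N then \sum_(l <- monics (k - e)) G (E * l) else 0.
Proof.
move=> Ee; rewrite -big_filter (perm_big _ (monics_dvd k Ee)).
by case: ifP; rewrite ?big_nil ?big_map.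
Qed.

(** One index list containing the monic divisors of every nonzero polynomial of degree at most n, so
    that sums over divisors and over multiples can be exchanged. *)
Definition monics_le n := [seq f <- polys n.+1 | f \is monic].

Lemma mem_monics_le n f : (f \in monics_le n) = (f \is monic) && (size f <= n.+1)%N.
Proof. by rewrite mem_filter mem_polys. Qed.

Lemma monics_le_uniq n : uniq (monics_le n).
Proof. by rewrite filter_uniq ?polys_uniq. Qed.

Lemma sum_monics_le (V : nmodType) n (Q : pred {poly F}) (G : {poly F} -> V) :
  \sum_(f <- monics_le n | Q f) G f = \sum_(a < n.+1) \sum_(f <- monics a | Q f) G f.
Proof.
pose d f : 'I_n.+1 := inord (size f).-1.
transitivity (\sum_(a < n.+1) \sum_(f <- monics_le n | Q f && (d f == a)) G f).
  exact: (partition_big d).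
apply: eq_bigr => a _; rewrite -big_filter -[RHS]big_filter.
apply/perm_big/uniq_perm; rewrite ?(filter_uniq, monics_uniq, monics_le_uniq, polys_uniq) //.
move=> f; rewrite mem_filter mem_monics_le [RHS]mem_filter mem_monics -!andbA.
case: (Q f) => //=; case: (boolP (f \is monic)) => fm //=; rewrite ?andbF //=.
have sf := monic_size_gt0 fm.
have [sfn|sfn] := leqP (size f) n.+1; rewrite ?andbT ?andbF.
  by rewrite -val_eqE /d /=; move: sf sfn; case: (size f) => // m _ sfn; rewrite inordK.
by apply/esym/negbTE; move: (ltn_ord a) sfn; case: (size f) => // m; lia.
Qed.

End Enumeration.

(** * Prime divisors, multiplicities and Möbius cancellation *)

Section PrimeDivisors.
Variable F : finFieldType.
Implicit Types (f g h p A B D E P Q : {poly F}).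

(** Any n bounding the degree is allowed, so the prime divisors of two polynomials can be taken from
    one common list. *)
Lemma fsbig_prime_divisors (R : Type) (idx : R) (op : Monoid.com_law idx) n f
    (G : {poly F} -> R) : f != 0 -> (size f <= n.+1)%N ->
  \big[op/idx]_(P \in prime_divisors f) G P =
  \big[op/idx]_(P <- monics_le F n | mirr P && (P %| f)) G P.
Proof.
move=> f0 sf; rewrite -[RHS]big_filter [RHS]fsbig_seq ?(filter_uniq, monics_le_uniq, polys_uniq) //.
congr (\big[op/idx]_(i \in _) _); apply/seteqP; split=> P /=.
  move=> [Pm Pi Pf]; rewrite mem_filter mem_monics_le Pm Pf (leq_trans (dvdp_leq f0 Pf) sf) !andbT.
  exact/mirrP.
by rewrite mem_filter => /andP[/andP[/mirrP[Pm Pi] Pf] _].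
Qed.

Lemma prime_divisors1 : prime_divisors (1 : {poly F}) = set0.
Proof.
apply/seteqP; split=> P //= [Pm Pi P1].
by have := mirr_dvd1 (introT (mirrP _) (conj Pm Pi)); rewrite P1.
Qed.

Lemma fsbig_prime_divisorsM (R : Type) (idx : R) (op : Monoid.com_law idx) P f
    (G : {poly F} -> R) : mirr P -> f \is monic -> ~~ (P %| f) ->
  \big[op/idx]_(Q \in prime_divisors (P * f)) G Q =
  op (G P) (\big[op/idx]_(Q \in prime_divisors f) G Q).
Proof.
move=> Pi fm nPf; have f0 := monic_neq0 fm; have P0 := mirr_neq0 Pi.
have Pf0 : P * f != 0 by rewrite mulf_neq0.
pose n := size (P * f).
rewrite !(@fsbig_prime_divisors _ _ _ n) //; last first.
  by rewrite (leq_trans (dvdp_leq Pf0 (dvdp_mull P (dvdpp f)))).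
rewrite big_mkcond (bigD1_seq P) ?(filter_uniq, monics_le_uniq, polys_uniq) //=; last first.
  by rewrite mem_monics_le mirr_monic // (leq_trans (dvdp_leq Pf0 (dvdp_mulr f (dvdpp P)))).
rewrite Pi dvdp_mulr //=; congr (op _ _).
rewrite big_mkcond [RHS]big_mkcond; apply: eq_bigr => Q _.
have [->|QP] := eqVneq Q P; first by rewrite (negbTE nPf) andbF.
case: (boolP (mirr Q)) => Qi //=.
by rewrite mirr_dvdM // mirr_eq // (negbTE QP).
Qed.

(** Fixes [pmult] through all its lower bounds; equalities of multiplicities then reduce to
    divisibility for each k. *)
Lemma leq_pmult P f k : f != 0 -> (1 < size P)%N -> (k <= pmult P f)%N = (P ^+ k %| f).
Proof.
move=> f0 sP; have P0 : P != 0 by rewrite -size_poly_gt0 ltnW.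
apply/idP/idP => [kle|Pkf].
  have [|i Pi iE] := @eq_bigmax_cond _ [pred i : 'I_(size f) | P ^+ i %| f] (@nat_of_ord _).
    have sf : (0 < size f)%N by rewrite size_poly_gt0.
    by apply/card_gt0P; exists (Ordinal sf); rewrite inE /= expr0 dvd1p.
  by move: kle; rewrite /pmult iE => kle; apply: dvdp_trans Pi; apply: dvdp_exp2l.
have kf : (k < size f)%N.
  apply: leq_trans (dvdp_leq f0 Pkf).
  have s0 : (0 < size (P ^+ k))%N by rewrite size_poly_gt0 expf_neq0.
  have : ((size P).-1 * k <= (size (P ^+ k)).-1)%N by rewrite size_exp.
  by move: s0; case: (size (P ^+ k)) => // m _ /=; move: sP; case: (size P) => // -[] // d _; nia.
exact: (@leq_bigmax_cond _ [pred i : 'I_(size f) | P ^+ i %| f] (@nat_of_ord _) (Ordinal kf)).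
Qed.

Lemma pmultM P Q f : mirr P -> mirr Q -> f \is monic ->
  pmult Q (P * f) = ((Q == P) + pmult Q f)%N.
Proof.
move=> Pi Qi fm; have f0 := monic_neq0 fm; have P0 := mirr_neq0 Pi.
have Pf0 : P * f != 0 by rewrite mulf_neq0.
have sQ := mirr_size Qi.
suff H k : (k <= pmult Q (P * f))%N = (k <= (Q == P) + pmult Q f)%N.
  by apply/eqP; rewrite eqn_leq H leqnn -H leqnn.
rewrite leq_pmult //; have [->|QP] := eqVneq Q P.
  case: k => [|k]; first by rewrite expr0 dvd1p.
  by rewrite exprS dvdp_mul2l // add1n ltnS leq_pmult // mirr_size.
rewrite add0n leq_pmult // Gauss_dvdpr // coprimep_expl //.
by rewrite mirr_coprime // mirr_eq.
Qed.

Lemma chi1 D : chi D 1 = 1.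
Proof. by rewrite /chi prime_divisors1 fsbig_set0. Qed.

(** Primes not dividing f enter with exponent 0, so the products for f and for P * f run over the
    same primes. *)
Lemma chi_seq D f n : f \is monic -> (size f <= n.+1)%N ->
  chi D f = \prod_(P <- monics_le F n | mirr P) legendre D P ^+ pmult P f.
Proof.
move=> fm sf; have f0 := monic_neq0 fm.
rewrite /chi (@fsbig_prime_divisors _ _ _ n) // big_mkcond [RHS]big_mkcond.
apply: eq_bigr => P _; case: (boolP (mirr P)) => Pi //=.
case: ifP => // nPf; have := leq_pmult 1 f0 (mirr_size Pi).
by rewrite expr1 nPf; case: pmult.
Qed.

Lemma chi_primeM D P f : mirr P -> f \is monic -> chi D (P * f) = legendre D P * chi D f.
Proof.
move=> Pi fm; have Pm := mirr_monic Pi; have P0 := mirr_neq0 Pi.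
have Pf0 : P * f != 0 by rewrite mulf_neq0 // monic_neq0.
pose n := size (P * f).
rewrite !(@chi_seq _ _ n) ?monicMl //; last first.
  by rewrite (leq_trans (dvdp_leq Pf0 (dvdp_mull P (dvdpp f)))).
rewrite (eq_bigr (fun Q => legendre D Q ^+ (Q == P) * legendre D Q ^+ pmult Q f)); last first.
  by move=> Q Qi; rewrite pmultM // exprD.
rewrite big_split; congr (_ * _) => /=.
rewrite big_mkcond (bigD1_seq P) ?(filter_uniq, monics_le_uniq, polys_uniq) //=; last first.
  by rewrite mem_monics_le Pm (leq_trans (dvdp_leq Pf0 (dvdp_mulr f (dvdpp P)))).
rewrite Pi eqxx expr1 big1 ?mulr1 // => Q QP.
by rewrite (negbTE QP) expr0 if_same.
Qed.

Lemma sqfree_monicP f : f \is monic ->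
  reflect (forall P, mirr P -> ~~ (P ^+ 2 %| f)) (sqfree f).
Proof.
move=> fm; have f0 := monic_neq0 fm.
apply: (iffP (asboolP _)) => [sq P Pi|H u su].
  by apply: sq; rewrite gtn_eqF ?mirr_size.
apply/negP => uf.
have u0 : u != 0.
  by apply: contraNneq f0 => u0; move: uf; rewrite u0 expr0n dvd0p.
have lu : lead_coef u != 0 by rewrite lead_coef_eq0.
pose v := (lead_coef u)^-1 *: u.
have vm : v \is monic by rewrite qualifE /= lead_coefZ mulVf.
have v1 : v != 1.
  by apply: contra su => /eqP v1; rewrite -(size_scale u (invr_neq0 lu)) -/v v1 size_poly1.
have [P Pi Pv] := exists_mirr vm v1.
case/negP: (H P Pi); apply: dvdp_trans (uf); apply: dvdp_exp2r.
by apply: dvdp_trans Pv _; rewrite dvdpZl // invr_eq0.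
Qed.

Lemma sqfreePn f : f \is monic -> ~~ sqfree f -> exists2 P, mirr P & P ^+ 2 %| f.
Proof.
move=> fm nsq; apply: contrapT => H; case/negP: nsq; apply/sqfree_monicP => // P Pi.
by apply/negP => Pf; apply: H; exists P.
Qed.

Lemma sqfree1 : sqfree (1 : {poly F}).
Proof.
apply/sqfree_monicP; rewrite ?monic1 // => P Pi; apply/negP => P2.
have : P %| 1 by apply: dvdp_trans P2; rewrite expr2 dvdp_mulr.
by rewrite mirr_dvd1.
Qed.

Lemma sqfreeM P f : mirr P -> f \is monic -> sqfree (P * f) = sqfree f && ~~ (P %| f).
Proof.
move=> Pi fm; have Pm := mirr_monic Pi; have P0 := mirr_neq0 Pi.
have Pfm : P * f \is monic by rewrite monicMl.
apply/sqfree_monicP/andP => // [H|[/sqfree_monicP H nPf] Q Qi].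
  split; first by apply/sqfree_monicP => // Q Qi; apply: contra (H _ Qi); apply: dvdp_mull.
  by apply: contra (H _ Pi) => Pf; rewrite expr2 dvdp_mul2l.
have [->|QP] := eqVneq Q P; first by rewrite expr2 dvdp_mul2l.
by rewrite Gauss_dvdpr ?H // coprimep_expl // mirr_coprime // mirr_eq.
Qed.

Lemma pmobius1 : pmobius (1 : {poly F}) = 1.
Proof. by rewrite /pmobius -/(sqfree _) sqfree1 prime_divisors1 fsbig_set0. Qed.

Lemma pmobius_nsqfree f : ~~ sqfree f -> pmobius f = 0.
Proof. by rewrite /pmobius -/(sqfree _) => /negbTE ->. Qed.

Lemma pmobiusM P f : mirr P -> f \is monic ->
  pmobius (P * f) = if P %| f then 0 else - pmobius f.
Proof.
move=> Pi fm; case: ifPn => Pf.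
  by rewrite pmobius_nsqfree // sqfreeM // Pf andbF.
rewrite /pmobius -!/(sqfree _) sqfreeM // Pf andbT; case: ifP => _; rewrite ?oppr0 //.
by rewrite fsbig_prime_divisorsM //= mulN1r.
Qed.

Lemma pmobius_le1 f : f \is monic -> `|pmobius f| <= 1.
Proof.
move: f; apply: monic_ind => [|P f Pi fm IH]; first by rewrite pmobius1.
by rewrite pmobiusM //; case: ifP; rewrite ?normr0 ?normrN.
Qed.

Definition pweight (S : comNzRingType) f : S :=
  \big[*%R/1]_(P \in prime_divisors f) (1 + (pnorm P)%:R : S).

Lemma pweight1 S : pweight S 1 = 1.
Proof. by rewrite /pweight prime_divisors1 fsbig_set0. Qed.

Lemma pweightM S P f : mirr P -> f \is monic -> ~~ (P %| f) ->
  pweight S (P * f) = (1 + (pnorm P)%:R) * pweight S f.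
Proof. by move=> Pi fm Pf; rewrite /pweight fsbig_prime_divisorsM. Qed.

(* Multiplication by P pairs the squarefree members of Q prime to P with the
   others, and changes the sign of the Moebius function. *)
Lemma sum_pmobius_eq0 n (Q : pred {poly F}) P : mirr P ->
  (forall E, E \is monic -> ~~ (P %| E) -> Q (P * E) = Q E) ->
  (forall E, E \is monic -> Q E -> (size E <= n.+1)%N) ->
  \sum_(E <- monics_le F n | Q E) pmobius E = 0.
Proof.
move=> Pi QP Qn; have P0 := mirr_neq0 Pi; have Pm := mirr_monic Pi.
rewrite (bigID (fun E => P %| E)) /=.
suff -> : \sum_(E <- monics_le F n | Q E && (P %| E)) pmobius E =
    - \sum_(E <- monics_le F n | Q E && ~~ (P %| E)) pmobius E by rewrite addNr.
transitivity (\sum_(E <- monics_le F n | [&& Q E, P %| E & ~~ (P ^+ 2 %| E)]) pmobius E).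
  rewrite big_mkcond [RHS]big_mkcond; apply: eq_big_seq => E.
  rewrite mem_monics_le => /andP[Em _].
  case: (Q E) => //=; case: ifP => //= PE; case: ifPn => // /negPn P2.
  by rewrite pmobius_nsqfree //; apply/negP => /sqfree_monicP -/(_ Em P Pi); rewrite P2.
rewrite -sumrN -big_filter -[RHS]big_filter.
rewrite (perm_big [seq P * E | E <- monics_le F n & Q E && ~~ (P %| E)]) /=.
  rewrite big_map; apply: eq_big_seq => E.
  rewrite mem_filter mem_monics_le => /and3P[/andP[_ /negbTE PE] Em _].
  by rewrite pmobiusM // PE.
apply: uniq_perm; rewrite ?(filter_uniq, monics_le_uniq, polys_uniq) //.
  by rewrite map_inj_uniq ?(filter_uniq, monics_le_uniq, polys_uniq) //; apply: mulfI.
move=> A; rewrite mem_filter mem_monics_le.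
apply/andP/mapP => [[/and3P[QA /dvdpP[E AE] PA] /andP[Am sA]]|[E]].
  have Em : E \is monic by rewrite -(monicMr _ Pm) -AE.
  rewrite mulrC in AE; exists E => //.
  have PE : ~~ (P %| E) by rewrite AE expr2 dvdp_mul2l in PA.
  have QE : Q E by rewrite -QP // -AE.
  by rewrite mem_filter mem_monics_le Em QE PE (Qn E).
rewrite mem_filter mem_monics_le => /and3P[/andP[QE PE] Em _] ->.
have PEm : P * E \is monic by rewrite monicMl.
have QPE : Q (P * E) by rewrite QP.
by rewrite QPE dvdp_mulr // expr2 dvdp_mul2l // PE PEm (Qn (P * E)).
Qed.

(** If f and g share a prime P, pairing E with P * E cancels the sum; otherwise only E = 1
    remains. *)
Lemma sum_pmobius_coprime n f g : f \is monic -> (size f <= n.+1)%N ->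
  \sum_(E <- monics_le F n | (E %| f) && (E %| g)) pmobius E = (coprimep f g)%:R.
Proof.
move=> fm sf; have f0 := monic_neq0 fm.
case: (boolP (coprimep f g)) => [cp|ncp].
  rewrite big_mkcond (bigD1_seq 1) ?(filter_uniq, monics_le_uniq, polys_uniq) //=; last first.
    by rewrite mem_monics_le monic1 size_poly1.
  rewrite !dvd1p pmobius1 big_seq_cond big1 ?addr0 // => E.
  rewrite mem_monics_le => /andP[/andP[Em _] E1]; case: ifP => // /andP[Ef Eg].
  have : E %| gcdp f g by rewrite dvdp_gcd Ef.
  move: cp; rewrite coprimep_def => /eqP sg /dvdp_leq.
  rewrite sg -size_poly_gt0 sg => /(_ isT) sE.
  by case/eqP: E1; apply: monic_size1 => //; have := monic_size_gt0 Em; move: sE; case: (size E) => // -[].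
have [P Pi /andP[Pf Pg]] : exists2 P, mirr P & (P %| f) && (P %| g).
  pose d := gcdp f g; have d0 : d != 0 by rewrite gcdp_eq0 negb_and f0.
  have ld : lead_coef d != 0 by rewrite lead_coef_eq0.
  have vm : (lead_coef d)^-1 *: d \is monic by rewrite qualifE /= lead_coefZ mulVf.
  have [|P Pi] := exists_mirr vm.
    apply: contra ncp => /eqP v1; rewrite coprimep_def -/d.
    by rewrite -(size_scale d (invr_neq0 ld)) v1 size_poly1.
  by rewrite dvdpZr ?invr_neq0 // dvdp_gcd => ?; exists P.
apply: (sum_pmobius_eq0 Pi) => [E Em nPE|E Em /andP[Ef _]]; last first.
  exact: leq_trans (dvdp_leq f0 Ef) sf.
have cPE : coprimep P E by rewrite mirr_coprime.
by rewrite !(Gauss_dvdp _ cPE) Pf Pg.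
Qed.

(** The same pairing, with a prime P whose square divides f. *)
Lemma sum_pmobius_sqfree n f : f \is monic -> (size f <= n.+1)%N ->
  \sum_(E <- monics_le F n | E ^+ 2 %| f) pmobius E = (sqfree f)%:R.
Proof.
move=> fm sf; have f0 := monic_neq0 fm.
case: (boolP (sqfree f)) => [/asboolP sq|nsq].
  rewrite big_mkcond (bigD1_seq 1) ?(filter_uniq, monics_le_uniq, polys_uniq) //=; last first.
    by rewrite mem_monics_le monic1 size_poly1.
  rewrite expr1n dvd1p pmobius1 big_seq_cond big1 ?addr0 // => E.
  rewrite mem_monics_le => /andP[/andP[Em _] E1]; case: ifP => // Ef.
  have := sq E; rewrite Ef; case: eqP => [s1 _|_ /(_ isT)] //.
  by case/eqP: E1; apply: monic_size1.
have [P Pi Pf] := sqfreePn fm nsq.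
apply: (sum_pmobius_eq0 Pi) => [E Em nPE|E Em Ef]; last first.
  apply: leq_trans (dvdp_leq f0 _) sf; apply: dvdp_trans Ef.
  by rewrite expr2 dvdp_mulr.
have cPE : coprimep (P ^+ 2) (E ^+ 2) by rewrite coprimep_expl // coprimep_expr // mirr_coprime.
by rewrite exprMn (Gauss_dvdp _ cPE) Pf.
Qed.

End PrimeDivisors.

(** * The quadratic symbol *)

Lemma euler_criterion (K : finFieldType) (x : K) : odd #|K| -> x != 0 ->
  x ^+ (#|K|.-1)./2 = if `[< exists y, x = y ^+ 2 >] then 1 else -1.
Proof.
move=> oK x0; set m := (#|K|.-1)./2.
have m2 : (m * 2 = #|K|.-1)%N.
  have : (1 < #|K|)%N by exact: finNzRing_gt1.
  by rewrite /m; move: oK; case: #|K| => //= n; rewrite muln2 => nodd _; rewrite even_halfK.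
have xE y : y != 0 -> y ^+ (m * 2) = 1 :> K.
  move=> y0; rewrite m2; apply: (mulfI y0); rewrite -exprS mulr1 prednK ?expf_card //.
  by apply/card_gt0P; exists 0.
case: ifPn => [/asboolP[y xy]|/asboolP nsq].
  by rewrite xy -exprM mulnC xE //; apply: contraNneq x0 => y0; rewrite xy y0 expr0n.
have : (x ^+ m) ^+ 2 == 1 by rewrite -exprM xE.
rewrite sqrf_eq1 => /orP[/eqP xm1|/eqP //]; case: nsq.
(* Write x as a power g^k of a generator; x^m = 1 forces the order 2m to divide km, so k is even. *)
have /cyclicP[g gE] := field_unit_group_cyclic [group of [set: {unit K}]].
have xu : x \is a GRing.unit by rewrite unitfE.
have : FinRing.unit K xu \in <[g]>%g by rewrite -gE inE.
case/cycleP=> k xk.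
have og : #[g]%g = (m * 2)%N by rewrite orderE -gE card_finField_unit m2.
have : (g ^+ (k * m) == 1)%g.
  rewrite expgM -xk; apply/eqP/val_inj.
  by rewrite FinRing.val_unitX /= xm1.
rewrite -order_dvdn og mulnC dvdn_pmul2r; last first.
  by rewrite -(ltn_pmul2r (ltn0Sn 1)) m2; have := finNzRing_gt1 K; case: #|K| => // -[].
move=> /dvdnP[j kj]; exists (val (g ^+ j)%g).
by rewrite -FinRing.val_unitX -expgM -kj -xk.
Qed.

(** * The symbol as a power of a resultant *)

Section ResultantSymbol.
Variables (F : finFieldType) (K : closedFieldType) (emb : {rmorphism F -> K}).
Implicit Types (f g h A B D P Q : {poly F}).
Local Notation "f ^i" := (map_poly emb f) (at level 2, format "f ^i").
Local Notation q := #|F|.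

Definition geom_roots f : seq K := sval (closed_field_poly_normal (f^i)).

Lemma geom_rootsE f : f \is monic -> f^i = \prod_(z <- geom_roots f) ('X - z%:P).
Proof.
move=> fm; rewrite /geom_roots; case: closed_field_poly_normal => s /= {1}->.
by rewrite (monicP _) ?scale1r // map_monic.
Qed.

Lemma size_geom_roots f : f \is monic -> size (geom_roots f) = (size f).-1.
Proof. by move=> fm; rewrite -(size_map_poly emb f) geom_rootsE // size_prod_XsubC. Qed.

Lemma mem_geom_roots f z : f \is monic -> (z \in geom_roots f) = root (f^i) z.
Proof. by move=> fm; rewrite geom_rootsE // root_prod_XsubC. Qed.

(* the resultant of f and A, for f monic *)
Definition resn f A : K := \prod_(z <- geom_roots f) (A^i).[z].

Lemma resn_seq f A s : f \is monic -> f^i = \prod_(z <- s) ('X - z%:P) ->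
  resn f A = \prod_(z <- s) (A^i).[z].
Proof.
move=> fm fE; apply: perm_big; apply: prod_XsubC_eq.
by rewrite -geom_rootsE.
Qed.

Lemma resnMl f g A : f \is monic -> g \is monic -> resn (f * g) A = resn f A * resn g A.
Proof.
move=> fm gm; rewrite (@resn_seq _ _ (geom_roots f ++ geom_roots g)) ?monicMl //.
  by rewrite big_cat.
by rewrite big_cat rmorphM /= !geom_rootsE.
Qed.

Lemma resn1 A : resn 1 A = 1.
Proof. by rewrite (@resn_seq _ _ [::]) ?monic1 ?big_nil ?rmorph1. Qed.

Lemma resnMr f A B : resn f (A * B) = resn f A * resn f B.
Proof. by rewrite /resn -big_split; apply: eq_bigr => z _; rewrite rmorphM hornerM. Qed.

Lemma resnC f c : f \is monic -> resn f c%:P = emb c ^+ (size f).-1.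
Proof.
move=> fm; rewrite -size_geom_roots // /resn.
rewrite (eq_bigr (fun=> emb c)) ?big_const_seq ?count_predT ?iter_mulr_1 //.
by move=> z _; rewrite map_polyC hornerC.
Qed.

Lemma resn_modp f A B : f \is monic -> f %| A - B -> resn f A = resn f B.
Proof.
move=> fm /dvdpP[g AB]; rewrite /resn; apply: eq_big_seq => z.
rewrite mem_geom_roots // => /eqP fz.
by rewrite -[A](subrK B) AB rmorphD rmorphM hornerD hornerM fz mulr0 add0r.
Qed.

Lemma resn_eq0 f A : f \is monic -> (resn f A == 0) = ~~ coprimep f A.
Proof.
move=> fm; rewrite -(coprimep_map emb) /resn prodf_seq_eq0.
apply/hasP/idP => [[z] |].
  rewrite mem_geom_roots //= => fz Az; apply/negP => /coprimep_root -/(_ z fz).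
  by rewrite (eqP Az) eqxx.
rewrite coprimep_def => /closed_rootP[z]; rewrite root_gcd => /andP[fz Az].
by exists z => //; rewrite mem_geom_roots.
Qed.

Lemma resn_sym f g : f \is monic -> g \is monic ->
  resn f g = (-1) ^+ ((size f).-1 * (size g).-1) * resn g f.
Proof.
move=> fm gm; rewrite /resn !geom_rootsE //.
under eq_bigr => z _ do rewrite horner_prod.
under [in RHS]eq_bigr => z _ do rewrite horner_prod.
rewrite exchange_big /= exprM -!size_geom_roots //.
have cst (u : seq K) (c : K) : c ^+ size u = \prod_(z <- u) c.
  by rewrite big_const_seq count_predT iter_mulr_1.
rewrite [X in X * _]cst -big_split /=; apply: eq_bigr => w _ /=.
rewrite cst -big_split /=; apply: eq_bigr => z _ /=.
by rewrite !hornerXsubC mulN1r opprB.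
Qed.

Definition frob (x : K) := x ^+ q.

Fact frob_zmod_morphism : zmod_morphism frob.
Proof.
have [p p_pr pF] := finPcharP F.
have pK : p \in [pchar K] by rewrite (fmorph_pchar emb).
have qp : ([pchar K]).-nat q.
  have := abelem_pgroup (fin_ring_pchar_abelem pF).
  rewrite /pgroup cardsT; apply: sub_in_pnat => r _.
  by move=> /eqP ->.
move=> x y; apply/eqP; rewrite eq_sym subr_eq eq_sym.
by rewrite /frob -exprDn_pchar // subrK.
Qed.

Fact frob_monoid_morphism : monoid_morphism frob.
Proof. by split=> [|x y]; rewrite /frob ?expr1n ?exprMn. Qed.

HB.instance Definition _ := GRing.isZmodMorphism.Build K K frob frob_zmod_morphism.
HB.instance Definition _ := GRing.isMonoidMorphism.Build K K frob frob_monoid_morphism.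

Lemma map_frob_iota f : map_poly frob (f^i) = f^i.
Proof. by apply/polyP => n; rewrite !coef_map /= /frob -rmorphXn expf_card. Qed.

Lemma horner_frob f z : (f^i).[z ^+ q] = (f^i).[z] ^+ q.
Proof. by rewrite -{1}map_frob_iota (horner_map frob). Qed.

Lemma horner_frobX f z n : (f^i).[z ^+ (q ^ n)] = (f^i).[z] ^+ (q ^ n).
Proof.
elim: n => [|n IH]; first by rewrite expn0 !expr1.
by rewrite expnSr !exprM horner_frob IH.
Qed.

Lemma frob_fixed x : x ^+ q = x -> exists a, x = emb a.
Proof.
move=> xq; have : root (('X^q - 'X : {poly F})^i) x.
  by rewrite rmorphB /= map_polyXn map_polyX rootE !hornerE xq subrr.
rewrite finField_genPoly rmorph_prod /= rootE horner_prod => /eqP/eqP.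
rewrite prodf_seq_eq0 => /hasP[a _ /=].
rewrite rmorphB /= map_polyX map_polyC /= hornerXsubC subr_eq0 => /eqP ->.
by exists a.
Qed.

Lemma frob_fixed_poly (p : {poly K}) : map_poly frob p = p -> exists f, p = f^i.
Proof.
move=> pq; have H n : exists a, p`_n = emb a.
  by apply: frob_fixed; rewrite -{2}pq coef_map.
exists (\poly_(n < size p) projT1 (cid (H n))); apply/polyP => n.
rewrite coef_map coef_poly; case: ltnP => [_|pn]; last first.
  by rewrite nth_default //; apply/esym/rmorph0.
by case: (cid (H n)).
Qed.


Lemma in_qpoly_eq P A B : mirr P -> (in_qpoly P A == in_qpoly P B) = (P %| A - B).
Proof.
move=> Pi; have Pm := mirr_monic Pi.
rewrite -subr_eq0 -rmorphB -val_eqE /=.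
have /mirrP[_ Pirr] := Pi.
have mE : mk_monic P = P := mk_monicE ((Pirr, Pm) : monic_irreducible_poly P).
by rewrite mE Pdiv.WeakIdomain.dvdpE.
Qed.

Lemma prime_fermat P A : mirr P -> P %| A ^+ (q ^ (size P).-1) - A.
Proof.
move=> Pi; have /mirrP[Pm Pirr] := Pi.
pose mi : monic_irreducible_poly P := (Pirr, Pm).
rewrite -in_qpoly_eq // rmorphXn /=.
have cL := card_qfpoly mi; rewrite -cL.
by apply/eqP; exact: (@expf_card {poly %/ P with mi} (in_qpoly P A)).
Qed.

Lemma legendre_euler P A : odd q -> mirr P -> ~~ (P %| A) ->
  P %| A ^+ (q ^ (size P).-1).-1./2 - (legendre A P)%:~R.
Proof.
move=> oq Pi PA; have /mirrP[Pm Pirr] := Pi.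
pose mi : monic_irreducible_poly P := (Pirr, Pm).
rewrite -in_qpoly_eq // rmorphXn /=.
have cL := card_qfpoly mi; rewrite -cL.
have x0 : (in_qpoly P A : {poly %/ P with mi}) != 0.
  by rewrite -(rmorph0 (in_qpoly P)) in_qpoly_eq // subr0.
have oL : odd #|{poly %/ P with mi}| by rewrite cL oddX oq orbT.
have /eqP := euler_criterion oL x0.
rewrite /legendre (negbTE PA).
have -> : `[< is_square_mod P A >] =
    `[< exists y : {poly %/ P with mi}, in_qpoly P A = y ^+ 2 >].
  apply/asboolP/asboolP => [[h]|[y /eqP]].
    by rewrite -in_qpoly_eq // => /eqP <-; exists (in_qpoly P h); rewrite rmorphXn.
  have -> : y = in_qpoly P y :> {poly %/ P with mi}.
    exact/val_inj/esym/in_qpoly_small/size_mk_monic.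
  rewrite -rmorphXn eq_sym => H; exists (y : {poly F}).
  by rewrite -in_qpoly_eq.
by case: ifP => _; rewrite ?(rmorphN, rmorph1).
Qed.

(** Frobenius permutes the conjugates z^(q^i), because z^(q^d) = z, so their product descends to a
    polynomial S over F. P divides S, since they share the root z, and the degrees agree. *)
Lemma prime_roots P : mirr P -> exists z, root (P^i) z /\
  P^i = \prod_(x <- [seq z ^+ (q ^ i) | i <- iota 0 (size P).-1]) ('X - x%:P).
Proof.
move=> Pi; have /mirrP[Pm Pirr] := Pi; have sP := mirr_size Pi.
have [z Pz] : exists z, root (P^i) z.
  by apply/closed_rootP; rewrite size_map_poly gtn_eqF.
exists z; split => //; set d := (size P).-1.
have Hdvd A : P %| A -> (A^i).[z] = 0.
  by move=> /dvdpP[B ->]; rewrite rmorphM hornerM (eqP Pz) mulr0.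
have zq : z ^+ (q ^ d) = z.
  have := Hdvd _ (prime_fermat 'X Pi).
  rewrite rmorphB rmorphXn /= map_polyX !hornerE => /eqP.
  by rewrite subr_eq0 => /eqP.
have d0 : (0 < d)%N by rewrite /d -ltnS prednK // ltnW.
pose R := \prod_(i < d) ('X - (z ^+ (q ^ i))%:P).
have -> : \prod_(x <- [seq z ^+ (q ^ i) | i <- iota 0 d]) ('X - x%:P) = R.
  by rewrite big_map /R -(big_mkord xpredT (fun i => 'X - (z ^+ (q ^ i))%:P)) /index_iota subn0.
have RE : map_poly frob R = R.
  rewrite /R rmorph_prod /=.
  under eq_bigr => i _ do rewrite rmorphB /= map_polyX map_polyC /= /frob -exprM -expnSr.
  case: d d0 zq {R} => // d _ zq.
  by rewrite big_ord_recr big_ord_recl /= zq expn0 expr1 mulrC.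
have [S SE] := frob_fixed_poly RE.
have Sm : S \is monic by rewrite -(map_monic emb) -SE monic_prod_XsubC.
have sS : size S = d.+1.
  by rewrite -(size_map_poly emb) -SE /R size_prod_XsubC /index_enum -enumT size_enum_ord.
rewrite SE; congr (_^i).
have PS : P %| S.
  apply: contraT; rewrite -mirr_coprime // -(coprimep_map emb) => /coprimep_root -/(_ z Pz).
  rewrite -SE /R horner_prod; case: d d0 {zq R RE SE sS} => // d _.
  by rewrite big_ord_recl expn0 expr1 hornerXsubC subrr mul0r eqxx.
apply/eqP; rewrite -eqp_monic // -dvdp_size_eqp // sS /d prednK //.
exact: ltnW.
Qed.

(** With z a root of P and d = deg P, the resultant is the norm A(z)^(1 + q + ... + q^(d-1));
    multiplying this exponent by (q - 1)/2 gives (q^d - 1)/2, the exponent of Euler's criterion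
    modulo P. *)
Lemma legendre_resn P A : odd q -> mirr P ->
  (legendre A P)%:~R = resn P A ^+ (q.-1)./2.
Proof.
move=> oq Pi; have /mirrP[Pm Pirr] := Pi.
have q1 : (1 < q)%N by apply: finNzRing_gt1.
have q2 : ((q.-1)./2 * 2 = q.-1)%N.
  by move: oq q1; case: q => //= n nodd _; rewrite muln2 even_halfK.
case: (boolP (P %| A)) => PA.
  have /eqP -> : resn P A == 0 by rewrite resn_eq0 // mirr_coprime // PA.
  rewrite /legendre PA expr0n.
  have -> // : ((q.-1)./2 == 0)%N = false.
  by apply/negbTE/eqP => e; move: q2 q1; rewrite e; case: q oq => // -[|n].
have [z [Pz PE]] := prime_roots Pi.
rewrite (resn_seq _ Pm PE) big_map.
under eq_bigr => i _ do rewrite horner_frobX.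
have -> : \prod_(i <- iota 0 (size P).-1) (A^i).[z] ^+ (q ^ i) =
    (A^i).[z] ^+ (\sum_(i < (size P).-1) q ^ i).
  by rewrite expr_sum -(big_mkord xpredT (fun i => (A^i).[z] ^+ (q ^ i))) /index_iota subn0.
rewrite -exprM.
have -> : ((\sum_(i < (size P).-1) q ^ i) * (q.-1)./2 = (q ^ (size P).-1).-1./2)%N.
  rewrite predn_exp; set S := (\sum_(_ < _) _)%N.
  have -> : (q.-1 * S = (S * (q.-1)./2).*2)%N by rewrite -muln2 -mulnA q2 mulnC.
  by rewrite doubleK.
have /dvdpP[B] := legendre_euler oq Pi PA.
move/(congr1 (fun p => (p^i).[z])).
rewrite rmorphB rmorphM rmorphXn rmorph_int /= !hornerE (eqP Pz) mulr0 => /eqP.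
rewrite subr_eq0 => /eqP ->.
by rewrite -(rmorph_int (@polyC K)) hornerC.
Qed.

Lemma chi_resn f A : odd q -> f \is monic ->
  (chi A f)%:~R = resn f A ^+ (q.-1)./2.
Proof.
move=> oq; move: f; apply: monic_ind => [|P f Pi fm IH].
  by rewrite chi1 resn1 expr1n.
by rewrite chi_primeM // rmorphM /= IH legendre_resn // (resnMl _ (mirr_monic Pi) fm) exprMn.
Qed.

End ResultantSymbol.

(** * Bimultiplicativity, periodicity and reciprocity *)

Section SymbolLaws.
Variable F : finFieldType.
Hypothesis oq : odd #|F|.
Implicit Types (f g h A B D P : {poly F}).

Lemma finField_card_pchar p : p \in [pchar F] -> p.-nat #|F|.
Proof.
by move=> pF; have := abelem_pgroup (fin_ring_pchar_abelem pF); rewrite /pgroup cardsT.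
Qed.

Lemma odd_finField_pchar : (2%N \in [pchar F]) = false.
Proof.
apply/negP => /finField_card_pchar /p_natP[n qE].
have := finNzRing_gt1 F; move: oq; rewrite qE oddX orbF => /eqP ->.
by rewrite expn0.
Qed.

Lemma legendre_cases A P : legendre A P \in [:: 0; 1; -1].
Proof. by rewrite /legendre; case: ifP => // _; case: ifP. Qed.

Lemma chi_cases A f : f \is monic -> chi A f \in [:: 0; 1; -1].
Proof.
move: f; apply: monic_ind => [|P f Pi fm]; first by rewrite chi1.
rewrite chi_primeM //; move: (legendre_cases A P); rewrite !inE.
by case/or3P => /eqP -> /or3P[] /eqP ->.
Qed.

Lemma chi_norm_le1 A f : f \is monic -> `|chi A f| <= 1.
Proof. by move=> fm; have := chi_cases A fm; rewrite !inE => /or3P[] /eqP ->. Qed.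

Lemma chiMl D f g : f \is monic -> g \is monic -> chi D (f * g) = chi D f * chi D g.
Proof.
move=> + gm; move: f; apply: monic_ind => [|P f Pi fm IH]; first by rewrite chi1 !mul1r.
by rewrite -mulrA chi_primeM ?monicMl // IH chi_primeM // mulrA.
Qed.

(** The three values remain distinct in K because the characteristic is odd; identities between
    symbols can thus be checked on resultants. *)
Lemma sign_intr_inj (K : closedFieldType) (emb : {rmorphism F -> K}) (a b : int) :
  a \in [:: 0; 1; -1] -> b \in [:: 0; 1; -1] -> a%:~R = b%:~R :> K -> a = b.
Proof.
have n2 : (1 + 1 : K) != 0.
  apply/negP => e; have : (2%N \in [pchar F]) by rewrite -(fmorph_pchar emb) inE /=.
  by rewrite odd_finField_pchar.
have n1 : (1 : K) == 0 = false by exact: oner_eq0.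
rewrite !inE => /or3P[] /eqP -> /or3P[] /eqP -> //; rewrite ?mulrNz ?mulr0z ?mulr1z => /eqP;
  by rewrite -subr_eq0 ?(sub0r, subr0, opprK, oppr_eq0) -?opprD ?oppr_eq0 ?n1 ?(negbTE n2).
Qed.

Lemma odd_finField_half_gt0 : (0 < #|F|.-1./2)%N.
Proof. by move: oq (finNzRing_gt1 F); case: #|F| => // -[|[|[]]]. Qed.

Lemma chiMr f A B : f \is monic -> chi (A * B) f = chi A f * chi B f.
Proof.
move=> fm; have [K [emb _]] := countable_algebraic_closure F.
apply: (sign_intr_inj emb); rewrite ?chi_cases //.
  move: (chi_cases A fm) (chi_cases B fm); rewrite !inE.
  by case/or3P => /eqP -> /or3P[] /eqP ->.
by rewrite rmorphM /= !(chi_resn emb) // resnMr exprMn.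
Qed.

Lemma chi_modp f A B : f \is monic -> f %| A - B -> chi A f = chi B f.
Proof.
move=> fm AB; have [K [emb _]] := countable_algebraic_closure F.
by apply: (sign_intr_inj emb); rewrite ?chi_cases // !(chi_resn emb) // (resn_modp _ fm AB).
Qed.

Lemma chi_eq0 f A : f \is monic -> (chi A f == 0) = ~~ coprimep f A.
Proof.
move=> fm; have [K [emb _]] := countable_algebraic_closure F.
rewrite -(resn_eq0 emb) //; apply/idP/idP => [/eqP c0|/eqP r0].
  have /eqP := chi_resn emb A oq fm; rewrite c0 rmorph0 eq_sym expf_eq0 => /andP[] //.
apply/eqP/(sign_intr_inj emb); rewrite ?chi_cases // (chi_resn emb) // r0 rmorph0 expr0n.
by rewrite gtn_eqF // odd_finField_half_gt0.
Qed.

(** The quadratic character of -1 in F. *)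
Definition chi_eps : int := (-1) ^+ (#|F|.-1)./2.

Lemma chi_reciprocity f g : f \is monic -> g \is monic ->
  chi g f = chi_eps ^+ ((size f).-1 * (size g).-1) * chi f g.
Proof.
move=> fm gm; have [K [emb _]] := countable_algebraic_closure F.
apply: (sign_intr_inj emb); rewrite ?chi_cases //.
  rewrite /chi_eps -exprM -signr_odd; move: (chi_cases f gm); rewrite !inE.
  by case/or3P => /eqP ->; case: odd.
rewrite rmorphM /= !(chi_resn emb) // (resn_sym _ fm gm) exprMn.
by rewrite /chi_eps -!exprM rmorph_sign mulnC.
Qed.

(** The quadratic character of F: modulo the linear prime X the residue field is F itself. *)
Definition qchi (c : F) : int := chi c%:P 'X.

Lemma chi_const c f : f \is monic -> chi c%:P f = qchi c ^+ (size f).-1.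
Proof.
move=> fm; have [K [emb _]] := countable_algebraic_closure F.
apply: (sign_intr_inj emb); rewrite ?chi_cases //.
  rewrite /qchi; elim: ((size f).-1) => [|n IH]; first by rewrite expr0.
  rewrite exprS; move: (chi_cases c%:P (monicX F)) IH; rewrite !inE.
  by case/or3P => /eqP -> /or3P[] /eqP ->.
rewrite rmorphXn /= !(chi_resn emb) ?monicX // !resnC ?monicX // size_polyX /=.
by rewrite expr1 -!exprM mulnC.
Qed.

End SymbolLaws.

(** * Gauss sums and the Pólya-Vinogradov bound *)

Lemma perm_map_in (T : eqType) (s : seq T) (f : T -> T) : uniq s ->
  {in s &, injective f} -> {in s, forall x, f x \in s} -> perm_eq [seq f x | x <- s] s.
Proof.
move=> us fi fs; have um : uniq [seq f x | x <- s] by rewrite map_inj_in_uniq.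
apply: uniq_perm => //; apply: (uniq_min_size um _ _).2; last by rewrite size_map.
by move=> _ /mapP[x xs ->]; apply: fs.
Qed.

(** Any nontrivial irreducible character of the additive group serves; commutativity makes it
    linear. *)
Lemma additive_char_exists (F : finFieldType) : exists psi : F -> algC,
  [/\ {morph psi : x y / x + y >-> x * y}, forall x, `|psi x| = 1 & exists c, psi c != 1].
Proof.
pose G := [group of [set: F]].
have abG : abelian G by apply/centsP => x _ y _; apply: addrC.
have NG : (1 < Nirr G)%N.
  by rewrite NirrE; move: abG; rewrite card_classes_abelian => /eqP ->; rewrite cardsT finNzRing_gt1.
pose i : Iirr G := Ordinal NG.
have lin : 'chi_i \is a linear_char by apply/char_abelianP.
exists 'chi_i; split=> [x y|x|].
- by rewrite -(lin_charM lin) ?inE.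
- by rewrite normC_lin_char ?inE.
apply: contrapT => H; have : 'chi_i = 'chi_0.
  rewrite irr0; apply/cfun_inP => x _; rewrite cfun1E inE.
  by apply/eqP/negPn/negP => xi; apply: H; exists x.
by move/irr_inj => /(congr1 val).
Qed.

(** If all elements were squares, a choice of square roots would be injective, hence bijective on a
    finite set, and squaring would be injective; but 1 and -1 have the same square. *)
Lemma nonsquare_exists (K : finFieldType) : (2%N \in [pchar K]) = false ->
  exists x : K, forall y, x != y ^+ 2.
Proof.
move=> c2; apply: contrapT => H.
have H' (x : K) : exists y, x = y ^+ 2.
  apply: contrapT => nx; apply: H; exists x => y; apply/eqP => xy.
  by apply: nx; exists y.
pose r x := projT1 (cid (H' x)).
have rK x : r x ^+ 2 = x by rewrite /r; case: cid.
have ri : injective r by move=> x y xy; rewrite -(rK x) xy rK.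
have [s rs sr] := injF_bij ri.
have s1 : s 1 = 1 by rewrite -[LHS]rK sr expr1n.
have sN1 : s (-1) = 1 by rewrite -[LHS]rK sr sqrrN expr1n.
have e : (1 : K) = -1 := etrans (esym (sr 1)) (etrans (congr1 r (etrans s1 (esym sN1))) (sr (-1))).
have : (1 + 1 : K) = 0 by rewrite {2}e subrr.
by move=> /eqP e2; move: c2; rewrite inE /= => /negbT/negP; apply; exact: e2.
Qed.

Lemma chi_one (F : finFieldType) (f : {poly F}) : f \is monic -> chi 1 f = 1.
Proof.
move: f; apply: monic_ind => [|P f Pi fm IH]; first exact: chi1.
rewrite chi_primeM // IH mulr1 /legendre (mirr_dvd1 Pi) ifT //.
by apply/asboolP; exists 1; rewrite expr1n subrr dvdp0.
Qed.

Section GaussSum.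
Variable F : finFieldType.
Hypothesis oq : odd #|F|.
Variable psi : F -> algC.
Hypothesis psiD : {morph psi : x y / x + y >-> x * y}.
Hypothesis psi_norm : forall x, `|psi x| = 1.
Hypothesis psi_nontrivial : exists c, psi c != 1.
Implicit Types (f g h x y A B D P : {poly F}).
Local Notation q := #|F|.

Lemma perm_polys_add (a : {poly F}) n : (size a <= n)%N ->
  perm_eq [seq a + x | x <- polys F n] (polys F n).
Proof.
move=> sa; apply: perm_map_in; rewrite ?polys_uniq //.
  by move=> x y _ _; apply: addrI.
move=> x; rewrite !mem_polys => sx.
by rewrite (leq_trans (size_polyD _ _)) // geq_max sa.
Qed.

Lemma perm_polys_mulmod f u : f \is monic -> coprimep f u ->
  perm_eq [seq (u * x) %% f | x <- polys F (size f).-1] (polys F (size f).-1).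
Proof.
move=> fm cu; have sf := monic_size_gt0 fm; apply: perm_map_in; rewrite ?polys_uniq //.
  move=> x y; rewrite !mem_polys => sx sy /eqP.
  rewrite -subr_eq0 -modpN -modpD -mulrN -mulrDr => /eqP/modp_eq0P.
  rewrite Gauss_dvdpr // => fxy; apply/eqP; rewrite -subr_eq0; apply: contraTT fxy => xy0.
  apply/negP => /(dvdp_leq xy0); rewrite leqNgt -(prednK sf) ltnS.
  by rewrite (leq_trans (size_polyD _ _)) // geq_max sx size_polyN.
by move=> x _; rewrite mem_polys -ltnS prednK // ltn_modp monic_neq0.
Qed.

Lemma psi0 : psi 0 = 1.
Proof.
have p0 : psi 0 != 0 by rewrite -normr_gt0 psi_norm ltr01.
by apply: (mulfI p0); rewrite mulr1 -psiD addr0.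
Qed.

Lemma psiN c : psi (- c) = (psi c)^*.
Proof.
have p0 : psi c != 0 by rewrite -normr_gt0 psi_norm ltr01.
by apply: (mulfI p0); rewrite -psiD subrr psi0 -normCK psi_norm expr1n.
Qed.

Lemma dvdp_modB f x : f %| x %% f - x.
Proof. by apply/modp_eq0P; rewrite modpD modpN modp_id subrr. Qed.

(** For monic f of positive degree this is psi of the coefficient of 1/t in the expansion of x/f at
    infinity, the analogue of e(x/f). *)
Definition polychar f x : algC := psi ((x %% f)`_((size f).-2)).

Lemma polycharD f x y : polychar f (x + y) = polychar f x * polychar f y.
Proof. by rewrite /polychar modpD coefD psiD. Qed.

Lemma polycharN f x : polychar f (- x) = (polychar f x)^*.
Proof. by rewrite /polychar modpN coefN psiN. Qed.

Lemma polychar_small f x : (size x < size f)%N -> polychar f x = psi x`_((size f).-2).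
Proof. by move=> xf; rewrite /polychar modp_small. Qed.

Lemma polychar_dvd f x y : f %| x - y -> polychar f x = polychar f y.
Proof.
by move=> /modp_eq0P xy; rewrite -[x](subrK y) /polychar modpD xy add0r.
Qed.

(** If y has degree at least b, some h0 moves its leading coefficient into the position read by
    [polychar], and translating h by h0 multiplies the sum by a value other than 1. *)
Lemma polychar_orthogonality f y b : f \is monic -> (size y < size f)%N -> (b < size f)%N ->
  \sum_(h <- polys F ((size f).-1 - b)) polychar f (h * y) =
  if (size y <= b)%N then (q ^ ((size f).-1 - b))%:R else 0.
Proof.
move=> fm sy bf; set n := (size f).-1; have nE : size f = n.+1 by rewrite prednK // monic_size_gt0.
case: leqP => yb.
  rewrite big_seq (eq_bigr (fun=> 1)).
    by rewrite -big_seq big_const_seq count_predT size_polys iter_addr_0.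
  move=> h; rewrite mem_polys => sh.
  have shy : (size (h * y)%R <= n.-1)%N.
    have [->|h0] := eqVneq h 0; first by rewrite mul0r size_poly0.
    have [->|y0] := eqVneq y 0; first by rewrite mulr0 size_poly0.
    rewrite size_mul //; move: h0 y0; rewrite -!size_poly_gt0.
    move: sh yb bf; rewrite nE; move: (size h) (size y) => a c; lia.
  rewrite polychar_small; last by rewrite nE; move: shy; move: (size _) => a; lia.
  by rewrite nE /= nth_default ?psi0.
have [c pc] := psi_nontrivial.
have y0 : y != 0 by rewrite -size_poly_gt0 (leq_ltn_trans _ yb).
pose h0 : {poly F} := (c / lead_coef y) *: 'X^(n - size y).
have h0E : polychar f (h0 * y) = psi c.
  have s0 : (size (h0 * y)%R <= n)%N.
    rewrite -scalerAl (leq_trans (size_scale_leq _ _)) // mulrC size_mulXn //.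
    by move: sy; rewrite nE; move: (size y) => a; lia.
  rewrite polychar_small ?nE //= -scalerAl coefZ coefXnM.
  have -> : (n.-1 < n - size y)%N = false.
    by move: yb; move: (size y) => a; lia.
  have -> : (n.-1 - (n - size y))%N = (size y).-1.
    by move: yb sy; rewrite nE; move: (size y) => a; lia.
  by rewrite -/(lead_coef y) divfK // lead_coef_eq0.
have sh0 : (size h0 <= n - b)%N.
  rewrite (leq_trans (size_scale_leq _ _)) // size_polyXn.
  by move: yb sy; rewrite nE; move: (size y) => a; lia.
set S := \sum_(h <- _) _.
have : S = psi c * S.
  rewrite {1}/S -(perm_big _ (perm_polys_add sh0)) /= big_map mulr_sumr.
  by apply: eq_bigr => h _; rewrite mulrDl polycharD h0E.
move/eqP; rewrite -subr_eq0 -{1}[S]mul1r -mulrBl mulf_eq0 subr_eq0 eq_sym (negbTE pc) /=.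
by move/eqP.
Qed.

Definition gauss_sum f h : algC :=
  \sum_(x <- polys F (size f).-1) (chi x f)%:~R * polychar f (h * x).

Definition char_sum f b : int := \sum_(B <- monics F b) chi B f.

Lemma gauss_sum_mul f h u : f \is monic -> coprimep f u ->
  gauss_sum f h = (chi u f)%:~R * gauss_sum f (h * u).
Proof.
move=> fm cu; rewrite /gauss_sum -(perm_big _ (perm_polys_mulmod fm cu)) /= big_map mulr_sumr.
apply: eq_bigr => x _; rewrite mulrA -rmorphM /= -chiMr //; congr (_%:~R * _).
  by apply: chi_modp => //; apply: dvdp_modB.
by apply: polychar_dvd; rewrite -mulrA -mulrBr dvdp_mull // dvdp_modB.
Qed.

Lemma exists_nonresidue P : mirr P -> exists r, legendre r P = -1.
Proof.
move=> Pi; have /mirrP[Pm Pirr] := Pi.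
pose mi : monic_irreducible_poly P := (Pirr, Pm).
have [|x xns] := @nonsquare_exists {poly %/ P with mi}.
  by rewrite pchar_qpoly odd_finField_pchar.
exists (x : {poly F}); rewrite /legendre.
have xE : x = in_qpoly P (x : {poly F}) :> {poly %/ P with mi}.
  exact/val_inj/esym/in_qpoly_small/size_mk_monic.
rewrite ifN; last first.
  rewrite -[val x]subr0 -in_qpoly_eq // rmorph0 -xE.
  by have := xns 0; rewrite expr0n.
case: asboolP => // -[h]; rewrite -in_qpoly_eq // rmorphXn -xE eq_sym => /eqP xh.
by case/eqP: (xns (in_qpoly P h)).
Qed.

(** Chinese remainders: u is a nonresidue modulo P and 1 modulo g. *)
Lemma exists_local_nonresidue P g : mirr P -> g \is monic -> ~~ (P %| g) ->
  exists u, g %| u - 1 /\ chi u (P * g) = -1.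
Proof.
move=> Pi gm nPg; have Pm := mirr_monic Pi.
have [r rP] := exists_nonresidue Pi.
have : coprimep P g by rewrite mirr_coprime.
case/Bezout_eq1_coprimepP => [[a b]] /= ab.
have gE : g %| r * b * g + a * P - 1.
  have -> : r * b * g + a * P - 1 = (r * b - b) * g by rewrite -ab; ring.
  by rewrite dvdp_mull.
have PE : P %| r * b * g + a * P - r.
  have -> : r * b * g + a * P - r = (a - r * a) * P by rewrite -{2}[r]mulr1 -ab; ring.
  by rewrite dvdp_mull.
exists (r * b * g + a * P); split => //.
rewrite chi_primeM // (chi_modp oq gm gE) chi_one // mulr1.
have cP x : chi x P = legendre x P by rewrite -{1}[P]mulr1 chi_primeM ?monic1 // chi1 mulr1.
by rewrite -cP (chi_modp oq Pm PE) cP.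
Qed.

(** For h prime to f this is a change of variables. If a prime P divides both, square-freeness gives
    u that is 1 modulo f / P and has symbol -1; then f divides h (u - 1), so passing from h to h u
    fixes the sum while [gauss_sum_mul] reverses its sign. *)
Lemma gauss_sumE f h : f \is monic -> sqfree f ->
  gauss_sum f h = (chi h f)%:~R * gauss_sum f 1.
Proof.
move=> fm sq; case: (boolP (coprimep f h)) => [cp|ncp].
  rewrite (gauss_sum_mul 1 fm cp) mul1r mulrA -rmorphM /=.
  have := chi_cases h fm; have : chi h f != 0 by rewrite chi_eq0 // cp.
  by rewrite !inE => /negPf -> /= /orP[] /eqP ->; rewrite mul1r.
have /eqP -> : chi h f == 0 by rewrite chi_eq0 // ncp.
rewrite mul0r.
have [P Pi /andP[Pf Ph]] : exists2 P, mirr P & (P %| f) && (P %| h).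
  pose d := gcdp f h; have d0 : d != 0 by rewrite gcdp_eq0 negb_and monic_neq0.
  have ld : lead_coef d != 0 by rewrite lead_coef_eq0.
  have vm : (lead_coef d)^-1 *: d \is monic by rewrite qualifE /= lead_coefZ mulVf.
  have [|P Pi] := exists_mirr vm.
    apply: contra ncp => /eqP v1; rewrite coprimep_def -/d.
    by rewrite -(size_scale d (invr_neq0 ld)) v1 size_poly1.
  by rewrite dvdpZr ?invr_neq0 // dvdp_gcd => ?; exists P.
have /dvdpP[g fE] := Pf; rewrite mulrC in fE.
have gm : g \is monic by rewrite -(monicMl _ (mirr_monic Pi)) -fE.
have nPg : ~~ (P %| g) by move: sq; rewrite fE sqfreeM // => /andP[].
have [u [gu cu]] := exists_local_nonresidue Pi gm nPg.
have cfu : coprimep f u by rewrite -[coprimep _ _]negbK -(chi_eq0 oq) // fE cu.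
have := gauss_sum_mul h fm cfu.
have -> : gauss_sum f (h * u) = gauss_sum f h.
  apply: eq_bigr => x _; congr (_ * _); apply: polychar_dvd.
  have -> : h * u * x - h * x = x * (h * (u - 1)) by ring.
  by rewrite dvdp_mull // fE dvdp_mul.
rewrite fE cu mulN1r => /eqP; rewrite -addr_eq0 -mulr2n mulrn_eq0 /=.
by move/eqP.
Qed.

(** Parseval: open the square and apply orthogonality in h with b = 0, which leaves the diagonal x =
    y. *)
Lemma sum_norm_gauss_sum f : f \is monic -> (1 < size f)%N ->
  \sum_(h <- polys F (size f).-1) `|gauss_sum f h| ^+ 2 =
  (q ^ (size f).-1)%:R * \sum_(x <- polys F (size f).-1) (chi x f)%:~R ^+ 2.
Proof.
move=> fm sf1; have sf := monic_size_gt0 fm.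
transitivity (\sum_(h <- polys F (size f).-1) \sum_(x <- polys F (size f).-1)
   \sum_(y <- polys F (size f).-1) ((chi x f)%:~R * (chi y f)%:~R : algC) * polychar f (h * (x - y))).
  apply: eq_bigr => h _; rewrite normCK /gauss_sum rmorph_sum /= mulr_suml.
  apply: eq_bigr => x _; rewrite mulr_sumr; apply: eq_bigr => y _.
  rewrite rmorphM /= rmorph_int -polycharN mulrBr polycharD; ring.
rewrite exchange_big mulr_sumr /=; apply: eq_big_seq => x; rewrite mem_polys => sx.
rewrite exchange_big /= (bigD1_seq x) ?polys_uniq ?mem_polys //=.
rewrite [X in _ + X]big1_seq ?addr0.
  rewrite -mulr_sumr -[(size f).-1]subn0 polychar_orthogonality ?subrr ?size_poly0 //.
  by rewrite subn0 mulrC expr2.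
move=> y /andP[yx]; rewrite mem_polys => sy.
rewrite -mulr_sumr -[X in polys F X]subn0 polychar_orthogonality //.
  by rewrite leqn0 size_poly_eq0 subr_eq0 eq_sym (negbTE yx) mulr0.
rewrite -(prednK sf) ltnS.
by rewrite (leq_trans (size_polyD _ _)) // geq_max sx size_polyN.
Qed.

(** By [gauss_sumE] the left side of Parseval is C |gauss_sum f 1|^2, with the same C > 0 as on the
    right. *)
Lemma norm_gauss_sum1 f : f \is monic -> (1 < size f)%N -> sqfree f ->
  `|gauss_sum f 1| ^+ 2 = (q ^ (size f).-1)%:R.
Proof.
move=> fm sf sq; have := sum_norm_gauss_sum fm sf.
set n := (size f).-1; set C : algC := \sum_(x <- polys F n) (chi x f)%:~R ^+ 2.
have C0 : C != 0.
  rewrite gt_eqF // /C (bigD1_seq 1) ?polys_uniq //=; last first.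
    by rewrite mem_polys size_poly1 /n; case: size sf => // -[].
  rewrite chi_one // expr1n ltr_pwDl ?ltr01 // sumr_ge0 // => x _.
  by rewrite -rmorphXn ler0z sqr_ge0.
rewrite (eq_bigr (fun h => (chi h f)%:~R ^+ 2 * `|gauss_sum f 1| ^+ 2)).
  by rewrite -mulr_suml -/C mulrC => /(mulIf C0).
by move=> h _; rewrite gauss_sumE // normrM exprMn real_normK // realz.
Qed.

Lemma gauss_sum0 f : f \is monic -> (1 < size f)%N -> sqfree f -> gauss_sum f 0 = 0.
Proof.
move=> fm sf sq; rewrite gauss_sumE //.
have /eqP -> : chi 0 f == 0 by rewrite chi_eq0 // coprimep0 -size_poly_eq1 gtn_eqF.
by rewrite mul0r.
Qed.

Lemma mem_polys_monic f x : f \is monic -> (x \in polys F (size f).-1) = (size x < size f)%N.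
Proof. by move=> fm; rewrite mem_polys -ltnS prednK // monic_size_gt0. Qed.

Lemma monics_divide f b : f \is monic -> ((size f).-1 <= b)%N ->
  perm_eq (monics F b)
    [seq f * H + x | H <- monics F (b - (size f).-1), x <- polys F (size f).-1].
Proof.
move=> fm fb; have sf := monic_size_gt0 fm; apply: uniq_perm; first exact: monics_uniq.
  apply: allpairs_uniq; rewrite ?monics_uniq ?polys_uniq //.
  move=> [H x] [H' x'] /allpairsP[[H1 x1] [_ /= + [-> ->]]] /allpairsP[[H2 x2] [_ /= + [-> ->]]] /=.
  rewrite !mem_polys_monic // => s1 s2 e.
  have /(congr1 (fun u => u %% f)) := e.
  rewrite !modpD !modp_mulr !modp_small // !add0r => xx; move: e; rewrite xx.
  by move/addIr/(mulfI (monic_neq0 fm)) => ->.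
move=> B; apply/monicsP/allpairsP => [[Bm sB]|[[H x] /= [/monicsP[Hm sH]]]].
  have BE := divp_eq B f; rewrite mulrC in BE.
  have sr : (size (B %% f)%R < size f)%N by rewrite ltn_modp monic_neq0.
  have f0 : f != 0 by rewrite monic_neq0.
  have d0 : B %/ f != 0.
    by rewrite divp_eq0 (negbTE f0) (negbTE (monic_neq0 Bm)) /= -leqNgt sB; move: fb sf; case: size.
  have sm : (size (B %% f)%R < size (f * (B %/ f))%R)%N.
    rewrite (leq_trans sr) // size_mul //; move: d0; rewrite -size_poly_gt0.
    by move: sf; case: (size f) => // k _; case: (size (_ %/ _)) => // l _; rewrite addSn addnS /= leq_addr.
  have dm : B %/ f \is monic.
    by move: Bm; rewrite {1}BE qualifE /= lead_coefDl // lead_coef_monicM // qualifE.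
  exists (B %/ f, B %% f); split => //=; last by rewrite mem_polys_monic.
  apply/monicsP; split=> //; rewrite size_divp // sB.
  by move: fb sf; case: size => // k /= kb _; rewrite subSn.
rewrite mem_polys_monic // => sx ->.
have sm : (size x < size (f * H)%R)%N.
  rewrite (leq_trans sx) // size_monicM // sH.
  by move: sf; case: (size f) => // k _; rewrite addSn addnS /= leq_addr.
split; first by rewrite qualifE /= lead_coefDl // lead_coef_monicM //; rewrite qualifE /= in Hm.
by rewrite size_polyDl // size_monicM // sH; move: fb sf; case: (size f) => // k kb _; rewrite addSn addnS /= subnKC.
Qed.

(** Division by f meets each residue class once for every quotient H, and the sum over all classes
    is [gauss_sum f 0]. *)
Lemma char_sum_sqfree_eq0 f b : f \is monic -> (1 < size f)%N -> sqfree f ->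
  ((size f).-1 <= b)%N -> char_sum f b = 0.
Proof.
move=> fm sf sq fb; rewrite /char_sum (perm_big _ (monics_divide fm fb)) /= big_flatten big_map big1 // => H _.
rewrite big_map (eq_bigr (fun x => chi x f)); last first.
  by move=> x _; apply: chi_modp => //; rewrite addrK dvdp_mulr.
have := gauss_sum0 fm sf sq; rewrite /gauss_sum.
rewrite (eq_bigr (fun x => (chi x f)%:~R)); last first.
  by move=> x _; rewrite mul0r polychar_small ?size_poly0 1?ltnW // coef0 psi0 mulr1.
by rewrite -rmorph_sum /= => /eqP; rewrite intr_eq0 => /eqP.
Qed.

(** Monic polynomials of degree b are the x modulo f with x - X^b of degree below b, a condition
    detected by orthogonality in h. *)
Lemma char_sum_poisson f b : f \is monic -> (b < (size f).-1)%N ->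
  (q ^ ((size f).-1 - b))%:R * (char_sum f b)%:~R =
  \sum_(h <- polys F ((size f).-1 - b)) polychar f (- (h * 'X^b)) * gauss_sum f h.
Proof.
move=> fm bf; have sf := monic_size_gt0 fm; set n := (size f).-1.
have nE : size f = n.+1 by rewrite prednK.
under eq_bigr => h _ do rewrite /gauss_sum mulr_sumr.
rewrite exchange_big /=.
transitivity (\sum_(x <- polys F n | (size (x - 'X^b)%R <= b)%N) (chi x f)%:~R * (q ^ (n - b))%:R : algC).
  rewrite -mulr_suml -rmorph_sum /= mulrC; congr (_%:~R * _).
  rewrite /char_sum -[RHS]big_filter; apply/perm_big/uniq_perm; rewrite ?(filter_uniq, monics_uniq, polys_uniq) //.
  move=> x; rewrite mem_filter mem_polys /monics.
  apply/mapP/andP => [[y]|[xb _]].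
    rewrite mem_polys => yb ->; have -> : 'X^b + y - 'X^b = y by ring.
    split => //.
    rewrite (leq_trans (size_polyD _ _)) // geq_max size_polyXn bf /=.
    exact: leq_trans yb (ltnW bf).
  by exists (x - 'X^b); rewrite ?mem_polys // addrC subrK.
rewrite big_mkcond; apply: eq_big_seq => x; rewrite mem_polys => sx.
rewrite (eq_bigr (fun h => (chi x f)%:~R * polychar f (h * (x - 'X^b)))); last first.
  by move=> h _; rewrite mulrBr polycharD; ring.
rewrite -mulr_sumr polychar_orthogonality //; last by rewrite nE ltnS ltnW.
  by case: ifP => // _; rewrite mulr0.
rewrite nE ltnS (leq_trans (size_polyD _ _)) // geq_max sx size_polyN size_polyXn.
exact: bf.
Qed.

(** The dual side has q^(n - b) terms, each at most |gauss_sum f 1|, and their number cancels the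
    factor on the left; hence no logarithm appears. *)
Lemma char_sum_sqfree_bound f b : f \is monic -> sqfree f -> (b < (size f).-1)%N ->
  (char_sum f b) ^+ 2 <= (q ^ (size f).-1)%:R.
Proof.
move=> fm sq bf; have sf : (1 < size f)%N by move: bf; case: size => // -[].
set n := (size f).-1; have Q0 : 0 < (q ^ (n - b))%:R :> algC.
  by rewrite ltr0n expn_gt0 (ltnW (finNzRing_gt1 F)).
have H : `|(char_sum f b)%:~R| <= `|gauss_sum f 1|.
  rewrite -(ler_pM2l Q0) -{1}[(q ^ _)%:R]ger0_norm ?(ltW Q0) // -normrM char_sum_poisson //.
  apply: le_trans (ler_norm_sum _ _ _) _.
  apply: le_trans (_ : \sum_(h <- polys F (n - b)) `|gauss_sum f 1| <= _).
    apply: ler_sum => h _; rewrite normrM /polychar psi_norm mul1r gauss_sumE // normrM.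
    by rewrite ler_piMl // -intr_norm -[1]/(1%:~R) ler_int chi_norm_le1.
  by rewrite big_const_seq count_predT size_polys iter_addr_0 mulr_natl.
rewrite -(ler_int algC) rmorphXn /= -(real_normK (realz _ _)) rmorph_nat -norm_gauss_sum1 //.
by rewrite lerXn2r ?nnegrE.
Qed.

Lemma polys_decomp k : perm_eq (polys F k.+1)
  (polys F k ++ [seq c *: m | c <- [seq c <- enum F | c != 0], m <- monics F k]).
Proof.
have uF : uniq [seq c <- enum F | c != 0] by apply/filter_uniq/enum_uniq.
apply: uniq_perm; first exact: polys_uniq.
  rewrite cat_uniq polys_uniq /=; apply/andP; split.
    apply/hasPn => _ /allpairsP[[c m] /= [+ /monicsP[mm sm] ->]].
    by rewrite mem_filter mem_polys => /andP[c0 _]; rewrite size_scale // sm ltnn.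
  apply: allpairs_uniq; rewrite ?monics_uniq ?uF //.
  move=> [c m] [c' m'] /allpairsP[[c1 m1] /= [+ + [-> ->]]] /allpairsP[[c2 m2] /= [+ + [-> ->]]] /=.
  rewrite !mem_filter => /andP[c0 _] /monicsP[mm _] /andP[_ _] /monicsP[mm' _] e.
  have := congr1 lead_coef e; rewrite !lead_coefZ !(monicP _) // !mulr1 => cc.
  by move: e; rewrite cc => /scalerI ->; rewrite // -cc.
move=> x; rewrite mem_cat !mem_polys; apply/idP/orP => [sx|[sx|]].
- have [sk|sk] := leqP (size x) k; [by left|right].
  have sx' : size x = k.+1 by apply/eqP; rewrite eqn_leq sx.
  have lx : lead_coef x != 0 by rewrite lead_coef_eq0 -size_poly_gt0 sx'.
  apply/allpairsP; exists (lead_coef x, (lead_coef x)^-1 *: x); split => /=.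
  + by rewrite mem_filter lx mem_enum.
  + by apply/monicsP; rewrite size_scale ?invr_eq0 // qualifE /= lead_coefZ mulVf.
  + by rewrite scalerA divff // scale1r.
- exact: leqW.
case/allpairsP => -[c m] /= [+ /monicsP[mm sm] ->].
by rewrite mem_filter => /andP[c0 _]; rewrite size_scale // sm.
Qed.

Lemma mirrX : mirr ('X : {poly F}).
Proof.
apply/mirrP; split; first exact: monicX.
by have := irredp_XsubC (0 : F); rewrite polyC0 subr0.
Qed.

Lemma qchi_nonresidue : exists2 c : F, c != 0 & qchi c = -1.
Proof.
have [r rX] := exists_nonresidue mirrX.
have cX : chi r 'X = -1 by rewrite -['X]mulr1 chi_primeM ?mirrX ?monic1 // chi1 mulr1.
have cE : qchi r.[0] = -1.
  rewrite /qchi -(chi_modp oq (monicX F) (_ : 'X %| r - _)) //.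
  by rewrite -['X]subr0 -(polyC0 F) dvdp_XsubCl /root !hornerE subrr.
exists r.[0] => //; apply/negP => /eqP r0; move: cE; rewrite r0 /qchi polyC0.
have /eqP -> // : chi 0 ('X : {poly F}) == 0.
by rewrite chi_eq0 ?monicX // coprimep0 -size_poly_eq1 size_polyX.
Qed.

(** Here deg f is odd, so scaling x by a nonresidue constant reverses the sign. *)
Lemma sum_chi_polys_odd f k : f \is monic -> ~~ odd (size f) -> \sum_(x <- polys F k) chi x f = 0.
Proof.
move=> fm of_; have [c c0 cn] := qchi_nonresidue.
have pc : perm_eq [seq c *: x | x <- polys F k] (polys F k).
  apply: perm_map_in; first exact: polys_uniq.
    by move=> x y _ _ /(scalerI c0).
  by move=> x; rewrite !mem_polys size_scale.
set S := \sum_(x <- _) _; suff : S = - S by lia.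
rewrite {1}/S -(perm_big _ pc) /= big_map -mulN1r mulr_sumr; apply: eq_bigr => x _.
rewrite -mul_polyC chiMr // chi_const // cn -signr_odd.
by have := monic_size_gt0 fm; move: of_; case: size => // n; rewrite /= negbK => ->.
Qed.

Definition const_gauss_sum n : algC :=
  \sum_(c <- [seq c <- enum F | c != 0]) (qchi c)%:~R ^+ n * psi (- c).

(** Since size f = k + b + 2, [polychar] reads the coefficient of X^k in h. The h of degree below k
    sum to 0 by [sum_chi_polys_odd]; the others are constants times monics, and the constants factor
    out as a Gauss sum over F. *)
Lemma sum_chi_polychar f k b : f \is monic -> ~~ odd (size f) -> size f = (k + b).+2 ->
  \sum_(h <- polys F k.+1) polychar f (- (h * 'X^b)) * (chi h f)%:~R =
  const_gauss_sum (size f).-1 * (char_sum f k)%:~R.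
Proof.
move=> fm of_ sf.
have eE h : (size h <= k.+1)%N -> polychar f (- (h * 'X^b)) = psi (- h`_k).
  move=> sh; rewrite polychar_small; last first.
    rewrite size_polyN sf mulrC; have [->|h0] := eqVneq h 0; first by rewrite mulr0 size_poly0.
    by rewrite mulrC size_mulXn // ltnS -addSn addnC leq_add2r.
  by rewrite sf /= coefN coefMXn ltnNge leq_addl /= addnK.
rewrite (perm_big _ (polys_decomp k)) big_cat /= [X in X + _](_ : _ = 0) ?add0r.
  rewrite big_flatten big_map /const_gauss_sum mulr_suml; apply: eq_big_seq => c.
  rewrite mem_filter => /andP[c0 _]; rewrite big_map /char_sum rmorph_sum /= mulr_sumr.
  apply: eq_big_seq => m /monicsP[mm sm]; rewrite eE ?size_scale ?sm // coefZ.
  have -> : m`_k = 1 by move/monicP: mm; rewrite lead_coefE sm.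
  rewrite mulr1 -mul_polyC chiMr // chi_const // rmorphM rmorphXn /=; ring.
rewrite (eq_big_seq (fun h => (chi h f)%:~R)); last first.
  move=> h; rewrite mem_polys => sh.
  by rewrite eE ?leqW // nth_default // oppr0 psi0 mul1r.
by rewrite -rmorph_sum /= sum_chi_polys_odd.
Qed.

(** The product K of the two Gauss sums is not evaluated: the case b = 2g, whose dual sum is 1,
    expresses K through [char_sum f (2 * g)]. *)
Lemma char_sum_odd_duality f (g b : nat) : f \is monic -> sqfree f -> size f = (2 * g).+2 -> (b <= 2 * g)%N ->
  (q ^ (2 * g - b))%:R * char_sum f b = char_sum f (2 * g) * char_sum f (2 * g - b).
Proof.
move=> fm sq sf bg; have of_ : ~~ odd (size f) by rewrite sf /= negbK mul2n odd_double.
pose K := const_gauss_sum (size f).-1 * gauss_sum f 1.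
have key c : (c <= 2 * g)%N ->
    (q ^ (2 * g - c).+1)%:R * (char_sum f c)%:~R = K * (char_sum f (2 * g - c))%:~R.
  move=> cg; have sfc : ((size f).-1 - c = (2 * g - c).+1)%N by rewrite sf /= subSn.
  have := @char_sum_poisson f c fm; rewrite sfc sf ltnS => -> //.
  rewrite (eq_bigr (fun h => polychar f (- (h * 'X^c)) * (chi h f)%:~R * gauss_sum f 1)); last first.
    by move=> h _; rewrite gauss_sumE // mulrA.
  rewrite -mulr_suml (@sum_chi_polychar f (2 * g - c) c) //; last by rewrite subnK.
  by rewrite /K; ring.
have S0 : char_sum f 0 = 1 by rewrite /char_sum monics0 big_seq1 chi_one.
have KE : K = (q%:R * char_sum f (2 * g))%:~R.
  have := key _ (leqnn _); rewrite subnn S0 mulr1 => <-.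
  by rewrite rmorphM /= rmorph_nat expn1.
have q0 : (q%:R : algC) != 0 by rewrite pnatr_eq0 -lt0n ltnW // finNzRing_gt1.
apply: (@mulrIz algC 1 (oner_neq0 _)); rewrite !rmorphM /= rmorph_nat; apply: (mulfI q0).
have := key _ bg; rewrite KE rmorphM /= rmorph_nat expnS natrM -!mulrA => ->.
by [].
Qed.

End GaussSum.

Lemma sqr_subr_le4 (R : realDomainType) (x z Q : R) :
  x ^+ 2 <= Q -> z ^+ 2 <= Q -> (x - z) ^+ 2 <= 4 * Q.
Proof. by move=> xQ zQ; have := sqr_ge0 (x + z); nra. Qed.

(** * Character sums for nonsquare f, and the functional equation *)

Section CharSums.
Variable F : finFieldType.
Hypothesis oq : odd #|F|.
Implicit Types (f h A B D E P : {poly F}).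
Local Notation q := #|F|.

Lemma q_gt2 : (2 < q)%N.
Proof. by move: oq (finNzRing_gt1 F); case: #|F| => // -[|[|[]]]. Qed.

Definition square f := `[< exists2 h, h \is monic & f = h ^+ 2 >].

(** The symbol at P^2 is the indicator of P not dividing B; the subtracted term collects the
    multiples of P. *)
Lemma char_sum_sqM P f b d : mirr P -> f \is monic -> P \in monics F d ->
  char_sum (P ^+ 2 * f) b =
  char_sum f b - (if (d <= b)%N then chi P f * char_sum f (b - d) else 0).
Proof.
move=> Pi fm Pd; have Pm := mirr_monic Pi.
have -> : (if (d <= b)%N then chi P f * char_sum f (b - d) else 0) =
    \sum_(B <- monics F b | P %| B) chi B f.
  rewrite (sum_monics_dvd b _ Pd); case: ifP => // _.
  by rewrite /char_sum mulr_sumr; apply: eq_bigr => B _; rewrite chiMr.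
have -> : char_sum f b = \sum_(B <- monics F b | P %| B) chi B f +
    \sum_(B <- monics F b | ~~ (P %| B)) chi B f.
  by rewrite /char_sum (bigID (fun B => P %| B)).
rewrite addrC addKr.
rewrite [RHS]big_mkcond; apply: eq_bigr => B _.
rewrite expr2 -mulrA !chi_primeM ?monicMl // mulrA.
rewrite /legendre; case: (P %| B) => /=; first by rewrite !mul0r.
by case: ifP => _; rewrite ?mulrNN ?mul1r.
Qed.

Lemma square_mirrM P f : mirr P -> f \is monic -> ~~ square (P ^+ 2 * f) -> ~~ square f.
Proof.
move=> Pi fm; apply: contra => /asboolP[h hm ->]; apply/asboolP.
by exists (P * h); rewrite ?exprMn // monicMl // mirr_monic.
Qed.

Lemma nonsqfree_factor f : f \is monic -> ~~ sqfree f ->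
  exists P f' d, [/\ mirr P, f' \is monic, f = P ^+ 2 * f', P \in monics F d.+1 &
    size f = (size f' + 2 * d.+1)%N].
Proof.
move=> fm nsq; have [P Pi /dvdpP[f' fE]] := sqfreePn fm nsq.
have Pm := mirr_monic Pi; have sP := mirr_size Pi.
have P2m : P ^+ 2 \is monic by rewrite monic_exp.
have f'm : f' \is monic by rewrite -(monicMr _ P2m) -fE.
exists P, f', (size P).-2; split=> //; first by rewrite fE mulrC.
  by apply/monicsP; split => //; move: sP; case: (size P) => // -[].
rewrite fE (size_monicM f'm P2m) expr2 (size_monicM Pm Pm).
have := monic_size_gt0 f'm; move: sP; move: (size P) (size f') => a b; lia.
Qed.

Lemma square1 : square (1 : {poly F}).
Proof. by apply/asboolP; exists 1; rewrite ?monic1 ?expr1n. Qed.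

Lemma nonsquare_size f : f \is monic -> ~~ square f -> (1 < size f)%N.
Proof.
move=> fm; apply: contraR; rewrite -leqNgt => sf.
rewrite (monic_size1 fm) ?square1 //; apply/eqP; rewrite eqn_leq sf.
exact: monic_size_gt0.
Qed.

(** When f is not square-free, one degree is gained: if f = P^2 f' has degree at most b + 1, then f'
    has degree at most b - deg P, so both sums in [char_sum_sqM] vanish. [char_sum_top] needs this
    extra degree. *)
Lemma char_sum_eq0 f b : f \is monic -> ~~ square f -> (size f <= (b + ~~ sqfree f).+1)%N ->
  char_sum f b = 0.
Proof.
have [psi [psiD psi1 psin]] := additive_char_exists F.
have [n] := ubnP (size f); elim: n f b => // n IH f b; rewrite ltnS => sn fm nsq fb.
case: (boolP (sqfree f)) => [sq|nf].
  apply: (char_sum_sqfree_eq0 oq psiD psi1) => //; first exact: nonsquare_size.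
  by move: fb (monic_size_gt0 fm); rewrite sq addn0; case: size.
have [P [f' [d [Pi f'm fE Pd sf]]]] := nonsqfree_factor fm nf.
have nsq' : ~~ square f' by rewrite fE in nsq; exact: square_mirrM nsq.
have V c : (size f' <= c.+1)%N -> char_sum f' c = 0.
  move=> fc; apply: IH => //; first by move: sn; rewrite sf; move: (size f') => a; lia.
  by rewrite (leq_trans fc) // ltnS leq_addr.
rewrite fE (char_sum_sqM b Pi f'm Pd) !V ?mulr0 ?if_same ?subr0 //.
  by move: fb; rewrite nf sf; move: (size f') => a; lia.
by move: fb; rewrite nf sf; move: (size f') => a; lia.
Qed.

(** Restoring a factor P^2 at most doubles the bound, so the squared bound grows by 4, which is
    below q^(2 deg P). Squaring keeps q^(deg f / 2) among the integers. *)
Lemma char_sum_bound f b : f \is monic -> ~~ square f ->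
  (char_sum f b) ^+ 2 <= (q ^ (size f).-1)%:R.
Proof.
have [psi [psiD psi1 psin]] := additive_char_exists F.
have [n] := ubnP (size f); elim: n f b => // n IH f b; rewrite ltnS => sn fm nsq.
case: (boolP (sqfree f)) => [sq|nf].
  have [bf|fb] := ltnP b (size f).-1.
    exact: (char_sum_sqfree_bound oq psiD psi1 psin).
  rewrite (char_sum_sqfree_eq0 oq psiD psi1) ?nonsquare_size //.
have [P [f' [d [Pi f'm fE Pd sf]]]] := nonsqfree_factor fm nf.
have nsq' : ~~ square f' by rewrite fE in nsq; exact: square_mirrM nsq.
have V c : (char_sum f' c) ^+ 2 <= (q ^ (size f').-1)%:R.
  by apply: IH => //; move: sn; rewrite sf; move: (size f') => a; lia.
rewrite fE (char_sum_sqM b Pi f'm Pd) -fE sf.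
have -> : ((size f' + 2 * d.+1).-1 = (size f').-1 + 2 * d.+1)%N.
  by have := monic_size_gt0 f'm; case: size.
have q4 : (4 <= q ^ (2 * d.+1))%N.
  rewrite expnM (leq_trans (_ : _ <= 4 ^ d.+1)%N) //; first by rewrite expnS leq_pmulr // expn_gt0.
  by rewrite leq_exp2r // (@leq_exp2r 2 q 2) // ltnW // q_gt2.
rewrite expnD natrM; set Q := (q ^ (size f').-1)%:R.
have Q0 : 0 <= Q by rewrite /Q.
have H4 : 4 * Q <= Q * (q ^ (2 * d.+1))%:R.
  by rewrite mulrC ler_wpM2l // ler_nat.
apply: le_trans H4; set x := char_sum f' b.
apply: sqr_subr_le4; first exact: V.
case: ifP => _; last by rewrite expr0n.
have := chi_cases P f'm; rewrite !inE => /or3P[] /eqP ->; rewrite ?mul0r ?mul1r ?mulN1r ?sqrrN //.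
Qed.

Lemma sum_squares (V : nmodType) n (G : {poly F} -> V) :
  (forall B, B \in monics F n -> ~~ square B -> G B = 0) ->
  \sum_(B <- monics F n) G B = if odd n then 0 else \sum_(h <- monics F n./2) G (h ^+ 2).
Proof.
move=> G0; rewrite (bigID square) /= [X in _ + X]big1_seq ?addr0; last first.
  by move=> B /andP[nB Bn]; apply: G0.
have sq2 h : h \is monic -> (size (h ^+ 2)).-1 = ((size h).-1).*2.
  by move=> hm; rewrite size_exp mulnC mul2n.
have sqs h : h \is monic -> size (h ^+ 2) = ((size h).-1).*2.+1.
  move=> hm; rewrite -sq2 // prednK // monic_size_gt0 // monic_exp //.
case: ifPn => on.
  rewrite big_seq_cond big1 // => B /andP[/monicsP[Bm sB] /asboolP[h hm BE]].
  by move: sB on; rewrite BE sqs // => -[<-]; rewrite odd_double.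
rewrite -big_filter (perm_big [seq h ^+ 2 | h <- monics F n./2]) ?big_map //=.
apply: uniq_perm; rewrite ?filter_uniq ?monics_uniq //.
  rewrite map_inj_in_uniq ?monics_uniq // => h k /monicsP[hm _] /monicsP[km _] /eqP.
  rewrite eqf_sqr => /orP[/eqP //|/eqP hk].
  have := congr1 lead_coef hk; rewrite lead_coefN !(monicP _) // => e.
  have /negP[] := negbT (odd_finField_pchar oq).
  by rewrite inE /= mulr2n {1}e addNr.
move=> B; rewrite mem_filter; apply/andP/mapP => [[/asboolP[h hm ->] /monicsP[_ sB]]|[h /monicsP[hm sh] ->]].
  exists h => //; apply/monicsP; split => //; move: sB; rewrite sqs // => -[<-].
  by rewrite doubleK prednK // monic_size_gt0.
split; first by apply/asboolP; exists h.
by apply/monicsP; rewrite monic_exp // sqs // sh /= even_halfK.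
Qed.

Lemma char_sum_sq h n : h \is monic ->
  char_sum (h ^+ 2) n = \sum_(D <- monics F n) (coprimep h D)%:R.
Proof.
move=> hm; apply: eq_bigr => D _; rewrite expr2 chiMl //.
have := chi_cases D hm; have := chi_eq0 oq D hm.
case: (coprimep h D) => /=; last by move=> /eqP ->; rewrite mul0r.
by rewrite !inE => -> /= /orP[] /eqP ->.
Qed.

Lemma count_monics_dvd e k E : E \in monics F e ->
  \sum_(f <- monics F k) (E %| f)%R%:R = if (e <= k)%N then (q ^ (k - e))%:R else 0 :> int.
Proof.
move=> Ee; rewrite (eq_bigr (fun f => if E %| f then 1 else 0)); last first.
  by move=> f _; case: ifP.
rewrite -big_mkcond /= (sum_monics_dvd _ _ Ee); case: ifP => // _.
by rewrite big_const_seq count_predT size_monics iter_addr_0.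
Qed.

(** The coefficients of 1/zeta_A = 1 - q u in u = q^(-s): 1, then -q, then 0. *)
Definition mobius_sum e : int := \sum_(E <- monics F e) pmobius E.

Lemma sum_pmobius_deg n (W : nat -> int) :
  \sum_(E <- monics_le F n) pmobius E * W (size E).-1 = \sum_(e < n.+1) mobius_sum e * W e.
Proof.
rewrite (sum_monics_le n xpredT); apply: eq_bigr => e _.
rewrite /mobius_sum mulr_suml; apply: eq_big_seq => E /monicsP[_ sE].
by rewrite sE.
Qed.

Lemma monics_le_monics n E : E \in monics_le F n -> E \in monics F (size E).-1.
Proof.
by rewrite mem_monics_le => /andP[Em _]; apply/monicsP; rewrite prednK // monic_size_gt0.
Qed.

(** The sum counts the monic D of degree n that are prime to themselves, which leaves only D = 1. *)
Lemma mobius_sum_conv n : \sum_(e < n.+1) mobius_sum e * (q ^ (n - e))%:R = (n == 0%N)%:R.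
Proof.
pose W e : int := if (e <= n)%N then (q ^ (n - e))%:R else 0.
transitivity (\sum_(e < n.+1) mobius_sum e * W e).
  by apply: eq_bigr => e _; rewrite /W -ltnS ltn_ord.
rewrite -sum_pmobius_deg.
transitivity (\sum_(E <- monics_le F n) \sum_(D <- monics F n) pmobius E * (E %| D)%R%:R).
  apply: eq_big_seq => E /monics_le_monics En.
  by rewrite -mulr_sumr (count_monics_dvd _ En).
rewrite exchange_big /=.
transitivity (\sum_(D <- monics F n) (coprimep D D)%:R : int).
  apply: eq_big_seq => D /monicsP[Dm sD].
  rewrite -(@sum_pmobius_coprime _ n) ?sD // [RHS]big_mkcond.
  by apply: eq_bigr => E _; rewrite andbb; case: (E %| D); rewrite ?mulr1 ?mulr0.
case: n W => [|n] _; first by rewrite monics0 big_seq1 coprimep1.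
rewrite big1_seq // => D /monicsP[Dm sD].
rewrite coprimep_def gcdpp sD //.
Qed.

Lemma mobius_sum0 : mobius_sum 0 = 1.
Proof. by rewrite /mobius_sum monics0 big_seq1 pmobius1. Qed.

Lemma mobius_sumS m : mobius_sum m.+1 = - (q%:R * (m == 0%N)%:R).
Proof.
have := mobius_sum_conv m.+1; rewrite big_ord_recr /= subnn mulr1 => /eqP.
rewrite addr_eq0 => /eqP e; rewrite -[LHS]opprK -e -(mobius_sum_conv m) mulr_sumr.
congr (- _); apply: eq_bigr => i _.
have im : (i <= m)%N by rewrite -ltnS.
by rewrite subSn // expnS natrM; ring.
Qed.

Lemma mobius_sum_eval n (W : nat -> int) :
  \sum_(e < n.+2) mobius_sum e * W e = W 0%N - q%:R * W 1%N.
Proof.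
rewrite !big_ord_recl big1 => [|e _].
  by rewrite mobius_sum0 mobius_sumS /= addr0 mul1r mulr1 mulNr.
by rewrite /= /bump /= !add1n mobius_sumS mulr0 oppr0 mul0r.
Qed.

Lemma count_sqfree n : (1 < n)%N ->
  \sum_(D <- monics F n) (sqfree D)%:R = (q ^ n)%:R - (q ^ n.-1)%:R :> int.
Proof.
case: n => [|[|n]] // _; pose W e : int := if (e * 2 <= n.+2)%N then (q ^ (n.+2 - e * 2))%:R else 0.
transitivity (\sum_(E <- monics_le F n.+2) pmobius E * W (size E).-1); last first.
  rewrite sum_pmobius_deg mobius_sum_eval /W mul0n subn0 mul1n /= -natrM -expnS.
  by rewrite subSS subSS subn0.
transitivity (\sum_(E <- monics_le F n.+2) \sum_(D <- monics F n.+2) pmobius E * (E ^+ 2 %| D)%R%:R).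
  rewrite exchange_big /=; apply: eq_big_seq => D /monicsP[Dm sD].
  rewrite -(@sum_pmobius_sqfree _ n.+2) ?sD // [LHS]big_mkcond.
  by apply: eq_bigr => E _; case: (E ^+ 2 %| D); rewrite ?mulr1 ?mulr0.
apply: eq_big_seq => E /monics_le_monics /monicsP[Em sE]; rewrite -mulr_sumr.
rewrite (@count_monics_dvd ((size E).-1 * 2)) //; apply/monicsP; rewrite monic_exp //; split => //.
by rewrite -size_exp prednK // monic_size_gt0 // monic_exp.
Qed.

Lemma count_coprime_pairs a b :
  \sum_(h <- monics F a.+1) \sum_(D <- monics F b.+1) (coprimep h D)%:R =
  (q ^ (a.+1 + b.+1))%:R - (q ^ (a + b).+1)%:R :> int.
Proof.
pose W e : int := (if (e <= a.+1)%N then (q ^ (a.+1 - e))%:R else 0) *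
                  (if (e <= b.+1)%N then (q ^ (b.+1 - e))%:R else 0).
transitivity (\sum_(E <- monics_le F a.+1) pmobius E * W (size E).-1); last first.
  by rewrite sum_pmobius_deg mobius_sum_eval /W !subn0 !subn1 /= -!natrM -expnD -expnD -expnS.
transitivity (\sum_(E <- monics_le F a.+1) \sum_(h <- monics F a.+1) \sum_(D <- monics F b.+1)
    pmobius E * ((E %| h)%R%:R * (E %| D)%R%:R)); last first.
  apply: eq_big_seq => E /monics_le_monics En.
  rewrite /W -!(count_monics_dvd _ En) mulr_suml mulr_sumr; apply: eq_bigr => h _.
  by rewrite mulr_sumr mulr_sumr.
rewrite [RHS]exchange_big /=; apply: eq_big_seq => h /monicsP[hm sh].
rewrite [RHS]exchange_big /=; apply: eq_bigr => D _.
rewrite -(@sum_pmobius_coprime _ a.+1) ?sh // [LHS]big_mkcond.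
by apply: eq_bigr => E _; case: (E %| h); case: (E %| D); rewrite ?mulr1 ?mulr0.
Qed.

Lemma odd_nonsquare D g : D \in monics F (2 * g).+1 -> ~~ square D.
Proof.
move=> /monicsP[Dm sD]; apply/asboolP => -[h hm DE].
have : (size D).-1 = ((size h).-1 * 2)%N by rewrite DE size_exp.
by rewrite sD /= => /(congr1 odd); rewrite oddM andbF /= mul2n odd_double.
Qed.

Lemma chi_eps_sq : chi_eps F ^+ 2 = 1.
Proof. by rewrite /chi_eps sqrr_sign. Qed.

(** After exchanging sums, reciprocity costs no sign because deg B = 2g is even. Nonsquare B have
    degree below 2g + 1 and cancel; B = h^2 leaves the coprime pairs (h, D). *)
Lemma sum_char_sum_top g : (0 < g)%N ->
  \sum_(D <- monics F (2 * g).+1) char_sum D (2 * g) = (q ^ (3 * g).+1)%:R - (q ^ (3 * g))%:R.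
Proof.
case: g => // g _; rewrite /char_sum exchange_big /=.
transitivity (\sum_(B <- monics F (2 * g.+1)) char_sum B (2 * g.+1).+1).
  apply: eq_big_seq => B /monicsP[Bm sB]; apply: eq_big_seq => D /monicsP[Dm sD].
  rewrite (chi_reciprocity oq Dm Bm) sB sD /= mulnC -mulnA exprM chi_eps_sq expr1n mul1r //.
rewrite sum_squares => [|B /monicsP[Bm sB] nsq]; last first.
  by apply: char_sum_eq0; rewrite // sB ltnS leqW // leq_addr.
rewrite mul2n odd_double /= doubleK -mul2n.
rewrite (eq_big_seq (fun h => \sum_(D <- monics F (2 * g.+1).+1) (coprimep h D)%:R)).
  by rewrite count_coprime_pairs; congr ((q ^ _)%:R - (q ^ _)%:R); lia.
by move=> h /monicsP[hm _]; rewrite char_sum_sq.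
Qed.

(** Duality at b = 0 leaves two signs, so every gap q^g - [char_sum E (2 * g)] is nonnegative for
    square-free E. The other E have sum 0 by [char_sum_eq0], and q^g times the number of square-free
    E equals [sum_char_sum_top]; so every gap is 0. *)
Lemma char_sum_top D g : (0 < g)%N -> D \in monics F (2 * g).+1 -> sqfree D ->
  char_sum D (2 * g) = (q ^ g)%:R.
Proof.
move=> g0 DN sqD.
have [psi [psiD psi1 psin]] := additive_char_exists F.
have top E : E \in monics F (2 * g).+1 -> sqfree E -> (char_sum E (2 * g)) ^+ 2 = ((q ^ g)%:R) ^+ 2.
  move=> /monicsP[Em sE] sqE.
  have := char_sum_odd_duality oq psiD psi1 psin Em sqE sE (leq0n _).
  rewrite subn0 {1}/char_sum monics0 big_seq1 chi_one // mulr1 => e.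
  by rewrite expr2 -e expr2 -natrM -expnD addnn mul2n.
have Q0 : 0 <= (q ^ g)%:R :> int by [].
have le E : E \in monics F (2 * g).+1 -> sqfree E -> 0 <= (q ^ g)%:R - char_sum E (2 * g).
  move=> EN sqE; have := top E EN sqE; move: Q0; set x := char_sum _ _; set y := (q ^ g)%:R.
  move=> y0 /eqP; rewrite eqf_sqr subr_ge0 => /orP[/eqP -> //|/eqP ->].
  by rewrite (le_trans _ y0) // oppr_le0.
have : \sum_(E <- monics F (2 * g).+1 | sqfree E && (E \in monics F (2 * g).+1))
    ((q ^ g)%:R - char_sum E (2 * g)) = 0.
  transitivity (\sum_(E <- monics F (2 * g).+1) ((sqfree E)%:R * (q ^ g)%:R - char_sum E (2 * g))).
    rewrite big_mkcond; apply: eq_big_seq => E EN; rewrite EN andbT; case: ifPn => sqE.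
      by rewrite mul1r.
    rewrite char_sum_eq0 ?subr0 ?mul0r //; first by case/monicsP: EN.
      exact: odd_nonsquare EN.
    by rewrite sqE; case/monicsP: EN => _ ->; rewrite addn1.
  rewrite big_split /= -mulr_suml count_sqfree ?sumrN ?sum_char_sum_top //; last by lia.
  rewrite /= mulrBl -!natrM -!expnD.
  have -> : ((2 * g).+1 + g = (3 * g).+1)%N by lia.
  have -> : (2 * g + g = 3 * g)%N by lia.
  by rewrite subrr.
move/eqP; rewrite psumr_eq0; last by move=> E /andP[sqE EN]; apply: le.
move/allP/(_ D DN); rewrite DN sqD /= subr_eq0 => /eqP <- //.
Qed.

Definition L_coef D n : int := \sum_(f <- monics F n) chi D f.

Lemma L_coefE D n : D \is monic ->
  L_coef D n = chi_eps F ^+ (n * (size D).-1) * char_sum D n.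
Proof.
move=> Dm; rewrite /L_coef /char_sum mulr_sumr; apply: eq_big_seq => f /monicsP[fm sf].
by rewrite (chi_reciprocity oq fm Dm) sf.
Qed.

Lemma L_coef_functional_equation D g n : (0 < g)%N -> D \in monics F (2 * g).+1 -> sqfree D ->
  (n <= g)%N -> L_coef D (2 * g - n) = (q ^ (g - n))%:R * L_coef D n.
Proof.
move=> g0 DN sqD ng; have /monicsP[Dm sD] := DN.
have [psi [psiD psi1 psin]] := additive_char_exists F.
have n2g : (n <= 2 * g)%N by lia.
have := char_sum_odd_duality oq psiD psi1 psin Dm sqD sD n2g.
rewrite char_sum_top // !L_coefE //.
have -> : (2 * g - n = (g - n) + g)%N by lia.
(* The factor q^g of q^(2g - n) cancels against the value q^g supplied by [char_sum_top]. *)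
rewrite expnD natrM -mulrA mulrCA => /mulfI H.
have {H} <- : (q ^ (g - n))%:R * char_sum D n = char_sum D (g - n + g).
  by rewrite H // pnatr_eq0 -lt0n expn_gt0 (ltnW (ltnW q_gt2)).
rewrite mulrCA; congr (_ * (_ * _)).
(* The two exponents of [chi_eps] differ by an even number, so the reciprocity signs agree. *)
have -> : ((g - n + g) * (size D).-1 = 2 * ((g - n) * (size D).-1) + n * (size D).-1)%N by nia.
by rewrite exprD exprM chi_eps_sq expr1n mul1r.
Qed.

End CharSums.

(** * Averages over square-free polynomials *)

Section GeometricSums.
Variable R : realFieldType.

(** Ratio 2 suffices throughout: it bounds q from below and, by [r3_ge2], also q^(3/4). *)
Lemma geometric_up (G : nat -> R) j k : (forall a, 0 <= G a) -> (forall a, 2 * G a <= G a.+1) ->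
  \sum_(j <= a < k) G a <= G k.
Proof.
move=> G0 G2; elim: k => [|k IH]; first by rewrite big_geq.
have [jk|kj] := leqP j k; last by rewrite big_geq.
by rewrite big_nat_recr //=; have := G2 k; lra.
Qed.

Lemma geometric_down (G : nat -> R) j k : (forall a, 0 <= G a) ->
  (forall a, (j <= a)%N -> (a.+1 < k)%N -> 2 * G a.+1 <= G a) ->
  \sum_(j <= a < k) G a <= 2 * G j.
Proof.
move=> G0; have [n] := ubnP (k - j); elim: n j => // n IH j kj G2.
have [jk|kj'] := ltnP j k; last by rewrite big_geq // mulr_ge0.
rewrite big_ltn //; have [jk2|kj2] := ltnP j.+1 k; last first.
  by rewrite big_geq //; have := G0 j; lra.
have := IH j.+1; have := G2 j (leqnn _) jk2 => H1 H2.
have : \sum_(j.+1 <= a < k) G a <= 2 * G j.+1.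
  by apply: H2 => [|a ja]; [lia|apply: G2; exact: ltnW].
lra.
Qed.

End GeometricSums.

(** * The square-free sieve and the density of square-free D prime to E *)

Section Averages.
Variables (R : realType) (F : finFieldType).
Hypothesis oq : odd #|F|.
Implicit Types (f h A B D E P : {poly F}).
Local Notation q := #|F|.
Local Notation qR := (#|F|%:R : R).

Definition chi_avg N f : int := \sum_(D <- monics F N | sqfree D) chi D f.

Lemma sqfree_sieve N f : f \is monic -> chi_avg N f =
  \sum_(a < N.+1) (if (a * 2 <= N)%N
     then (\sum_(A <- monics F a) pmobius A * chi A f ^+ 2) * char_sum f (N - a * 2) else 0).
Proof.
move=> fm.
transitivity (\sum_(A <- monics_le F N) \sum_(D <- monics F N | A ^+ 2 %| D) pmobius A * chi D f).
  rewrite (exchange_big_dep predT) //= /chi_avg big_mkcond; apply: eq_big_seq => D /monicsP[Dm sD].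
  rewrite -mulr_suml sum_pmobius_sqfree ?sD //; case: (sqfree D); rewrite ?mul1r ?mul0r //.
rewrite (sum_monics_le N xpredT); apply: eq_bigr => a _.
rewrite mulr_suml -(fun_if (fun x => x)).
transitivity (\sum_(A <- monics F a) if (a * 2 <= N)%N then
   (pmobius A * chi A f ^+ 2) * char_sum f (N - a * 2) else 0); last first.
  by case: ifP => // _; rewrite big1.
apply: eq_big_seq => A /monicsP[Am sA].
have A2 : A ^+ 2 \in monics F (a * 2).
  have sA2 : (size (A ^+ 2)).-1 = (a * 2)%N by rewrite size_exp sA.
  by apply/monicsP; rewrite monic_exp // -sA2 prednK // monic_size_gt0 // monic_exp.
rewrite (sum_monics_dvd _ _ A2); case: ifP => // _.
rewrite /char_sum mulr_sumr; apply: eq_bigr => l _.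
by rewrite chiMr // expr2 chiMr //; ring.
Qed.

Lemma char_sum_trivial f b : f \is monic -> `|char_sum f b| <= (q ^ b)%:R.
Proof.
move=> fm; apply: le_trans (ler_norm_sum _ _ _) _.
apply: le_trans (_ : \sum_(B <- monics F b) 1 <= _).
  by apply: ler_sum => B _; apply: chi_norm_le1.
by rewrite big_const_seq count_predT size_monics iter_addr_0.
Qed.

Lemma chi_avg_le N f : f \is monic -> `|chi_avg N f| <=
  \sum_(a < N.+1) (if (a * 2 <= N)%N then (q ^ a)%:R * `|char_sum f (N - a * 2)| else 0).
Proof.
move=> fm; rewrite sqfree_sieve //; apply: le_trans (ler_norm_sum _ _ _) _.
apply: ler_sum => a _; case: ifP => _; last by rewrite normr0.
rewrite normrM ler_wpM2r //; apply: le_trans (ler_norm_sum _ _ _) _.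
apply: le_trans (_ : \sum_(B <- monics F a) 1 <= _).
  rewrite big_seq [leRHS]big_seq; apply: ler_sum => B /monicsP[Bm _].
  by rewrite normrM normrX mulr_ile1 ?exprn_ge0 // ?pmobius_le1 // exprn_ile1 ?chi_norm_le1.
by rewrite big_const_seq count_predT size_monics iter_addr_0.
Qed.

Lemma qR_ge3 : 3 <= qR.
Proof. by rewrite (ler_nat R 3) q_gt2. Qed.


Definition sqfree_coprime E n : int := \sum_(D <- monics F n | sqfree D) (coprimep E D)%:R.

Lemma sqfree_mul E D : E \is monic -> D \is monic ->
  sqfree (E * D) = [&& sqfree E, sqfree D & coprimep E D].
Proof.
move=> + Dm; move: E; apply: monic_ind => [|P E Pi Em IH].
  by rewrite mul1r sqfree1 coprime1p andbT.
rewrite -mulrA sqfreeM ?monicMl // IH sqfreeM // coprimepMl mirr_dvdM // (mirr_coprime D Pi) negb_or.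
by case: (sqfree E); case: (sqfree D); case: (coprimep E D); case: (P %| E); case: (P %| D).
Qed.

(** Split the D prime to f by whether P divides D; if D = P D' is square-free, then D' is prime to P
    f. The density estimate inducts on this recursion. *)
Lemma sqfree_coprimeM P f d n : mirr P -> f \is monic -> P \in monics F d -> ~~ (P %| f) ->
  sqfree_coprime f n = sqfree_coprime (P * f) n +
    (if (d <= n)%N then sqfree_coprime (P * f) (n - d) else 0).
Proof.
move=> Pi fm Pd Pf; rewrite /sqfree_coprime.
rewrite -(fun_if (fun x => x)) big_mkcond (bigID (fun D => P %| D)) /= addrC; congr (_ + _).
  rewrite big_mkcond [RHS]big_mkcond; apply: eq_bigr => D _; rewrite coprimepMl (mirr_coprime D Pi).
  by case: (P %| D); case: (sqfree D).
rewrite (sum_monics_dvd _ _ Pd); case: ifP => // _; rewrite [RHS]big_mkcond.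
apply: eq_big_seq => D /monicsP[Dm _].
rewrite sqfreeM // coprimepMr coprimepMl [coprimep f P]coprimep_sym (mirr_coprime f Pi) (mirr_coprime D Pi) Pf /=.
by case: (sqfree D); case: (P %| D).
Qed.

(** For square-free E this is (1 - 1/q) times the product of 1 / (1 + 1/|P|) over P dividing E, the
    density of square-free polynomials prime to E. *)
Definition density E : R := (1 - qR^-1) * (pnorm E)%:R / pweight R E.

Lemma pnorm_monic E : E \is monic -> pnorm E = (q ^ (size E).-1)%N.
Proof. by move=> Em; rewrite /pnorm (negbTE (monic_neq0 Em)). Qed.

Lemma pnormM E D : E \is monic -> D \is monic -> pnorm (E * D) = (pnorm E * pnorm D)%N.
Proof.
move=> Em Dm; rewrite !pnorm_monic ?monicMl // -expnD size_monicM //.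
have := monic_size_gt0 Dm; have := monic_size_gt0 Em.
by case: (size E) => // a _; case: (size D) => // b _; rewrite addSn addnS.
Qed.

Lemma pweight_ge E : E \is monic -> sqfree E -> (pnorm E)%:R <= pweight R E.
Proof.
move: E; apply: monic_ind => [_|P E Pi Em IH].
  by rewrite pweight1 /pnorm oner_eq0 size_poly1.
rewrite sqfreeM // => /andP[sE PE]; rewrite pweightM // (pnormM (mirr_monic Pi) Em) natrM.
by apply: ler_pM => //; [rewrite lerDr|apply: IH].
Qed.

Lemma pnorm_gt0 E : E \is monic -> 0 < (pnorm E)%:R :> R.
Proof.
by move=> Em; rewrite pnorm_monic // ltr0n expn_gt0 (ltnW (ltnW (q_gt2 oq))).
Qed.

Lemma density_mul P f : mirr P -> f \is monic -> sqfree f -> ~~ (P %| f) ->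
  density f = density (P * f) * (1 + (pnorm P)%:R^-1).
Proof.
move=> Pi fm sf Pf; have P0 := pnorm_gt0 (mirr_monic Pi).
have w0 := lt_le_trans (pnorm_gt0 fm) (pweight_ge fm sf).
rewrite /density pweightM // (pnormM (mirr_monic Pi) fm) natrM.
have q3 := qR_ge3; field.
by rewrite !gt_eqF //=; lra.
Qed.

Lemma density_le1 E : E \is monic -> sqfree E -> 0 <= density E <= 1.
Proof.
move=> Em sE; have w1 := pweight_ge Em sE; have w0 := lt_le_trans (pnorm_gt0 Em) w1.
have q3 := qR_ge3; have qi : qR^-1 <= 1 by rewrite invf_le1; lra.
have qi0 : 0 <= qR^-1 by rewrite invr_ge0; lra.
rewrite /density -mulrA mulr_ge0 //=; [|by lra|by rewrite divr_ge0 // ltW].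
rewrite mulr_ile1 //; try lra; first by rewrite divr_ge0 // ltW.
by rewrite ler_pdivrMr // mul1r.
Qed.

(** In [square_avg_estimate] deg E + n = N, so all E share the error 2^N. Induct on the primes of E,
    then on n: with d = deg P >= 1 and e = deg f, the recursion gives at most 2^(e+n) + 2^(e+n) <=
    2^(d+e+n). *)
Lemma sqfree_coprime_estimate E n : E \is monic -> sqfree E ->
  `|(sqfree_coprime E n)%:~R - density E * qR ^+ n| <= 2 ^+ ((size E).-1 + n).
Proof.
move=> Em; have q3 := qR_ge3; have q0 : qR != 0 by rewrite gt_eqF; lra.
move: E Em n; apply: monic_ind => [|P f Pi fm IH] n.
  move=> _; rewrite size_poly1 add0n /density pweight1 /pnorm oner_eq0 size_poly1 /= mulr1 divr1.
  have -> : sqfree_coprime 1 n = \sum_(D <- monics F n) (sqfree D)%:R.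
    by rewrite /sqfree_coprime big_mkcond; apply: eq_bigr => D _; rewrite coprime1p; case: sqfree.
  (* Only in degrees 0 and 1 does the count differ from q^n - q^n / q, by 1/q and by 1. *)
  case: n => [|[|n]].
  - rewrite monics0 big_seq1 sqfree1 /= !expr0 mulr1 opprB addrC subrK.
    by rewrite ger0_norm ?invr_ge0 ?invf_le1; lra.
  - have -> : \sum_(D <- monics F 1) (sqfree D)%:R = q%:R :> int.
      rewrite (eq_big_seq (fun=> 1)); first by rewrite big_const_seq count_predT size_monics iter_addr_0.
      move=> D /monicsP[Dm sD]; have -> // : sqfree D.
      apply/sqfree_monicP => // P Pi; apply/negP => /(dvdp_leq (monic_neq0 Dm)).
      by rewrite expr2 size_monicM ?mirr_monic // sD; have := mirr_size Pi; move: (size P) => a; lia.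
    rewrite rmorph_nat !expr1 mulrBl mul1r mulVf // opprB addrC subrK.
    by rewrite normr1; lra.
  rewrite count_sqfree // rmorphB /= !rmorph_nat !natrX mulrBl mul1r -[n.+2]/(n.+1.+1) !exprS mulKf //.
  by rewrite subrr normr0 !mulr_ge0 ?exprn_ge0.
rewrite sqfreeM // => /andP[sf Pf].
have Pm := mirr_monic Pi; have sP := mirr_size Pi; set d := (size P).-1.
have d0 : (0 < d)%N by rewrite /d; case: (size P) sP => // -[].
have Pd : P \in monics F d by apply/monicsP; rewrite prednK // ltnW.
have -> : (size (P * f)).-1 = (d + (size f).-1)%N.
  by rewrite size_monicM // /d; move: sP (monic_size_gt0 fm); case: (size P) => // a _; case: (size f) => // b _; rewrite addSn addnS.
have sPf : sqfree (P * f) by rewrite sqfreeM // sf.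
have := density_mul Pi fm sf Pf; set al := density f; set al' := density (P * f) => alE.
have /andP[al0 al1] : 0 <= al' <= 1 by apply: density_le1; rewrite ?monicMl.
have pP : (pnorm P)%:R = qR ^+ d by rewrite pnorm_monic // natrX.
set e := (size f).-1 in IH *.
elim/ltn_ind: n => n IHn.
have := IH n sf; have := sqfree_coprimeM n Pi fm Pd Pf.
have [dn|nd] := leqP d n => hE.
  have := IHn (n - d)%N; rewrite ltn_subrL d0 (leq_trans d0 dn) => /(_ isT) H2 H1.
  have -> : (sqfree_coprime (P * f) n)%:~R - al' * qR ^+ n =
     ((sqfree_coprime f n)%:~R - al * qR ^+ n) -
     ((sqfree_coprime (P * f) (n - d))%:~R - al' * qR ^+ (n - d)).
    have -> : qR ^+ n = qR ^+ (n - d) * qR ^+ d by rewrite -exprD subnK.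
    have dn0 : qR ^+ d != 0 by rewrite expf_neq0.
    by rewrite hE alE rmorphD /= pP; field.
  apply: le_trans (ler_normB _ _) _; apply: le_trans (lerD H1 H2) _.
  have -> : (d + e + (n - d) = e + n)%N by rewrite (addnC d) -addnA subnKC.
  have -> : (d + e + n = (d.-1 + (e + n)).+1)%N by rewrite -addSn prednK // addnA.
  rewrite exprS mulr_natl mulr2n lerD ?ler_weXn2l ?leq_addl //; lra.
(* For n < d the recursion has no second term. The densities differ by al' / q^d, which times q^n is
   at most 1. *)
move=> H1; rewrite hE addr0 in H1.
have -> : (sqfree_coprime (P * f) n)%:~R - al' * qR ^+ n =
   ((sqfree_coprime (P * f) n)%:~R - al * qR ^+ n) + al' * (qR ^+ d)^-1 * qR ^+ n.
  by rewrite alE pP; ring.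
apply: le_trans (ler_normD _ _) _.
have H2 : `|al' * (qR ^+ d)^-1 * qR ^+ n| <= 1.
  have x0 : 0 <= (qR ^+ d)^-1 * qR ^+ n.
    by rewrite mulr_ge0 ?invr_ge0 ?exprn_ge0.
  rewrite -mulrA ger0_norm; last exact: mulr_ge0.
  rewrite mulr_ile1 //.
  rewrite mulrC ler_pdivrMr ?mul1r ?ler_weXn2l // ?(ltnW nd) //; first by lra.
  by rewrite exprn_gt0 //; lra.
apply: le_trans (lerD H1 H2) _.
have -> : (d + e + n = (d.-1 + (e + n)).+1)%N by rewrite -addSn prednK // addnA.
rewrite exprS mulr_natl mulr2n lerD ?ler_weXn2l ?leq_addl //; try lra.
by rewrite exprn_ege1 //; lra.
Qed.

Definition square_avg N k : int := \sum_(h <- monics F k) chi_avg N (h ^+ 2).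

Lemma chi_avg_sq N h : h \is monic -> chi_avg N (h ^+ 2) = sqfree_coprime h N.
Proof.
move=> hm; apply: eq_bigr => D _; rewrite expr2 chiMl //.
have := chi_cases D hm; have := chi_eq0 oq D hm.
case: (coprimep h D) => /=; last by move=> /eqP ->; rewrite mul0r.
by rewrite !inE => -> /= /orP[] /eqP ->.
Qed.

(** Möbius over the common divisors E of h and D. For square-free E, the product E D' is square-free
    exactly when D' is square-free and prime to E. *)
Lemma square_avgE N k : (k <= N)%N -> square_avg N k =
  \sum_(E <- monics_le F k) pmobius E * (q ^ (k - (size E).-1))%:R * sqfree_coprime E (N - (size E).-1).
Proof.
move=> kN.
transitivity (\sum_(E <- monics_le F k) \sum_(h <- monics F k) \sum_(D <- monics F N | sqfree D)
    pmobius E * ((E %| h)%R%:R * (E %| D)%R%:R)).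
  rewrite exchange_big /=; apply: eq_big_seq => h /monicsP[hm sh].
  rewrite chi_avg_sq // exchange_big /=; apply: eq_bigr => D _.
  rewrite -(@sum_pmobius_coprime _ k) ?sh // big_mkcond.
  by apply: eq_bigr => E _; case: (E %| h); case: (E %| D); rewrite ?mulr1 ?mulr0.
apply: eq_big_seq => E; rewrite mem_monics_le => /andP[Em sE].
have [sqE|nsq] := boolP (sqfree E); last first.
  by rewrite pmobius_nsqfree // !mul0r big1 // => h _; rewrite big1 // => D _; rewrite mul0r.
pose e := (size E).-1; have Ee : E \in monics F e by apply/monicsP; rewrite prednK // monic_size_gt0.
have ek : (e <= k)%N by move: sE; rewrite /e; case: (size E).
have H1 := count_monics_dvd k Ee; rewrite ek in H1.
have H2 : \sum_(D <- monics F N | sqfree D) (E %| D)%R%:R = sqfree_coprime E (N - e) :> int.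
  transitivity (\sum_(D <- monics F N | E %| D) (sqfree D)%:R : int).
    by rewrite big_mkcond [RHS]big_mkcond; apply: eq_bigr => D _; case: sqfree; case: (E %| D).
  rewrite (sum_monics_dvd _ _ Ee) (leq_trans ek kN) /sqfree_coprime [RHS]big_mkcond.
  apply: eq_big_seq => D /monicsP[Dm _]; rewrite sqfree_mul // sqE /=.
  by case: (sqfree D); case: (coprimep E D).
rewrite -H1 -H2 -mulrA mulr_suml mulr_sumr; apply: eq_bigr => h _.
by rewrite mulr_sumr mulr_sumr.
Qed.

(** The coefficients of G: G(s) is the sum of [gcoef e] q^(-e s) over e. *)
Definition gcoef e : R := \sum_(E <- monics F e) (pmobius E)%:~R / pweight R E.

Lemma norm_gcoef_le1 e : `|gcoef e| <= 1.
Proof.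
have q0 := qR_ge3.
apply: le_trans (ler_norm_sum _ _ _) _.
apply: le_trans (_ : \sum_(E <- monics F e) (qR ^+ e)^-1 <= _).
  rewrite big_seq [leRHS]big_seq; apply: ler_sum => E /monicsP[Em sE].
  have [sqE|nsq] := boolP (sqfree E); last first.
    by rewrite pmobius_nsqfree // mul0r normr0 invr_ge0 exprn_ge0.
  have w1 := pweight_ge Em sqE; have w0 := lt_le_trans (pnorm_gt0 Em) w1.
  rewrite normrM normfV [`|pweight R E|]ger0_norm ?(ltW w0) // ler_pdivrMr //.
  have m1 : `|(pmobius E)%:~R| <= 1 :> R by rewrite -intr_norm -[1]/(1%:~R) ler_int pmobius_le1.
  rewrite (le_trans m1) // mulrC ler_pdivlMr ?mul1r ?exprn_gt0 //; last by lra.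
  by rewrite -natrX -[e]/(e.+1.-1) -sE -pnorm_monic.
rewrite big_const_seq count_predT size_monics iter_addr_0 -[leLHS]mulr_natl natrX mulfV //.
by rewrite expf_neq0 // gt_eqF //; lra.
Qed.

Lemma square_avg_estimate N k : (k <= N)%N ->
  `|(square_avg N k)%:~R / qR ^+ k -
    (1 - qR^-1) * qR ^+ N * \sum_(e < k.+1) gcoef e / qR ^+ e| <= k.+1%:R * 2 ^+ N.
Proof.
move=> kN; have q3 := qR_ge3.
have q0 m : 0 < qR ^+ m by rewrite exprn_gt0 //; lra.
have qn m : qR ^+ m != 0 by rewrite gt_eqF.
have -> : (1 - qR^-1) * qR ^+ N * \sum_(e < k.+1) gcoef e / qR ^+ e =
   \sum_(E <- monics_le F k) (pmobius E)%:~R / qR ^+ (size E).-1 *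
      (density E * qR ^+ (N - (size E).-1)).
  rewrite (sum_monics_le k xpredT) mulr_sumr; apply: eq_bigr => -[e ek] _ /=.
  rewrite /gcoef mulr_suml mulr_sumr; apply: eq_big_seq => E /monicsP[Em sE].
  rewrite sE /= /density pnorm_monic // sE /= natrX.
  have -> : qR ^+ N = qR ^+ (N - e) * qR ^+ e by rewrite -exprD subnK // (leq_trans _ kN).
  set w := (pweight R E)^-1; have := qn e; set x := qR ^+ e => x0.
  by field; rewrite x0 /=; rewrite gt_eqF //; lra.
have -> : (square_avg N k)%:~R / qR ^+ k = \sum_(E <- monics_le F k)
    (pmobius E)%:~R / qR ^+ (size E).-1 * (sqfree_coprime E (N - (size E).-1))%:~R.
  rewrite square_avgE // rmorph_sum /= mulr_suml; apply: eq_big_seq => E.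
  rewrite mem_monics_le => /andP[Em sE].
  have ek : ((size E).-1 <= k)%N by move: sE; case: (size E).
  rewrite !rmorphM /= rmorph_nat natrX -{2}(subnK ek) exprD.
  set a := (sqfree_coprime _ _)%:~R; set x := qR ^+ _; set y := qR ^+ _.
  by field; rewrite !qn.
rewrite -sumrB; apply: le_trans (ler_norm_sum _ _ _) _.
apply: le_trans (_ : \sum_(E <- monics_le F k) 2 ^+ N / qR ^+ (size E).-1 <= _).
  rewrite big_seq [leRHS]big_seq; apply: ler_sum => E; rewrite mem_monics_le => /andP[Em sE].
  have [sqE|nsq] := boolP (sqfree E); last first.
    by rewrite pmobius_nsqfree // !mul0r subrr normr0 divr_ge0 ?exprn_ge0 // ltW.
  rewrite -mulrBr normrM normrM normfV [`|qR ^+ _|]ger0_norm ?(ltW (q0 _)) // mulrAC.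
  rewrite ler_wpM2r ?invr_ge0 ?(ltW (q0 _)) //.
  have m1 : `|(pmobius E)%:~R| <= 1 :> R by rewrite -intr_norm -[1]/(1%:~R) ler_int pmobius_le1.
  have ek : ((size E).-1 <= N)%N by apply: leq_trans kN; move: sE; case: (size E).
  have := sqfree_coprime_estimate (N - (size E).-1) Em sqE; rewrite subnKC // => H.
  by rewrite -[leRHS]mul1r ler_pM.
rewrite (sum_monics_le k xpredT).
(* Degree e has q^e polynomials E, each with error 2^N / q^e, so it contributes 2^N. *)
rewrite (eq_bigr (fun=> 2 ^+ N)); first by rewrite sumr_const card_ord mulr_natl.
move=> e _; rewrite (eq_big_seq (fun=> 2 ^+ N / qR ^+ e)); last by move=> E /monicsP[_ ->].
rewrite big_const_seq count_predT size_monics iter_addr_0 -[LHS]mulr_natl natrX mulrCA mulfV ?mulr1 //.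
Qed.

(** r is q^(1/4), so that all half and quarter powers of q are natural powers of r. *)
Variable r : R.
Hypotheses (r_gt0 : 0 < r) (r4 : r ^+ 4 = qR).

Lemma r_ge1 : 1 <= r.
Proof.
have := qR_ge3; rewrite -r4 => r43; rewrite leNgt; apply/negP => r1.
have : r ^+ 4 < 1 by rewrite exprn_ilt1 // ltW.
by lra.
Qed.

(** (r^3)^4 = q^3 >= 27 > 2^4. *)
Lemma r3_ge2 : 2 <= r ^+ 3.
Proof.
rewrite leNgt; apply/negP => r1.
have : (r ^+ 3) ^+ 4 < 2 ^+ 4 by rewrite ltrXn2r ?nnegrE ?exprn_ge0 // ltW.
rewrite -exprM mulnC exprM r4 => H.
have := qR_ge3 => H3.
have : 3 ^+ 3 <= qR ^+ 3 by rewrite lerXn2r ?nnegrE //; lra.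
by move: H; rewrite !exprS !expr0; lra.
Qed.

Lemma char_sum_boundR f b : f \is monic -> ~~ square f ->
  `|char_sum f b|%:~R <= r ^+ (2 * (size f).-1) :> R.
Proof.
move=> fm nsq; rewrite -(@ler_pXn2r _ 2) ?nnegrE ?exprn_ge0 ?(ltW r_gt0) ?ler0z //.
rewrite -exprM -rmorphXn /= -normrX ger0_norm ?sqr_ge0 //.
rewrite -mulnA (mulnC _ 2%N) mulnA exprM r4 -natrX -[leRHS](rmorph_nat (intmul (1:R))) ler_int.
exact: char_sum_bound.
Qed.

(** The bounds q^(a + n/2) and q^(N - a) for a sieve term of degree a cross near a = g - n/4, hence
    m = n / 4. Both ranges are then geometric sums of size about q^(g + n/4) = r^(4g + n); rounding
    costs q^2, and 3 = 1 + 2 adds the two ranges. *)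
Lemma chi_avg_nonsquare g n f : f \in monics F n -> (n <= g)%N -> ~~ square f ->
  `|chi_avg (2 * g).+1 f|%:~R <= 3 * qR ^+ 2 * r ^+ (4 * g + n).
Proof.
move=> /monicsP[fm sf] ng nsq; set N := (2 * g).+1.
pose m := (n %/ 4)%N; have mg : (m <= g)%N by rewrite (leq_trans _ ng) // leq_div.
have q0 : 0 <= qR by have := qR_ge3; lra.
pose u a : R := if (a <= g - m)%N then qR ^+ a * r ^+ (2 * n)
                else if (a <= g)%N then qR ^+ (N - a) else 0.
apply: (@le_trans _ _ (\sum_(0 <= a < N.+1) u a)).
  rewrite big_mkord; apply: (@le_trans _ _ (\sum_(a < N.+1) (if (a * 2 <= N)%N
      then (q ^ a)%:R * `|char_sum f (N - a * 2)| else 0)%:~R)).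
    by rewrite -rmorph_sum /= ler_int chi_avg_le.
  apply: ler_sum => -[a aN] _ /=; rewrite /u.
  have -> : (a * 2 <= N)%N = (a <= g)%N by rewrite /N; lia.
  case: (leqP a g) => ag; last by rewrite ifN // -ltnNge; lia.
  rewrite rmorphM /= rmorph_nat natrX; case: ifP => am.
    by rewrite ler_wpM2l ?exprn_ge0 // -[n]/(n.+1.-1) -sf char_sum_boundR.
  have -> : (N - a = a + (N - a * 2))%N by rewrite /N; lia.
  rewrite exprD ler_wpM2l ?exprn_ge0 // -natrX -(rmorph_nat (intmul (1:R))) ler_int.
  exact: char_sum_trivial.
have H1 : \sum_(0 <= a < (g - m).+1) u a <= qR ^+ (g - m).+1 * r ^+ (2 * n).
  rewrite (eq_big_nat _ _ (F2 := fun a => qR ^+ a * r ^+ (2 * n))); last first.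
    by move=> a /andP[_ am]; rewrite /u -ltnS am.
  apply: geometric_up => a; first by rewrite mulr_ge0 ?exprn_ge0 ?(ltW r_gt0).
  rewrite mulrA ler_wpM2r ?exprn_ge0 ?(ltW r_gt0) // exprS ler_wpM2r ?exprn_ge0 //.
  by have := qR_ge3; lra.
have H2 : \sum_((g - m).+1 <= a < g.+1) u a <= 2 * qR ^+ (N - (g - m).+1).
  rewrite (eq_big_nat _ _ (F2 := fun a => qR ^+ (N - a))); last first.
    by move=> a /andP[am ag]; rewrite /u leqNgt am /= -ltnS ag.
  apply: geometric_down => a; first exact: exprn_ge0.
  move=> _ ag; have -> : (N - a = (N - a.+1).+1)%N by rewrite /N; lia.
  by rewrite exprS ler_wpM2r ?exprn_ge0 //; have := qR_ge3; lra.
have H3 : \sum_(g.+1 <= a < N.+1) u a = 0.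
  rewrite big_nat big1 // => a /andP[ag _]; rewrite /u !ifN // -ltnNge //; lia.
rewrite (big_cat_nat (n := g.+1)) //=; last by rewrite /N; lia.
rewrite H3 addr0 (big_cat_nat (n := (g - m).+1)) //=; last by lia.
apply: le_trans (lerD H1 H2) _.
have -> : (N - (g - m).+1 = g + m)%N by rewrite /N; lia.
have m1 : (m * 4 <= n)%N by rewrite leq_divM.
have m2 : (n < m.+1 * 4)%N by rewrite ltn_ceil.
rewrite -r4 -!exprM -exprD mulrAC -!mulrA -exprD.
have e1 : r ^+ (4 * (g - m).+1 + 2 * n) <= r ^+ (4 * g + n + 4 * 2).
  by apply: ler_weXn2l; [exact: r_ge1|lia].
have e2 : r ^+ (4 * (g + m)) <= r ^+ (4 * g + n + 4 * 2).
  by apply: ler_weXn2l; [exact: r_ge1|lia].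
by lra.
Qed.

End Averages.

(** * The first moment at 1/2, over the reals *)

Section WeightedSums.
Variable R : realType.

Lemma bernoulli (y : R) n : 0 <= y -> n%:R * y <= (1 + y) ^+ n.
Proof.
move=> y0; suff : 1 + n%:R * y <= (1 + y) ^+ n by lra.
elim: n => [|n IH]; first by rewrite mul0r addr0 expr0.
rewrite exprS -natr1; have n0 : 0 <= n%:R * y by rewrite mulr_ge0.
apply: (@le_trans _ _ ((1 + y) * (1 + n%:R * y))); last by rewrite ler_wpM2l //; lra.
by nra.
Qed.

(** Each induction step spends a factor sqrt(y)^n on one power of n. *)
Lemma exprn_le_exp (y : R) a : 1 < y -> exists2 C : R, 0 <= C & forall n, n%:R ^+ a <= C * y ^+ n.
Proof.
elim: a y => [|a IH] y y1; first by exists 1 => // n; rewrite expr0 mul1r exprn_ege1 // ltW.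
pose s := Num.sqrt y; have s1 : 1 < s by rewrite -(@sqrtr1 R) ltr_sqrt //; lra.
have ss : s * s = y by rewrite -expr2 sqr_sqrtr //; lra.
have [C C0 CE] := IH s s1; exists (C / (s - 1)); first by rewrite divr_ge0 //; lra.
move=> n; have := @bernoulli (s - 1) n; have -> : 1 + (s - 1) = s by ring.
move=> H.
have Hn : n%:R <= s ^+ n / (s - 1) by rewrite ler_pdivlMr ?H //; lra.
rewrite exprSr -ss exprMn; apply: (@le_trans _ _ (C * s ^+ n * (s ^+ n / (s - 1)))).
  by rewrite ler_pM ?exprn_ge0.
by rewrite le_eqVlt; apply/orP; left; apply/eqP; ring.
Qed.

Section Tail.
Variables (u : nat -> R) (M x : R).
Hypotheses (M0 : 0 <= M) (x0 : 0 <= x) (x2 : 2 * x <= 1).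

Lemma dominated_series_cvg : (forall j, `|u j| <= M * x ^+ j) -> cvgn (series u).
Proof.
move=> uM; apply: normed_cvg; apply: (@series_le_cvg _ _ (geometric M x)) => //.
- by move=> n /=.
- by move=> n /=; rewrite mulr_ge0 // exprn_ge0.
- have x1 : x < 1.
    have [->|xn0] := eqVneq x 0; first exact: ltr01.
    by apply: lt_le_trans x2; rewrite mulr_natl mulr2n ltrDl lt_neqAle eq_sym xn0.
  by apply: is_cvg_geometric_series; rewrite ger0_norm.
Qed.

Lemma series_tail_le K : cvgn (series u) -> (forall j, (K <= j)%N -> `|u j| <= M * x ^+ j) ->
  `|limn (series u) - series u K| <= 2 * M * x ^+ K.
Proof.
move=> cu uM; have H n : (K <= n)%N -> `|series u n - series u K| <= 2 * M * x ^+ K.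
  move=> Kn; rewrite /series /= (big_cat_nat (n := K)) //= addrAC subrr add0r.
  apply: le_trans (ler_norm_sum _ _ _) _.
  apply: (@le_trans _ _ (\sum_(K <= j < n) M * x ^+ j)).
    by rewrite big_nat [leRHS]big_nat; apply: ler_sum => j /andP[Kj _]; exact: uM.
  rewrite -mulrA; apply: geometric_down => [a|a Ka an].
    by rewrite mulr_ge0 ?exprn_ge0.
  have -> : 2 * (M * x ^+ a.+1) = M * x ^+ a * (2 * x) by rewrite exprS; ring.
  by rewrite -[leRHS]mulr1 ler_wpM2l // mulr_ge0 // exprn_ge0.
have cn : (fun n => `|series u n - series u K|) @ \oo --> `|limn (series u) - series u K|.
  by apply: cvg_norm; apply: cvgB => //; apply: cvg_cst.
rewrite -(cvg_lim _ cn) //; apply: limr_le; first by apply/cvg_ex; eexists; exact: cn.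
by exists K => // n /= Kn; exact: H.
Qed.

End Tail.

Lemma powersum_coefR k n : (powersum k n)%:R =
  \sum_(1 <= m < k.+2) ratr (powersum_coef k m) * n%:R ^+ m :> R.
Proof.
have := congr1 (ratr : rat -> R) (powersum_coefE k n); rewrite ratr_nat => ->.
rewrite rmorph_sum /=; apply: eq_bigr => m _.
by rewrite rmorphM rmorphXn /= ratr_nat.
Qed.

Lemma powersumS k n : powersum k n.+1 = (powersum k n + n.+1 ^ k)%N.
Proof. by rewrite /powersum big_nat_recr. Qed.

Lemma powersum_mono k m n : (m <= n)%N -> (powersum k m <= powersum k n)%N.
Proof.
move=> mn; rewrite -(subnKC mn); elim: (n - m)%N => [|d IH]; first by rewrite addn0.
by rewrite addnS powersumS (leq_trans IH) // leq_addr.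
Qed.

Lemma powersum_le k n : (powersum k n <= n ^ k.+1)%N.
Proof.
rewrite /powersum big_nat (leq_trans (n := \sum_(1 <= l < n.+1) n ^ k)) //.
  rewrite [leqRHS]big_nat; apply: leq_sum => l /andP[_ ln].
  by case: k => // k; rewrite leq_exp2r.
by rewrite sum_nat_const_nat subn1 expnS.
Qed.

(** Summation by parts; the bracket is the sum of k^m over j <= k <= K. In the form J_m(K) + j^m -
    J_m(j) it also covers j = 0, and its three terms become the three kinds of terms in the
    theorem. *)
Lemma sum_partial_sums (a : nat -> R) m K :
  \sum_(k < K.+1) k%:R ^+ m * \sum_(e < k.+1) a e =
  \sum_(j < K.+1) a j * ((powersum m K)%:R + j%:R ^+ m - (powersum m j)%:R).
Proof.
elim: K => [|K IH]; first by rewrite !big_ord_recl !big_ord0 /=; ring.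
rewrite big_ord_recr IH [RHS]big_ord_recr /=.
rewrite [X in _ * X]big_ord_recr /= mulrDr addrA; congr (_ + _); last by ring.
rewrite mulr_sumr -big_split /=; apply: eq_bigr => j _.
by rewrite powersumS natrD natrX; ring.
Qed.

Lemma sum_even n (G : nat -> R) :
  \sum_(i < n.+1) (if odd i then 0 else G i./2) = \sum_(k < (n./2).+1) G k.
Proof.
elim: n => [|n IH]; first by rewrite !big_ord_recl !big_ord0.
rewrite big_ord_recr IH /= uphalf_half.
by case: (odd n) => /=; rewrite ?addr0 // add1n [RHS]big_ord_recr.
Qed.

End WeightedSums.

(** * Folding at n = g; square and nonsquare contributions *)

Section FirstMoment.
Variables (R : realType) (F : finFieldType).
Hypothesis oq : odd #|F|.
Local Notation q := #|F|.
Local Notation qR := (#|F|%:R : R).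
Variable r : R.
Hypotheses (r_gt0 : 0 < r) (r4 : r ^+ 4 = qR).
(** The terms of G and its derivatives at 1 are at most j^m q^(-j); a constant times r^j absorbs j^m
    and leaves the ratio r / q = r^(-3). *)
Let x : R := (r ^+ 3)^-1.

Lemma r_gt1 : 1 < r.
Proof.
rewrite lt_neqAle (r_ge1 oq r_gt0 r4) andbT; apply/eqP => e.
by have := @qR_ge3 R F oq; rewrite -r4 -e expr1n; lra.
Qed.

Let x_ge0 : 0 <= x. Proof. by rewrite invr_ge0 exprn_ge0 // ltW. Qed.

Let x_le2 : 2 * x <= 1.
Proof.
have r3 := r3_ge2 oq r_gt0 r4; rewrite /x -ler_pdivlMr ?invr_gt0 ?exprn_gt0 //.
by rewrite mul1r invrK.
Qed.

Definition gterm m j : R := gcoef R F j * j%:R ^+ m / qR ^+ j.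

(** Identified with G^(m)(1) / (-ln q)^m in [derive1n_Gseries]. *)
Definition gmoment m : R := limn (series (gterm m)).

Lemma gterm_bound m : exists2 C : R, 0 <= C & forall j (w : R), `|w| <= j%:R ^+ m ->
  `|gcoef R F j * w / qR ^+ j| <= C * x ^+ j.
Proof.
have [C C0 CE] := exprn_le_exp m r_gt1; exists C => // j w wj.
rewrite normrM normfV normrX [`|qR|]ger0_norm // ler_pdivrMr; last first.
  by rewrite exprn_gt0 // -r4 exprn_gt0.
have -> : C * x ^+ j * qR ^+ j = C * r ^+ j.
  have xq : x * qR = r.
    by rewrite /x -r4 (exprS r 3) mulrCA mulVf ?mulr1 // expf_neq0 // gt_eqF.
  by rewrite -mulrA -exprMn xq.
rewrite normrM; apply: le_trans (CE j); rewrite -[leRHS]mul1r ler_pM //.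
exact: norm_gcoef_le1.
Qed.

Lemma cvg_gmoment m : cvgn (series (gterm m)).
Proof.
have [C C0 CE] := gterm_bound m; apply: (dominated_series_cvg C0 x_ge0 x_le2) => j.
by apply: CE; rewrite ger0_norm // exprn_ge0.
Qed.

(** The sum by parts continued over all j, with J_m(j) expanded in powers of j. *)
Definition main_value m K : R := gmoment 0 * (powersum m K)%:R + gmoment m
  - \sum_(1 <= n < m.+2) ratr (powersum_coef m n) * gmoment n.

Definition main_term m K j : R :=
  gcoef R F j * ((powersum m K)%:R + j%:R ^+ m - (powersum m j)%:R) / qR ^+ j.

Lemma main_value_cvg m K : series (main_term m K) @ \oo --> main_value m K.
Proof.
have -> : series (main_term m K) = (fun n => series (gterm 0) n * (powersum m K)%:R + series (gterm m) n
   - \sum_(1 <= i < m.+2) ratr (powersum_coef m i) * series (gterm i) n).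
  apply/funext => n; rewrite /series /= mulr_suml -big_split /=.
  under [X in _ = _ - X]eq_bigr => i _ do rewrite mulr_sumr.
  rewrite exchange_big /= -sumrB; apply: eq_bigr => j _.
  rewrite /main_term /gterm (powersum_coefR R m j) expr0 mulr1.
  rewrite [X in _ = _ - X](_ : _ = gcoef R F j * (\sum_(1 <= i < m.+2) ratr (powersum_coef m i) * j%:R ^+ i) / qR ^+ j); last first.
    rewrite mulr_sumr mulr_suml; apply: eq_bigr => i _; ring.
  ring.
apply: cvgB.
  apply: cvgD; last exact: cvg_gmoment.
  by apply: cvgM; [exact: cvg_gmoment|exact: cvg_cst].
elim: (index_iota 1 m.+2) => [|i s IH].
  by under eq_fun do rewrite big_nil; rewrite big_nil; exact: cvg_cst.
under eq_fun do rewrite big_cons; rewrite big_cons.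
by apply: cvgD => //; apply: cvgM; [exact: cvg_cst|exact: cvg_gmoment].
Qed.

(** For j > K the bracket is J_m(K) - J_m(j - 1), at most j^(m+1) in absolute value; hence the bound
    is taken at [m.+1]. *)
Lemma main_value_estimate m : exists2 C : R, 0 <= C & forall K,
  `|\sum_(k < K.+1) k%:R ^+ m * \sum_(e < k.+1) gcoef R F e / qR ^+ e - main_value m K| <=
  C * x ^+ K.+1.
Proof.
have [C C0 CE] := gterm_bound m.+1; exists (2 * C); first by rewrite mulr_ge0.
move=> K; rewrite (sum_partial_sums (fun e => gcoef R F e / qR ^+ e) m K) distrC.
have cm := @main_value_cvg m K; rewrite -(cvg_lim _ cm) //.
have -> : \sum_(j < K.+1) gcoef R F j / qR ^+ j * ((powersum m K)%:R + j%:R ^+ m - (powersum m j)%:R) =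
    series (main_term m K) K.+1.
  by rewrite /series /= big_mkord; apply: eq_bigr => j _; rewrite /main_term; ring.
apply: series_tail_le => //; first by apply/cvg_ex; eexists; exact: cm.
case=> // j Kj; apply: CE; rewrite powersumS natrD -natrX opprD addrACA subrr addr0 distrC.
rewrite ger0_norm ?subr_ge0 ?ler_nat ?powersum_mono // -natrX.
rewrite lerBlDr -natrD ler_nat (leq_trans (powersum_le _ _)) // (leq_trans _ (leq_addr _ _)) //.
by rewrite leq_exp2r.
Qed.

(** (r^7)^4 = q^7 >= 3^7 > 4^4. This fits the counting error 2^(2g+1) inside r^(7g). *)
Lemma four_lt_r7 : 4 < r ^+ 7.
Proof.
rewrite ltNge; apply/negP => r7.
have : (r ^+ 7) ^+ 4 <= 4 ^+ 4 by rewrite lerXn2r ?nnegrE ?exprn_ge0 // ltW.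
rewrite -exprM mulnC exprM r4 => H; have q3 := @qR_ge3 R F oq.
have : 3 ^+ 7 <= qR ^+ 7 by rewrite lerXn2r ?nnegrE //; lra.
by move: H; rewrite !exprS !expr0; lra.
Qed.

Definition square_sum g m K : R :=
  \sum_(k < K.+1) k%:R ^+ m * ((square_avg F (2 * g).+1 k)%:~R / qR ^+ k).

(** The two inequalities hold for K = [g/2] and K = [(g-1)/2] alike. The tail of G costs q^(2g+1)
    x^(K+1), which is at most q r^(7g) because 3(K+1) >= g. *)
Lemma square_sum_estimate m : exists2 C : R, 0 <= C & forall g K, (0 < g)%N ->
  (2 * K <= g)%N -> (g <= 2 * K.+1)%N ->
  `|square_sum g m K - (1 - qR^-1) * qR ^+ (2 * g).+1 * main_value m K| <= C * g%:R ^+ m * r ^+ (7 * g).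
Proof.
have q3 := @qR_ge3 R F oq.
(* The counting error contains g^2 4^g: the number of terms and the factor [k.+1] are both O(g). The
   gap between 4 and r^7 absorbs g^2. *)
have y1 : 1 < r ^+ 7 / 4 by rewrite ltr_pdivlMr // mul1r four_lt_r7.
have [C1 C10 C1E] := exprn_le_exp 2 y1; have [C2 C20 C2E] := main_value_estimate m.
exists (8 * C1 + qR * C2); first by rewrite addr_ge0 ?mulr_ge0 //; lra.
move=> g K g0 Kg gK; set B := (1 - qR^-1) * qR ^+ (2 * g).+1.
have g1 : 1 <= g%:R ^+ m :> R by rewrite exprn_ege1 // ler1n.
have G0 : 0 <= g%:R ^+ m :> R by lra.
pose cs k := \sum_(e < k.+1) gcoef R F e / qR ^+ e.
have H1 : `|square_sum g m K - B * \sum_(k < K.+1) k%:R ^+ m * cs k| <= 8 * C1 * g%:R ^+ m * r ^+ (7 * g).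
  rewrite mulr_sumr -sumrB; apply: le_trans (ler_norm_sum _ _ _) _.
  apply: (@le_trans _ _ (\sum_(k < K.+1) g%:R ^+ m * (g%:R * 2 ^+ (2 * g).+1 * 2))).
    apply: ler_sum => -[k kK] _ /=; have kg : (k <= g)%N by clear -kK Kg; lia.
    set T := _ / _; have -> : k%:R ^+ m * T - B * (k%:R ^+ m * cs k) = k%:R ^+ m * (T - B * cs k) by ring.
    rewrite normrM ger0_norm ?exprn_ge0 //.
    rewrite ler_pM ?exprn_ge0 // ?lerXn2r ?nnegrE ?ler_nat //.
    apply: le_trans (square_avg_estimate R oq _) _; first by clear -kg; lia.
    rewrite mulrAC ler_wpM2r ?exprn_ge0 // -natrM ler_nat; clear -kg g0; lia.
  rewrite sumr_const card_ord -[leLHS]mulr_natl.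
  have e4 : 2 ^+ (2 * g).+1 = 2 * 4 ^+ g :> R.
    by rewrite exprS exprM; congr (_ * _ ^+ _); rewrite expr2; lra.
  have H4 : g%:R ^+ 2 * 4 ^+ g <= C1 * r ^+ (7 * g).
    have := C1E g; rewrite exprMn exprVn -exprM mulrA ler_pdivlMr ?exprn_gt0 //.
  have KG : K.+1%:R <= 2 * g%:R :> R by rewrite -natrM ler_nat; clear -Kg g0; lia.
  rewrite e4; apply: (@le_trans _ _ (g%:R ^+ m * (8 * (g%:R ^+ 2 * 4 ^+ g)))).
    rewrite mulrCA ler_wpM2l //; have p4 : 0 <= g%:R * (2 * 4 ^+ g) * 2 :> R by rewrite !mulr_ge0 ?exprn_ge0.
    apply: le_trans (ler_wpM2r p4 KG) _; rewrite le_eqVlt; apply/orP; left; apply/eqP; ring.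
  have -> : g%:R ^+ m * (8 * (g%:R ^+ 2 * 4 ^+ g)) = 8 * (g%:R ^+ m * (g%:R ^+ 2 * 4 ^+ g)) :> R by ring.
  have -> : 8 * C1 * g%:R ^+ m * r ^+ (7 * g) = 8 * (g%:R ^+ m * (C1 * r ^+ (7 * g))) by ring.
  by rewrite !ler_wpM2l.
have H2 : `|B * \sum_(k < K.+1) k%:R ^+ m * cs k - B * main_value m K| <= qR * C2 * r ^+ (7 * g).
  rewrite -mulrBr normrM; have qi : 0 <= qR^-1 <= 1 by rewrite invr_ge0 invf_le1; lra.
  have B0 : 0 <= B by rewrite mulr_ge0 ?exprn_ge0 //; lra.
  have B1 : B <= qR ^+ (2 * g).+1.
    by rewrite -[leRHS]mul1r ler_wpM2r ?exprn_ge0 //; lra.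
  rewrite ger0_norm //; apply: (@le_trans _ _ (qR ^+ (2 * g).+1 * (C2 * x ^+ K.+1))).
    by rewrite ler_pM.
  have xr : x ^+ K.+1 * r ^+ g <= 1.
    rewrite /x exprVn -exprM mulrC ler_pdivrMr ?exprn_gt0 // mul1r.
    by apply: ler_weXn2l; [exact: ltW r_gt1|clear -gK; lia].
  rewrite exprS -!mulrA ler_wpM2l //.
  rewrite mulrCA ler_wpM2l // -r4 -exprM.
  have -> : (4 * (2 * g) = 7 * g + g)%N by clear; lia.
  rewrite exprD -mulrA -[leRHS]mulr1 ler_wpM2l ?exprn_ge0 ?(ltW r_gt0) //.
  by rewrite mulrC.
rewrite -(subrKA (B * \sum_(k < K.+1) k%:R ^+ m * cs k)).
apply: le_trans (ler_normD _ _) _; apply: le_trans (lerD H1 H2) _.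
have -> : (8 * C1 + qR * C2) * g%:R ^+ m * r ^+ (7 * g) =
  8 * C1 * g%:R ^+ m * r ^+ (7 * g) + qR * C2 * (g%:R ^+ m * r ^+ (7 * g)) by ring.
rewrite lerD2l ler_wpM2l ?mulr_ge0 //.
by rewrite -[leLHS]mul1r ler_wpM2r ?exprn_ge0 // ltW.
Qed.

Definition L_avg N n : int := \sum_(D <- monics F N | sqfree D) L_coef D n.

Definition nonsquare_avg N n : int := \sum_(f <- monics F n | ~~ square f) chi_avg N f.

Lemma L_avg_split N n :
  L_avg N n = (if odd n then 0 else square_avg F N n./2) + nonsquare_avg N n.
Proof.
rewrite /L_avg /L_coef exchange_big /= (bigID (@square F)) /=; congr (_ + _).
rewrite big_mkcond (sum_squares oq) => [|B _ /negbTE -> //].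
case: ifP => // _; apply: eq_big_seq => h /monicsP[hm _].
by rewrite ifT //; apply/asboolP; exists h.
Qed.

Lemma L_avg_functional_equation g n : (0 < g)%N -> (n <= g)%N ->
  L_avg (2 * g).+1 (2 * g - n) = (q ^ (g - n))%:R * L_avg (2 * g).+1 n.
Proof.
move=> g0 ng; rewrite /L_avg mulr_sumr big_seq_cond [RHS]big_seq_cond.
apply: eq_bigr => D /andP[DN sD]; exact: (L_coef_functional_equation oq).
Qed.

(** The left side of the theorem as a real number: each derivative of q^(-ns) in s brings a factor
    -n ln q, and r^(2n) = q^(n/2). *)
Definition first_moment mu g : R :=
  \sum_(n < (2 * g).+1) (L_avg (2 * g).+1 n)%:~R * (- n%:R) ^+ mu / r ^+ (2 * n).

(* the approximate functional equation: the terms of degree 2g - n are folded onto those of degree n *)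
Lemma first_moment_fold mu g : (0 < g)%N -> first_moment mu g =
  \sum_(n < g.+1) (L_avg (2 * g).+1 n)%:~R / r ^+ (2 * n) * (- n%:R) ^+ mu +
  \sum_(n < g) (L_avg (2 * g).+1 n)%:~R / r ^+ (2 * n) * (n%:R - (2 * g)%:R) ^+ mu.
Proof.
move=> g0; rewrite /first_moment -(big_mkord xpredT (fun n => (L_avg (2 * g).+1 n)%:~R * (- n%:R) ^+ mu / r ^+ (2 * n))).
(* The middle term n = g stays in the first range, so the folded range stops at g - 1; this is the
   source of [(g-1)/2]. *)
rewrite (big_cat_nat (n := g.+1)) //=; last by rewrite ltnS mul2n -addnn leq_addr.
congr (_ + _); first by rewrite big_mkord; apply: eq_bigr => n _; rewrite mulrAC.
rewrite big_nat_rev /= -[X in (\sum_(X <= _ < _) _)%R]add0n big_addn big_mkord.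
have -> : ((2 * g).+1 - g.+1 = g)%N by rewrite subSS mul2n -addnn addnK.
apply: eq_bigr => -[n ng] _ /=.
have -> : (g.+1 + (2 * g).+1 - (n + g.+1).+1 = 2 * g - n)%N by clear -ng; lia.
rewrite L_avg_functional_equation //; last exact: ltnW.
have n2g : (n <= 2 * g)%N by clear -ng; lia.
rewrite rmorphM /= rmorph_nat natrX natrB // opprB -r4 -exprM.
have -> : (2 * (2 * g - n) = 4 * (g - n) + 2 * n)%N by clear -ng; lia.
have r0 k : r ^+ k != 0 by rewrite expf_neq0 // gt_eqF.
rewrite exprD; set a := (L_avg _ _)%:~R; set b := (_ - _) ^+ mu.
by field; rewrite !r0.
Qed.

Lemma nonsquare_avg_bound g n : (n <= g)%N ->
  `|(nonsquare_avg (2 * g).+1 n)%:~R / r ^+ (2 * n)| <= 3 * qR ^+ 2 * r ^+ (4 * g) * (r ^+ 3) ^+ n.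
Proof.
move=> ng; have r0 k : 0 < r ^+ k by rewrite exprn_gt0.
rewrite normrM normfV [`|r ^+ _|]ger0_norm ?(ltW (r0 _)) // ler_pdivrMr //.
rewrite /nonsquare_avg rmorph_sum /=; apply: le_trans (ler_norm_sum _ _ _) _.
apply: (@le_trans _ _ (\sum_(f <- monics F n) 3 * qR ^+ 2 * r ^+ (4 * g + n))).
  rewrite big_mkcond big_seq [leRHS]big_seq; apply: ler_sum => f fn; case: ifP => nsq.
    by rewrite -intr_norm; apply: (chi_avg_nonsquare oq r_gt0 r4).
  by rewrite mulr_ge0 ?mulr_ge0 ?exprn_ge0 // ltW.
rewrite big_const_seq count_predT size_monics iter_addr_0 -[leLHS]mulr_natl natrX -r4.
rewrite -!exprM le_eqVlt; apply/orP; left; apply/eqP.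
rewrite [RHS](_ : _ = 3 * r ^+ (4 * 2) * (r ^+ (4 * g) * r ^+ (3 * n) * r ^+ (2 * n))); last by ring.
have -> : r ^+ (4 * n) * (3 * r ^+ (4 * 2) * r ^+ (4 * g + n)) = 3 * r ^+ (4 * 2) * (r ^+ (4 * n) * r ^+ (4 * g + n)) by ring.
by rewrite -!exprD; congr (_ * _ ^+ _); clear; lia.
Qed.

(** Degree n contributes about r^(4g + 3n); the sum is geometric with ratio r^3 >= 2 and ends at n
    <= g, which gives r^(7g). *)
Lemma nonsquare_sum_bound mu g k (w : nat -> R) : (k <= g.+1)%N ->
  (forall n, (n < k)%N -> `|w n| <= (2 * g).+1%:R ^+ mu) ->
  `|\sum_(n < k) (nonsquare_avg (2 * g).+1 n)%:~R / r ^+ (2 * n) * w n| <=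
  3 * qR ^+ 2 * r ^+ 3 * (2 * g).+1%:R ^+ mu * r ^+ (7 * g).
Proof.
move=> kg wn; have r0 n : 0 <= r ^+ n by rewrite exprn_ge0 // ltW.
apply: le_trans (ler_norm_sum _ _ _) _.
set c := 3 * qR ^+ 2; set G := (2 * g).+1%:R ^+ mu.
have c0 : 0 <= c by rewrite mulr_ge0 ?exprn_ge0.
have G0 : 0 <= G by rewrite exprn_ge0.
apply: (@le_trans _ _ (\sum_(n < k) c * r ^+ (4 * g) * G * (r ^+ 3) ^+ n)).
  apply: ler_sum => -[n nk] _ /=; rewrite normrM mulrAC.
  by apply: ler_pM => //; [apply: nonsquare_avg_bound; clear -nk kg; lia|exact: wn].
rewrite -mulr_sumr -(big_mkord xpredT (fun n => (r ^+ 3) ^+ n)).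
have H : \sum_(0 <= n < k) (r ^+ 3) ^+ n <= (r ^+ 3) ^+ k.
  apply: geometric_up => a; first by rewrite -exprM.
  by rewrite (exprS (r ^+ 3) a) ler_wpM2r ?(r3_ge2 oq r_gt0 r4) // -exprM.
have H' : (r ^+ 3) ^+ k <= r ^+ 3 * r ^+ (3 * g).
  by rewrite -exprM -exprD; apply: ler_weXn2l; [exact: ltW r_gt1|clear -kg; lia].
have cG : 0 <= c * r ^+ (4 * g) * G by rewrite !mulr_ge0.
apply: le_trans (ler_wpM2l cG (le_trans H H')) _.
have -> : (7 * g = 4 * g + 3 * g)%N by clear; lia.
by rewrite exprD le_eqVlt; apply/orP; left; apply/eqP; ring.
Qed.

Lemma square_part g k (w : nat -> R) :
  \sum_(n < k.+1) (if odd n then 0 else (square_avg F (2 * g).+1 n./2)%:~R) / r ^+ (2 * n) * w n =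
  \sum_(i < k./2.+1) (square_avg F (2 * g).+1 i)%:~R / qR ^+ i * w (2 * i)%N.
Proof.
rewrite -(sum_even k (fun i => (square_avg F (2 * g).+1 i)%:~R / qR ^+ i * w (2 * i)%N)).
apply: eq_bigr => -[n nk] _ /=; case: ifPn => on; first by rewrite !mul0r.
have e : (2 * n./2 = n)%N by rewrite mul2n even_halfK.
by rewrite e -r4 -exprM -(mulnA 2 2) e.
Qed.

Lemma first_moment_estimate mu : exists C : R, forall g, (0 < g)%N ->
  let B := (1 - qR^-1) * qR ^+ (2 * g).+1 in
  `|first_moment mu g - ((-2) ^+ mu * B * main_value mu (g %/ 2) +
     2 ^+ mu * B * \sum_(0 <= m < mu.+1) 'C(mu, m)%:R * (- g%:R) ^+ (mu - m) * main_value m ((g - 1) %/ 2))|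
  <= C * (2 * g).+1%:R ^+ mu * r ^+ (7 * g).
Proof.
(* One constant for all m <= mu, the sum of the constants of [square_sum_estimate]. *)
have [C C0 CE] : exists2 C : R, 0 <= C & forall m g K, (m <= mu)%N -> (0 < g)%N ->
  (2 * K <= g)%N -> (g <= 2 * K.+1)%N ->
  `|square_sum g m K - (1 - qR^-1) * qR ^+ (2 * g).+1 * main_value m K| <= C * g%:R ^+ m * r ^+ (7 * g).
  elim: mu => [|mu [C C0 CE]].
    have [C C0 CE] := square_sum_estimate 0; exists C => // m g K.
    by rewrite leqn0 => /eqP ->; apply: CE.
  have [C' C'0 CE'] := square_sum_estimate mu.+1; exists (C + C'); first by rewrite addr_ge0.
  move=> m g K; rewrite leq_eqVlt => /predU1P[->|mm] g0 Kg gK.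
    apply: le_trans (CE' _ _ g0 Kg gK) _.
    by rewrite ler_wpM2r ?exprn_ge0 ?(ltW r_gt0) // ler_wpM2r ?exprn_ge0 // lerDr.
  apply: le_trans (CE m _ _ mm g0 Kg gK) _.
  by rewrite ler_wpM2r ?exprn_ge0 ?(ltW r_gt0) // ler_wpM2r ?exprn_ge0 // lerDl.
pose c1 : R := 3 * qR ^+ 2 * r ^+ 3.
exists (2 * c1 + 2 ^+ mu * C + 2 ^+ mu * \sum_(0 <= m < mu.+1) 'C(mu, m)%:R * C).
move=> g g0; lazy zeta; set B := (1 - qR^-1) * qR ^+ (2 * g).+1; set G := (2 * g).+1%:R ^+ mu; set r7 := r ^+ (7 * g).
have r70 : 0 <= r7 by rewrite exprn_ge0 // ltW.
have gG : g%:R <= (2 * g).+1%:R :> R by rewrite ler_nat; clear; lia.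
rewrite first_moment_fold //.
have split k (w : nat -> R) : \sum_(n < k) (L_avg (2 * g).+1 n)%:~R / r ^+ (2 * n) * w n =
   \sum_(n < k) (if odd n then 0 else (square_avg F (2 * g).+1 n./2)%:~R) / r ^+ (2 * n) * w n +
   \sum_(n < k) (nonsquare_avg (2 * g).+1 n)%:~R / r ^+ (2 * n) * w n.
  rewrite -big_split; apply: eq_bigr => n _ /=.
  by rewrite L_avg_split rmorphD /= -mulrDl -mulrDl; case: ifP.
rewrite (split g.+1 (fun n => (- n%:R) ^+ mu)) (split g (fun n => (n%:R - (2 * g)%:R) ^+ mu)).
set N1 := (X in _ + X + _); set N2 := (X in _ + (_ + X)).
have HN1 : `|N1| <= c1 * G * r7.
  apply: (@nonsquare_sum_bound _ _ _ (fun n => (- n%:R) ^+ mu)) => // n ng.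
  by rewrite normrX normrN normr_nat lerXn2r ?nnegrE // ler_nat; clear -ng; lia.
have HN2 : `|N2| <= c1 * G * r7.
  apply: (@nonsquare_sum_bound _ _ _ (fun n => (n%:R - (2 * g)%:R) ^+ mu)) => // n ng.
  have n2 : (n <= 2 * g)%N by clear -ng; lia.
  rewrite normrX distrC -natrB // normr_nat lerXn2r ?nnegrE // ler_nat; clear; lia.
rewrite (square_part _ _ (fun n => (- n%:R) ^+ mu)).
have -> : \sum_(n < g) (if odd n then 0 else (square_avg F (2 * g).+1 n./2)%:~R) / r ^+ (2 * n) * (n%:R - (2 * g)%:R) ^+ mu =
   \sum_(i < ((g - 1) %/ 2).+1) (square_avg F (2 * g).+1 i)%:~R / qR ^+ i * ((2 * i)%:R - (2 * g)%:R) ^+ mu.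
  rewrite divn2 -(square_part g _ (fun n => (n%:R - (2 * g)%:R) ^+ mu)).
  by rewrite subn1 prednK.
have -> : \sum_(i < g./2.+1) (square_avg F (2 * g).+1 i)%:~R / qR ^+ i * (- (2 * i)%:R) ^+ mu =
    (-2) ^+ mu * square_sum g mu (g %/ 2).
  rewrite divn2 /square_sum mulr_sumr; apply: eq_bigr => i _.
  by rewrite natrM -mulNr exprMn; ring.
(* Even degrees n = 2i turn (n - 2g)^mu into 2^mu (i - g)^mu, and the binomial theorem produces the
   sum over m in the theorem. *)
have -> : \sum_(i < ((g - 1) %/ 2).+1) (square_avg F (2 * g).+1 i)%:~R / qR ^+ i * ((2 * i)%:R - (2 * g)%:R) ^+ mu =
    2 ^+ mu * \sum_(0 <= m < mu.+1) 'C(mu, m)%:R * (- g%:R) ^+ (mu - m) * square_sum g m ((g - 1) %/ 2).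
  rewrite big_mkord mulr_sumr /square_sum.
  under [RHS]eq_bigr => m _ do rewrite !mulr_sumr.
  rewrite exchange_big /=; apply: eq_bigr => i _.
  have -> : (2 * i)%:R - (2 * g)%:R = 2 * (- g%:R + i%:R) :> R by rewrite !natrM; ring.
  rewrite exprMn (exprDn (- g%:R) i%:R) mulr_sumr mulr_sumr; apply: eq_bigr => m _.
  by rewrite -mulr_natl; ring.
set K1 := (g %/ 2)%N; set K2 := ((g - 1) %/ 2)%N.
have H1 : `|(-2) ^+ mu * square_sum g mu K1 - (-2) ^+ mu * B * main_value mu K1| <= 2 ^+ mu * C * G * r7.
  have -> : 2 ^+ mu * C * G * r7 = 2 ^+ mu * (C * G * r7) by ring.
  rewrite -(mulrA _ B) -mulrBr normrM normrX normrN normr_nat ler_wpM2l ?exprn_ge0 //.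
  apply: le_trans (CE mu g K1 (leqnn _) g0 _ _) _; try by rewrite /K1; clear; lia.
  by rewrite ler_wpM2r // ler_wpM2l // lerXn2r ?nnegrE.
have H2 : `|2 ^+ mu * \sum_(0 <= m < mu.+1) 'C(mu, m)%:R * (- g%:R) ^+ (mu - m) * square_sum g m K2 -
   2 ^+ mu * B * \sum_(0 <= m < mu.+1) 'C(mu, m)%:R * (- g%:R) ^+ (mu - m) * main_value m K2| <=
   2 ^+ mu * (\sum_(0 <= m < mu.+1) 'C(mu, m)%:R * C) * G * r7.
  have -> : 2 ^+ mu * (\sum_(0 <= m < mu.+1) 'C(mu, m)%:R * C) * G * r7 =
      2 ^+ mu * \sum_(0 <= m < mu.+1) 'C(mu, m)%:R * (C * G * r7).
    rewrite -!mulrA; congr (_ * _); rewrite mulr_suml; apply: eq_bigr => m _; ring.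
  rewrite -(mulrA _ B) -mulrBr normrM normrX normr_nat ler_wpM2l ?exprn_ge0 //.
  rewrite mulr_sumr -sumrB; apply: le_trans (ler_norm_sum _ _ _) _.
  rewrite big_nat [leRHS]big_nat; apply: ler_sum => m /andP[_ mm].
  have -> : 'C(mu, m)%:R * (- g%:R) ^+ (mu - m) * square_sum g m K2 -
      B * ('C(mu, m)%:R * (- g%:R) ^+ (mu - m) * main_value m K2) =
      'C(mu, m)%:R * ((- g%:R) ^+ (mu - m) * (square_sum g m K2 - B * main_value m K2)) by ring.
  rewrite normrM normr_nat ler_wpM2l // normrM normrX normrN normr_nat.
  apply: (@le_trans _ _ (g%:R ^+ (mu - m) * (C * g%:R ^+ m * r7))).
    rewrite ler_wpM2l ?exprn_ge0 //; apply: CE => //; by rewrite /K2; clear -g0; lia.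
  have -> : g%:R ^+ (mu - m) * (C * g%:R ^+ m * r7) = C * (g%:R ^+ (mu - m) * g%:R ^+ m * r7) by ring.
  by rewrite -exprD subnK // -mulrA ler_wpM2l // ler_wpM2r // lerXn2r ?nnegrE.
set S1 := (-2) ^+ mu * _; set S2 := 2 ^+ mu * \sum_(_ <= _ < _) _.
set M1 := (-2) ^+ mu * B * _; set M2 := 2 ^+ mu * B * _.
have -> : S1 + N1 + (S2 + N2) - (M1 + M2) = (S1 - M1) + (S2 - M2) + (N1 + N2) by ring.
apply: le_trans (ler_normD _ _) _.
apply: le_trans (lerD (le_trans (ler_normD _ _) (lerD H1 H2)) (le_trans (ler_normD _ _) (lerD HN1 HN2))) _.
by rewrite le_eqVlt; apply/orP; left; apply/eqP; ring.
Qed.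

End FirstMoment.

(** * The complex exponential *)

Section ComplexExponential.
Variable R : realType.
Implicit Types (a b x y : R) (z w : R[i]).
Local Notation normc := (@ComplexField.Normc.normc R).
Local Notation Re := (@complex.Re R).
Local Notation Im := (@complex.Im R).

Lemma norm_complex z : `|z| = (normc z)%:C.
Proof. by rewrite normc_def; case: z. Qed.

Lemma normc_ge0 z : 0 <= normc z.
Proof. by rewrite -ler0c -norm_complex. Qed.

Lemma normc_real x : normc x%:C = `|x|.
Proof. by rewrite /= expr0n addr0 sqrtr_sqr. Qed.

Lemma normc_Re z : `|Re z| <= normc z.
Proof.
case: z => a b /=; rewrite -sqrtr_sqr ler_sqrt; last by rewrite addr_ge0 ?sqr_ge0.
by rewrite lerDl sqr_ge0.
Qed.

Lemma normc_Im z : `|Im z| <= normc z.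
Proof.
case: z => a b /=; rewrite -sqrtr_sqr ler_sqrt; last by rewrite addr_ge0 ?sqr_ge0.
by rewrite lerDr sqr_ge0.
Qed.

Lemma normc_le z : normc z <= `|Re z| + `|Im z|.
Proof.
case: z => a b /=; rewrite -[leRHS]ger0_norm ?addr_ge0 // -sqrtr_sqr ler_sqrt ?sqr_ge0 //.
rewrite sqrrD !real_normK ?num_real //.
by have := mulr_ge0 (normr_ge0 a) (normr_ge0 b); lra.
Qed.

Lemma abs_MVT (f df : R -> R) (B x : R) : (forall y, is_derive y 1 f (df y)) ->
  (forall y, `|y| <= `|x| -> `|df y| <= B) -> `|f x - f 0| <= B * `|x|.
Proof.
move=> fd dB; have fc y : {for y, continuous f}.
  by apply/differentiable_continuous/derivable1_diffP; case: (fd y).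
have H u v : u <= v -> (forall y, u <= y <= v -> `|y| <= `|x|) -> `|f v - f u| <= B * `|v - u|.
  move=> uv H; have [|c] := MVT_segment uv (fun y _ => fd y).
    by apply: continuous_subspaceT => y; exact: fc.
  rewrite in_itv /= => cuv ->; rewrite normrM ler_wpM2r // dB //; exact: H.
have [x0|x0] := leP 0 x.
  rewrite -{2}[x]subr0; apply: H => // y /andP[y0 yx].
  by rewrite !ger0_norm.
rewrite distrC; apply: (le_trans (H x 0 (ltW x0) _)); last by rewrite sub0r normrN.
by move=> y /andP[xy y0]; rewrite !ler0_norm ?lerN2 // ltW.
Qed.

Lemma norm_sin_le x : `|sin x| <= `|x|.
Proof.
have := @abs_MVT sin cos 1 x; rewrite sin0 subr0 mul1r; apply => y; by rewrite cos_max.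
Qed.

Lemma norm_cos_sub1_le x : `|cos x - 1| <= `|x| * `|x|.
Proof.
have := @abs_MVT cos (fun y => - sin y) `|x| x; rewrite cos0; apply => y.
by rewrite normrN => /(le_trans (norm_sin_le y)).
Qed.

Lemma norm_cos_sub1_le1 x : `|cos x - 1| <= `|x|.
Proof.
have := @abs_MVT cos (fun y => - sin y) 1 x; rewrite cos0 mul1r; apply => y.
by rewrite normrN sin_max.
Qed.

Lemma norm_sin_sub_le x : `|sin x - x| <= `|x| * `|x|.
Proof.
have := @abs_MVT (fun y => sin y - y) (fun y => cos y - 1) `|x| x; rewrite sin0 !subr0; apply => y.
exact: (le_trans (norm_cos_sub1_le1 y)).
Qed.

Lemma expR_sub1_le a : `|expR a - 1| <= `|a| * expR `|a|.
Proof.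
have [a0|a0] := leP 0 a.
  have e1 : 1 <= expR a by rewrite -expR0 ler_expR.
  rewrite !ger0_norm ?subr_ge0 //.
  have := ler_wpM2r (expR_ge0 a) (expR_ge1Dx (- a)).
  by rewrite -expRD addNr expR0 mulrDl mul1r mulNr; lra.
have e1 : expR a <= 1 by rewrite -expR0 ler_expR ltW.
rewrite (ltr0_norm a0) ler0_norm ?subr_le0 //.
have e2 : 1 <= expR (- a) by rewrite -expR0 ler_expR; lra.
have := expR_ge1Dx a; have := expR_gt0 a; nra.
Qed.

(** The inequality (1 - a) e^a <= 1 bounds e^a - 1 - a by a (e^a - 1), so the first-order estimate
    finishes. *)
Lemma expR_sub1x_le a : `|expR a - 1 - a| <= `|a| ^+ 2 * expR `|a|.
Proof.
have e0 := expR_gt0 a; have e1 := expR_ge1Dx a.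
have e2 : 1 <= expR `|a| by rewrite -expR0 ler_expR.
rewrite ger0_norm; last by lra.
have H : (1 - a) * expR a <= 1.
  have [a1|a1] := ltP a 1.
    have := expR_ge1Dx (- a); rewrite expRN => H.
    by rewrite -ler_pdivlMr // div1r.
  by apply: (le_trans _ ler01); rewrite mulr_le0_ge0 ?subr_le0 // ltW.
have {H} : expR a - 1 - a <= a * (expR a - 1) by lra.
move=> H; apply: (le_trans H); apply: (le_trans (ler_norm _)).
by rewrite normrM expr2 -mulrA ler_wpM2l // expR_sub1_le.
Qed.

Lemma cexpD z w : cexp (z + w) = cexp z * cexp w.
Proof.
case: z w => [a b] [c d]; rewrite /cexp -/(addc _ _) /= expRD cosD sinD.
by simpc; congr (_ +i* _); ring.
Qed.

Lemma cexp_real x : cexp x%:C = (expR x)%:C.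
Proof. by rewrite /cexp /= cos0 sin0; simpc. Qed.

Lemma cexp0 : cexp 0 = 1 :> R[i].
Proof. by rewrite (cexp_real 0) expR0. Qed.

Lemma normc_cexp z : normc (cexp z) = expR (Re z).
Proof.
case: z => a b; rewrite /cexp ComplexField.Normc.normcM normc_real /=.
by rewrite cos2Dsin2 sqrtr1 mulr1 ger0_norm ?expR_ge0.
Qed.

Lemma cexpN z : cexp (- z) = (cexp z)^-1.
Proof.
have H : cexp z * cexp (- z) = 1 by rewrite -cexpD subrr cexp0.
have z0 : cexp z != 0 by apply/eqP => z0; move/eqP: H; rewrite z0 mul0r eq_sym oner_eq0.
by apply: (mulfI z0); rewrite H divff.
Qed.

(** Real and imaginary parts each split into two terms of size at most |w|^2 exp |w|, hence the
    factor 4. *)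
Lemma cexp_remainder w :
  normc (cexp w - 1 - w) <= 4 * normc w ^+ 2 * expR (normc w).
Proof.
have [ha hb] := (normc_Re w, normc_Im w); have n0 := normc_ge0 w.
set N := normc w in ha hb n0 *.
apply: (le_trans (normc_le _)); case: w @N ha hb n0 => a b N /= ha hb n0.
set E := expR N; have eE : expR `|a| <= E by rewrite ler_expR.
have eaE : expR a <= E by rewrite ler_expR (le_trans (ler_norm _)).
have HR : `|expR a * cos b - 0 * sin b - 1 - a| <= N ^+ 2 * E + E * (N * N).
  have -> : expR a * cos b - 0 * sin b - 1 - a = (expR a - 1 - a) + expR a * (cos b - 1) by ring.
  apply: (le_trans (ler_normD _ _)); apply: lerD.
    by apply: (le_trans (expR_sub1x_le a)); apply: ler_pM; rewrite ?exprn_ge0 ?expR_ge0 // lerXn2r ?nnegrE.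
  rewrite normrM ger0_norm ?expR_ge0 //; apply: ler_pM; rewrite ?expR_ge0 //.
  by apply: (le_trans (norm_cos_sub1_le b)); apply: ler_pM.
have HI : `|expR a * sin b + 0 * cos b - 0 - b| <= N * E * N + E * (N * N).
  have -> : expR a * sin b + 0 * cos b - 0 - b = (expR a - 1) * b + expR a * (sin b - b) by ring.
  apply: (le_trans (ler_normD _ _)); apply: lerD.
    rewrite normrM; apply: ler_pM => //.
    by apply: (le_trans (expR_sub1_le a)); apply: ler_pM; rewrite ?expR_ge0.
  rewrite normrM ger0_norm ?expR_ge0 //; apply: ler_pM; rewrite ?expR_ge0 //.
  by apply: (le_trans (norm_sin_sub_le b)); apply: ler_pM.
have -> : 4 * N ^+ 2 * E = (N ^+ 2 * E + E * (N * N)) + (N * E * N + E * (N * N)) by ring.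
by apply: lerD; [apply: le_trans HR | apply: le_trans HI]; rewrite le_eqVlt; apply/orP; left; apply/eqP; congr (`|_|); ring.
Qed.

End ComplexExponential.

(** * Derivatives of Dirichlet series *)

Section ComplexLimits.
Variable R : realType.
Local Notation normc := (@ComplexField.Normc.normc R).
Local Notation Re := (@complex.Re R).
Local Notation Im := (@complex.Im R).

Lemma posc_real (e : R[i]) : 0 < e -> exists2 d : R, 0 < d & e = d%:C.
Proof.
case: e => a b; rewrite ltcE /= => /andP[/eqP b0 a0]; exists a => //.
by rewrite b0.
Qed.

Lemma cvg_complexP (u : nat -> R[i]^o) (l : R[i]^o) :
  (fun n => Re (u n)) @ \oo --> Re l -> (fun n => Im (u n)) @ \oo --> Im l ->
  u @ \oo --> l.
Proof.
move=> /cvgrPdist_le cr /cvgrPdist_le ci; apply/cvgrPdist_le => e /posc_real[d d0 ->].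
have d2 : 0 < d / 2 by rewrite divr_gt0.
apply: filterS2 (cr _ d2) (ci _ d2) => n Hr Hi.
have -> : `|l - u n| = (normc (l - u n))%:C by rewrite -norm_complex.
rewrite lecR; apply: (le_trans (normc_le _)).
have -> : complex.Re (l - u n) = Re l - Re (u n) by case: l {cr ci Hr Hi} (u n) => ? ? [].
have -> : complex.Im (l - u n) = Im l - Im (u n) by case: l {cr ci Hr Hi} (u n) => ? ? [].
by rewrite [leRHS]splitr lerD.
Qed.

Lemma Re_series (u : nat -> R[i]^o) n : Re (series u n) = series (fun k => Re (u k)) n.
Proof.
rewrite /series /=; elim: n => [|n IH]; first by rewrite !big_geq.
by rewrite !big_nat_recr //= -IH; case: (\sum_(_ <= _ < _) _) (u n) => ? ? [].
Qed.

Lemma Im_series (u : nat -> R[i]^o) n : Im (series u n) = series (fun k => Im (u k)) n.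
Proof.
rewrite /series /=; elim: n => [|n IH]; first by rewrite !big_geq.
by rewrite !big_nat_recr //= -IH; case: (\sum_(_ <= _ < _) _) (u n) => ? ? [].
Qed.

Lemma real_series_lim (u : nat -> R) : cvgn (series u) ->
  limn (series (fun n => (u n)%:C) : nat -> R[i]^o) = (limn (series u))%:C.
Proof.
move=> cu; apply: cvg_lim => //; apply: cvg_complexP => /=.
  by under eq_fun do rewrite Re_series.
under eq_fun do rewrite Im_series /=.
rewrite (_ : (fun _ => _) = (fun=> 0)); first exact: cvg_cst.
by apply/funext => n; rewrite /series /= big1.
Qed.

Section Dominated.
Variables (u : nat -> R[i]^o) (M x : R).
Hypotheses (M0 : 0 <= M) (x0 : 0 <= x) (x2 : 2 * x <= 1).
Hypothesis uM : forall n, normc (u n) <= M * x ^+ n.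

Let ReM n : `|Re (u n)| <= M * x ^+ n.
Proof. exact: le_trans (normc_Re _) (uM n). Qed.

Let ImM n : `|Im (u n)| <= M * x ^+ n.
Proof. exact: le_trans (normc_Im _) (uM n). Qed.

Let l : R[i]^o := limn (series (fun k => Re (u k))) +i* limn (series (fun k => Im (u k))).

Let cvg_l : series u @ \oo --> l.
Proof.
apply: cvg_complexP => /=.
  by under eq_fun do rewrite Re_series; exact: dominated_series_cvg ReM.
by under eq_fun do rewrite Im_series; exact: dominated_series_cvg ImM.
Qed.

Lemma dominated_complex_series_cvg : cvgn (series u : nat -> R[i]^o).
Proof. by apply/cvg_ex; exists l. Qed.

Lemma dominated_complex_series_le : normc (limn (series u : nat -> R[i]^o)) <= 4 * M.
Proof.
have -> : limn (series u : nat -> R[i]^o) = l by apply: cvg_lim.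
apply: (le_trans (normc_le _)) => /=.
have -> : 4 * M = 2 * M + 2 * M by ring.
apply: lerD.
  have := @series_tail_le _ (fun k => Re (u k)) M x M0 x0 x2 0 (dominated_series_cvg M0 x0 x2 ReM) (fun j _ => ReM j).
  by rewrite expr0 mulr1 /series /= big_geq // subr0.
have := @series_tail_le _ (fun k => Im (u k)) M x M0 x0 x2 0 (dominated_series_cvg M0 x0 x2 ImM) (fun j _ => ImM j).
by rewrite expr0 mulr1 /series /= big_geq // subr0.
Qed.

End Dominated.

Lemma derive1_quadratic (f : R[i] -> R[i]^o) (a l : R[i]) (M d : R) : 0 < d ->
  (forall h, normc h < d -> normc (f (h + a) - f a - h * l) <= M * normc h ^+ 2) ->
  derive1 f a = l.
Proof.
move=> d0 H; rewrite /derive1; apply: cvg_lim => //.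
apply/cvgrPdist_le => e /posc_real[e' e0 ->].
(* M has no assumed sign; the radius needs a positive divisor. *)
set M1 := `|M| + 1; have M10 : 0 < M1 by rewrite ltr_wpDl.
have m0 : 0 < Num.min d (e' / M1) by rewrite lt_min d0 divr_gt0.
have mC : 0 < (Num.min d (e' / M1))%:C :> R[i] by rewrite ltcR.
have H1 := @dnbhs0_lt _ R[i]^o _ mC.
have H2 := @nbhs_dnbhs_neq R[i]^o 0.
near=> h.
have h0 : h != 0 by near: h.
have : `|h| < (Num.min d (e' / M1))%:C by near: h.
rewrite norm_complex ltcR lt_min => /andP[hd he].
have -> : `|l - h^-1 *: (f (h + a) - f a)| = (normc (l - h^-1 * (f (h + a) - f a)))%:C by rewrite -norm_complex.
rewrite lecR.
have -> : l - h^-1 * (f (h + a) - f a) = - (h^-1 * (f (h + a) - f a - h * l)) by field.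
rewrite normcN ComplexField.Normc.normcM ComplexField.Normc.normcV.
have nh : 0 < normc h.
  by rewrite lt_neqAle normc_ge0 eq_sym andbT; apply: contra h0 => /eqP/ComplexField.Normc.eq0_normc ->.
rewrite mulrC ler_pdivrMr //; apply: (le_trans (H _ hd)).
rewrite expr2 mulrA (ler_wpM2r (ltW nh)) //.
apply: (@le_trans _ _ (M1 * normc h)).
  by rewrite (ler_wpM2r (ltW nh)) // /M1 (le_trans (ler_norm M)) // lerDl.
by rewrite mulrC -ler_pdivlMr // ltW.
Unshelve. all: by end_near. Qed.

End ComplexLimits.

(** * Termwise differentiation of Dirichlet series *)

Section DirichletSeries.
Variables (R : realType) (c : nat -> R) (lam sigma x : R).
Local Notation normc := (@ComplexField.Normc.normc R).
Local Notation Re := (@complex.Re R).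
Hypotheses (lam0 : 0 <= lam) (x0 : 0 <= x) (x2 : 2 * x <= 1).
Hypothesis c_bound : forall k, exists2 M, 0 <= M &
  forall n, `|c n| * n%:R ^+ k * expR (- (n%:R * lam * sigma)) <= M * x ^+ n.

(** The m-th derivative in s of c_n exp(-n lam s), which is c_n q^(-ns) when lam = ln q. *)
Definition dirichlet_term (m : nat) (s : R[i]) (n : nat) : R[i]^o :=
  (c n * (- (n%:R * lam)) ^+ m)%:C * cexp ((- (n%:R * lam))%:C * s).

Definition dirichlet m s : R[i]^o := limn (series (dirichlet_term m s) : nat -> R[i]^o).

Let Re_scale (a : R) (s : R[i]) : Re (a%:C * s) = a * Re s.
Proof. by case: s => u v /=; rewrite mul0r subr0. Qed.

Lemma normc_dirichlet_term m s n : normc (dirichlet_term m s n) =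
  `|c n| * (n%:R * lam) ^+ m * expR (- (n%:R * lam * Re s)).
Proof.
rewrite /dirichlet_term ComplexField.Normc.normcM normc_real normc_cexp.
by rewrite Re_scale mulNr normrM normrX normrN (ger0_norm (mulr_ge0 (ler0n _ _) lam0)).
Qed.

Lemma dirichlet_cvg m s : sigma <= Re s -> cvgn (series (dirichlet_term m s) : nat -> R[i]^o).
Proof.
have [M M0 cM] := c_bound m; move=> ss.
apply: (@dominated_complex_series_cvg _ _ (lam ^+ m * M) x) => //.
  by rewrite mulr_ge0 // exprn_ge0.
move=> n; rewrite normc_dirichlet_term exprMn.
have -> : `|c n| * (n%:R ^+ m * lam ^+ m) * expR (- (n%:R * lam * Re s)) =
  lam ^+ m * (`|c n| * n%:R ^+ m * expR (- (n%:R * lam * Re s))) by ring.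
rewrite -[leRHS]mulrA ler_wpM2l ?exprn_ge0 //; apply: le_trans (cM n).
by rewrite ler_wpM2l ?mulr_ge0 ?exprn_ge0 // ler_expR lerN2 ler_wpM2l // mulr_ge0.
Qed.

(** The remainder of a term is the term times exp(w) - 1 - w with w = -n lam h, quadratic in n;
    hence the moment [m.+2] of the coefficients. The restriction on h keeps exp |w| from shifting
    the abscissa below sigma. *)
Lemma dirichlet_quadratic m s : sigma < Re s -> exists M : R, forall h,
  normc h < Re s - sigma ->
  normc (dirichlet m (h + s) - dirichlet m s - h * dirichlet m.+1 s) <= M * normc h ^+ 2.
Proof.
move=> ss; have [M M0 cM] := c_bound m.+2.
exists (4 * (4 * lam ^+ m.+2 * M)) => h hs.
have Rh : sigma <= Re (h + s).
  have -> : Re (h + s) = Re h + Re s by case: h {hs} s {ss} => ? ? [].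
  by have := normc_Re h; rewrite ler_norml => /andP[]; lra.
have cs := @dirichlet_cvg m _ (ltW ss); have cs1 := @dirichlet_cvg m.+1 _ (ltW ss).
have ch := @dirichlet_cvg m _ Rh.
pose v n : R[i]^o := dirichlet_term m (h + s) n - dirichlet_term m s n - h * dirichlet_term m.+1 s n.
have cv : series v @ \oo --> (dirichlet m (h + s) - dirichlet m s - h *: dirichlet m.+1 s : R[i]^o).
  have -> : (series v : nat -> R[i]^o) = (series (dirichlet_term m (h + s)) \- series (dirichlet_term m s))
    \- (fun n => h *: (series (dirichlet_term m.+1 s) n : R[i]^o)).
    apply/funext => n; rewrite /series /= /v !sumrB; congr (_ - _).
    by rewrite -mulr_sumr.
  by apply: cvgB; [apply: cvgB; [exact: ch|exact: cs] | apply: cvgZr; exact: cs1].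
have lv := @cvg_lim R[i]^o (@norm_hausdorff _ R[i]^o) nat \oo _ (series v) _ cv.
rewrite -[X in normc X]lv.
have -> : 4 * (4 * lam ^+ m.+2 * M) * normc h ^+ 2 = 4 * (4 * lam ^+ m.+2 * M * normc h ^+ 2) by ring.
apply: (@dominated_complex_series_le _ _ _ x) => //.
  by rewrite mulr_ge0 ?exprn_ge0 ?normc_ge0 // mulr_ge0 // mulr_ge0 // exprn_ge0.
move=> n; set w := (- (n%:R * lam))%:C * h.
have -> : v n = dirichlet_term m s n * (cexp w - 1 - w).
  rewrite /v /dirichlet_term mulrDr cexpD -/w exprSr !rmorphM /w; ring.
have nw : normc w = n%:R * lam * normc h.
  by rewrite /w ComplexField.Normc.normcM normc_real normrN ger0_norm // mulr_ge0.
rewrite ComplexField.Normc.normcM normc_dirichlet_term.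
have nl0 : 0 <= n%:R * lam by rewrite mulr_ge0.
apply: (@le_trans _ _ (`|c n| * (n%:R * lam) ^+ m * expR (- (n%:R * lam * Re s)) *
   (4 * (n%:R * lam * normc h) ^+ 2 * expR (n%:R * lam * (Re s - sigma))))).
  rewrite ler_wpM2l ?mulr_ge0 ?expR_ge0 ?exprn_ge0 //.
  apply: (le_trans (cexp_remainder w)); rewrite nw.
  by rewrite ler_wpM2l ?mulr_ge0 ?exprn_ge0 ?normc_ge0 // ler_expR ler_wpM2l // ltW.
have -> : expR (n%:R * lam * (Re s - sigma)) = expR (n%:R * lam * Re s) * expR (- (n%:R * lam * sigma)).
  by rewrite -expRD; congr expR; ring.
have e1 := expRxMexpNx_1 (n%:R * lam * Re s).
have -> : `|c n| * (n%:R * lam) ^+ m * expR (- (n%:R * lam * Re s)) *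
   (4 * (n%:R * lam * normc h) ^+ 2 * (expR (n%:R * lam * Re s) * expR (- (n%:R * lam * sigma)))) =
   4 * lam ^+ m.+2 * normc h ^+ 2 * (`|c n| * n%:R ^+ m.+2 * expR (- (n%:R * lam * sigma))) *
   (expR (n%:R * lam * Re s) * expR (- (n%:R * lam * Re s))).
  by rewrite -[m.+2]addn2 !exprD !exprMn; ring.
rewrite e1 mulr1.
have -> : 4 * lam ^+ m.+2 * M * normc h ^+ 2 * x ^+ n = 4 * lam ^+ m.+2 * normc h ^+ 2 * (M * x ^+ n) by ring.
by rewrite ler_wpM2l // mulr_ge0 ?exprn_ge0 ?normc_ge0 // mulr_ge0 // exprn_ge0.
Qed.

(** Each differentiation uses the formula at nearby points, so agreement is asked on the whole open
    half-plane. *)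
Lemma derive1n_dirichlet (f : R[i] -> R[i]^o) :
  (forall s, sigma < Re s -> f s = dirichlet 0 s) ->
  forall m s, sigma < Re s -> derive1n m f s = dirichlet m s.
Proof.
move=> fE; elim=> [|m IH] s ss; first exact: fE.
have [M HM] := dirichlet_quadratic m ss; rewrite derive1nS.
apply: (@derive1_quadratic _ _ _ _ M (Re s - sigma)); first by rewrite subr_gt0.
move=> h hs; rewrite (IH s ss) IH; first exact: HM.
have -> : Re (h + s) = Re h + Re s by case: (h) (s) => ? ? [].
by have := normc_Re h; rewrite ler_norml => /andP[]; lra.
Qed.

End DirichletSeries.

(** * Derivatives of L and G *)

Section ComplexMoments.
Variables (R : realType) (F : finFieldType).
Hypothesis oq : odd #|F|.
Local Notation qR := (#|F|%:R : R).
Local Notation lam := (ln qR).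
Local Notation r := (expR (lam / 4)).

Lemma q_gt0R : 0 < qR.
Proof. by have := @qR_ge3 R F oq; lra. Qed.

Lemma expr_root4 : r ^+ 4 = qR.
Proof.
rewrite -expRM_natl -[RHS](@lnK R); last by rewrite posrE q_gt0R.
by congr expR; field.
Qed.

Let r0 : 0 < r. Proof. exact: expR_gt0. Qed.

Lemma ln_q_gt0 : 0 < lam.
Proof. by apply: ln_gt0; have := @qR_ge3 R F oq; lra. Qed.

Lemma cpow_expr n (s : R[i]) : cpow (qR ^+ n) s = cexp ((n%:R * lam)%:C * s).
Proof. by rewrite /cpow lnXn ?q_gt0R // -(mulr_natl lam); congr cexp; exact: mulrC. Qed.

Lemma Gterm_dirichlet (s : R[i]) n :
  \sum_(L \in monic_deg F n) Gterm s L = dirichlet_term (gcoef R F) lam 0 s n.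
Proof.
rewrite fsbig_monics /dirichlet_term expr0 mulr1 mulrC /gcoef rmorph_sum mulr_sumr /=.
apply: eq_big_seq => L; rewrite mem_monics => /andP[Lm /eqP sL].
rewrite /Gterm pnorm_monic // sL /= natrX cpow_expr.
have -> : \big[*%R/1]_(P \in prime_divisors L) (1 + (pnorm P)%:R : R[i]) = (pweight R L)%:C.
  rewrite /pweight (@fsbig_prime_divisors _ _ _ _ n) ?sL ?monic_neq0 //.
  rewrite (@fsbig_prime_divisors _ _ _ _ n) ?sL ?monic_neq0 // (rmorph_prod (real_complex R)) /=.
  by apply: eq_bigr => P _; rewrite rmorphD rmorph1 rmorph_nat.
have -> : ((pmobius L)%:~R / pweight R L)%:C = (pmobius L)%:~R / (pweight R L)%:C.
  by rewrite (rmorphM (real_complex R)) fmorphV rmorph_int.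
rewrite rmorphN mulNr cexpN invfM.
by rewrite mulrCA.
Qed.

(** The abscissa 7/8 lies below 1, where G is differentiated, and leaves q^(n/8) to absorb n^k:
    q^(-7n/8) q^(n/8) = r^(-3n). *)
Lemma gcoef_decay k : exists2 M : R, 0 <= M &
  forall n, `|gcoef R F n| * n%:R ^+ k * expR (- (n%:R * lam * (7 / 8))) <= M * ((r ^+ 3)^-1) ^+ n.
Proof.
have y1 : 1 < expR (lam / 8) by rewrite -[X in X < _]expR0 ltr_expR divr_gt0 // ln_q_gt0.
have [C C0 HC] := exprn_le_exp k y1; exists C => // n.
apply: (@le_trans _ _ (1 * (C * expR (lam / 8) ^+ n) * expR (- (n%:R * lam * (7 / 8))))).
  by rewrite ler_wpM2r ?expR_ge0 // ler_pM ?norm_gcoef_le1 // exprn_ge0.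
rewrite mul1r -mulrA ler_wpM2l //.
rewrite -!expRM_natl -expRN -expRM_natl -expRD le_eqVlt; apply/orP; left; apply/eqP; congr expR.
by field.
Qed.

Let x0 : 0 <= (r ^+ 3)^-1.
Proof. by rewrite invr_ge0 exprn_ge0 ?expR_ge0. Qed.

Let x2 : 2 * (r ^+ 3)^-1 <= 1.
Proof.
have r3 := r3_ge2 oq r0 expr_root4; rewrite -ler_pdivlMr ?invr_gt0 ?exprn_gt0 //.
by rewrite mul1r invrK.
Qed.

Lemma Gseries_dirichlet (s : R[i]) : Gseries F s = dirichlet (gcoef R F) lam 0 s.
Proof.
rewrite /Gseries /dirichlet; congr (limn (series _)).
by apply/funext => n; rewrite Gterm_dirichlet.
Qed.

Lemma derive1n_Gseries m :
  derive1n m (@Gseries R F) 1 / (- lam%:C) ^+ m = (gmoment R F m)%:C.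
Proof.
have l0 := ln_q_gt0.
rewrite (derive1n_dirichlet (ltW l0) x0 x2 gcoef_decay) => [||/=]; last by lra.
  rewrite /dirichlet.
  have -> : dirichlet_term (gcoef R F) lam m 1 = (fun n => ((- lam) ^+ m * gterm R F m n)%:C).
    apply/funext => n; rewrite /dirichlet_term mulr1 cexp_real -rmorphM; congr (_%:C).
    have -> : expR (- (n%:R * lam)) = (qR ^+ n)^-1.
      by rewrite expRN expRM_natl lnK // posrE q_gt0R.
    by rewrite /gterm -mulrN exprMn; ring.
  have cg := cvg_gmoment oq r0 expr_root4 (m := m).
  rewrite real_series_lim; last exact: (is_cvg_seriesZ (k := (- lam) ^+ m) cg).
  rewrite (lim_seriesZ ((- lam) ^+ m) cg) -rmorphN -rmorphXn -fmorphV -rmorphM; congr (_%:C).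
  by rewrite mulrC mulKf // expf_neq0 // oppr_eq0 gt_eqF.
by move=> s _; exact: Gseries_dirichlet.
Qed.

Lemma limn_series_finite (N : nat) (u : nat -> R[i]^o) : (forall n, (N <= n)%N -> u n = 0) ->
  limn (series u : nat -> R[i]^o) = \sum_(n < N) u n.
Proof.
move=> u0; apply: lim_near_cst => //; exists N => // n /= Nn.
rewrite /series /= (big_cat_nat (n := N)) //= [X in _ + X]big_nat [X in _ + X]big1 ?addr0 ?big_mkord //.
by move=> i /andP[Ni _]; exact: u0.
Qed.

(** The L-polynomial is a Dirichlet series with finitely many nonzero coefficients, so abscissa 0
    and ratio 1/2 serve, with the sum of all terms scaled by 2^n as the dominating constant. *)
Lemma derive1n_Lchi mu (D : {poly F}) :
  derive1n mu (@Lchi R F D) (1 / 2) / lam%:C ^+ mu =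
  (\sum_(n < (size D).-1) (L_coef D n)%:~R * (- n%:R) ^+ mu / r ^+ (2 * n))%:C.
Proof.
have l0 := ln_q_gt0; set N := (size D).-1.
pose c n : R := if (n < N)%N then (L_coef D n)%:~R else 0.
have half : 2 * (1 / 2) <= 1 :> R by lra.
have c_bound k : exists2 M : R, 0 <= M &
    forall n, `|c n| * n%:R ^+ k * expR (- (n%:R * lam * 0)) <= M * (1 / 2) ^+ n.
  have t0 n : 0 <= `|c n| * n%:R ^+ k * 2 ^+ n by rewrite !mulr_ge0 ?exprn_ge0.
  exists (\sum_(n < N) `|c n| * n%:R ^+ k * 2 ^+ n).
    exact: sumr_ge0.
  move=> n; rewrite mulr0 oppr0 expR0 mulr1 expr_div_n expr1n mul1r ler_pdivlMr ?exprn_gt0 //.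
  have [nN|nN] := ltnP n N.
    rewrite (bigD1 (Ordinal nN)) //= lerDl sumr_ge0 //.
  have -> : c n = 0 by rewrite /c ltnNge nN.
  by rewrite normr0 mul0r mul0r sumr_ge0.
have dE m s : dirichlet c lam m s = \sum_(n < N) dirichlet_term c lam m s n.
  by apply: limn_series_finite => n Nn; rewrite /dirichlet_term /c ltnNge Nn /= mul0r mul0r.
have -> : 1 / 2 = (1 / 2)%:C :> R[i] by rewrite rmorphM fmorphV rmorph1 rmorph_nat.
rewrite (derive1n_dirichlet (ltW l0) _ half c_bound) => [||s _|].
- rewrite dE -rmorphXn -fmorphV mulr_suml rmorph_sum; apply: eq_bigr => n _.
  rewrite /dirichlet_term /c ltn_ord -rmorphM cexp_real -!rmorphM; congr (_%:C).
  have -> : expR (- (n%:R * lam) * (1 / 2)) = (r ^+ (2 * n))^-1.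
    by rewrite -expRM_natl -expRN natrM; congr expR; field.
  by rewrite -mulNr exprMn mulrA [LHS]mulrAC mulfK // expf_neq0 // gt_eqF.
- by lra.
- rewrite dE /Lchi; apply: eq_bigr => n _.
  rewrite /dirichlet_term /c ltn_ord expr0 mulr1 rmorph_int fsbig_monics; congr (_ * _).
  by rewrite /cpow rmorphN rmorphM rmorph_nat; congr cexp; ring.
- by rewrite /=; lra.
Qed.

End ComplexMoments.

(** With every analytic object replaced by a variable, the four-part right side is matched to its
    real form by algebra alone. *)
Lemma main_term_real (R : realType) (mu g : nat) (z N G1 : R[i]) (Gd : nat -> R[i])
    (J j : nat -> nat -> R[i]) (B : R) (V : nat -> nat -> R) :
  N / z = B%:C ->
  (forall m K, G1 * J m K + Gd m - \sum_(1 <= n < m.+2) j m n * Gd n = (V m K)%:C) ->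
  (-2) ^+ mu * N / z * (G1 * J mu (g %/ 2)%N + Gd mu)
      - (-2) ^+ mu * N / z * (\sum_(1 <= n < mu.+2) j mu n * Gd n)
      + 2 ^+ mu * N / z *
          (\sum_(0 <= m < mu.+1) 'C(mu, m)%:R * (- g%:R) ^+ (mu - m) *
             (G1 * J m ((g - 1) %/ 2)%N + Gd m))
      - 2 ^+ mu * N / z *
          (\sum_(0 <= m < mu.+1) 'C(mu, m)%:R * (- g%:R) ^+ (mu - m) *
             (\sum_(1 <= n < m.+2) j m n * Gd n)) =
  ((-2) ^+ mu * B * V mu (g %/ 2)%N +
   2 ^+ mu * B * \sum_(0 <= m < mu.+1) 'C(mu, m)%:R * (- g%:R) ^+ (mu - m) * V m ((g - 1) %/ 2)%N)%:C.
Proof.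
move=> BE VE; rewrite -!(mulrA _ N) BE -mulrBr VE -addrA -mulrBr -sumrB.
under [X in _ + _ * X]eq_bigr do rewrite -mulrBr VE.
rewrite rmorphD !rmorphM !rmorphXn rmorphN !rmorph_nat rmorph_sum; congr (_ + _ * _).
by apply: eq_bigr => m _; rewrite !rmorphM rmorphXn rmorphN !rmorph_nat.
Qed.

Theorem theorem3p1 (R : realType) (F : finFieldType) (mu : nat) :
  odd #|F| -> (0 < mu)%N ->
  let q : R := #|F|%:R in
  let lnq : R[i] := (ln q)%:C in
  let normD (g : nat) : R := q ^+ (2 * g + 1) in
  let Gd (m : nat) : R[i] := derive1n m (@Gseries R F) 1 / (- lnq) ^+ m in
  let G1 : R[i] := @Gseries R F 1 in
  let J (k n : nat) : R[i] := (powersum k n)%:R in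
  let j (k n : nat) : R[i] := ratr (powersum_coef k n) in
  let zeta2 : R[i] := zetaA F 2 in
  exists C : R, forall g : nat, (0 < g)%N ->
    let lhs : R[i] :=
      \sum_(D \in monic_squarefree F (2 * g + 1))
        derive1n mu (@Lchi R F D) (1 / 2) / lnq ^+ mu in
    let rhs : R[i] :=
      (-2) ^+ mu * (normD g)%:C / zeta2 * (G1 * J mu (g %/ 2)%N + Gd mu)
      - (-2) ^+ mu * (normD g)%:C / zeta2 *
          (\sum_(1 <= n < mu.+2) j mu n * Gd n)
      + 2 ^+ mu * (normD g)%:C / zeta2 *
          (\sum_(0 <= m < mu.+1) 'C(mu, m)%:R * (- g%:R) ^+ (mu - m) *
             (G1 * J m ((g - 1) %/ 2)%N + Gd m))
      - 2 ^+ mu * (normD g)%:C / zeta2 *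
          (\sum_(0 <= m < mu.+1) 'C(mu, m)%:R * (- g%:R) ^+ (mu - m) *
             (\sum_(1 <= n < m.+2) j m n * Gd n)) in
    `|lhs - rhs| <=
      (C * (normD g `^ (7 / 8) * (ln (normD g) / ln q) ^+ mu))%:C.
Proof.
move=> oq _ q lnq normD Gd G1 J j zeta2.
pose r := expR (ln q / 4).
have r_gt0 : 0 < r := expR_gt0 _.
have r4 : r ^+ 4 = q := expr_root4 R oq.
have q_gt0 : 0 < q := q_gt0R R oq.
have lnq_gt0 : 0 < ln q := ln_q_gt0 R oq.
have [C HC] := first_moment_estimate oq r_gt0 r4 mu.
(* [first_moment_estimate] gives C without a sign, and the final comparison multiplies by it. *)
exists `|C| => g g_gt0; lazy zeta.
set lhs := (X in `|X - _|); set rhs := (X in lhs - X).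
have lhsE : lhs = (first_moment F r mu g)%:C.
  rewrite /lhs fsbig_monic_squarefree /first_moment addn1.
  transitivity (\sum_(D <- monics F (2 * g).+1 | sqfree D)
    (\sum_(n < (2 * g).+1) (L_coef D n)%:~R * (- n%:R) ^+ mu / r ^+ (2 * n))%:C).
    rewrite [LHS]big_seq_cond [RHS]big_seq_cond; apply: eq_bigr => D.
    by rewrite mem_monics => /andP[/andP[_ /eqP sD] _]; rewrite derive1n_Lchi // sD.
  rewrite -rmorph_sum; congr (_%:C); rewrite exchange_big; apply: eq_bigr => n _.
  by rewrite /L_avg rmorph_sum !mulr_suml.
have zetaE : zeta2^-1 = (1 - q^-1)%:C.
  rewrite /zeta2 /zetaA invrK rmorphB rmorph1; congr (_ - _).
  have -> : 1 - 2 = (-1)%:C :> R[i] by rewrite rmorphN rmorph1; ring.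
  by rewrite /cpow -rmorphM cexp_real mulN1r expRN lnK // posrE.
have GdE m : Gd m = (gmoment R F m)%:C := derive1n_Gseries R oq m.
have G1E : G1 = (gmoment R F 0)%:C by rewrite -GdE /Gd expr0 divr1.
have mainE m K : G1 * J m K + Gd m - \sum_(1 <= n < m.+2) j m n * Gd n = (main_value R F m K)%:C.
  rewrite G1E GdE /main_value rmorphB rmorphD rmorphM rmorph_nat; congr (_ - _).
  by rewrite rmorph_sum; apply: eq_bigr => n _; rewrite GdE rmorphM fmorph_rat.
pose B := (1 - q^-1) * q ^+ (2 * g).+1.
have BE : (normD g)%:C / zeta2 = B%:C by rewrite zetaE -rmorphM mulrC /B /normD addn1.
rewrite {}/rhs (main_term_real mu g BE mainE) lhsE -rmorphB norm_complex normc_real lecR.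
apply: (le_trans (HC g g_gt0)).
have -> : ln (normD g) / ln q = (2 * g).+1%:R.
  by rewrite /normD lnXn // addn1 -(mulr_natl (ln q)) mulfK // gt_eqF.
have -> : normD g `^ (7 / 8) = expR (7 / 8 * ((2 * g).+1%:R * ln q)).
  by rewrite /powR gt_eqF ?exprn_gt0 // /normD lnXn // addn1 (mulr_natl (ln q)).
have rE : r ^+ (7 * g) = expR ((7 * g)%:R * (ln q / 4)) by rewrite expRM_natl.
rewrite rE -mulrA.
apply: (@le_trans _ _ (`|C| * ((2 * g).+1%:R ^+ mu * expR ((7 * g)%:R * (ln q / 4))))).
  by rewrite ler_wpM2r ?ler_norm // mulr_ge0 ?exprn_ge0 ?expR_ge0.
(* What remains is 7g/4 <= (7/8)(2g + 1), times ln q. *)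
rewrite ler_wpM2l // mulrC ler_wpM2r ?exprn_ge0 // ler_expR.
have -> : (2 * g).+1%:R = 2 * g%:R + 1 :> R by rewrite -(natr1 (2 * g)%N) natrM.
by rewrite natrM; lra.
Qed.
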